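(* Suppose that $\|\overline\kappa_{p_1,\omega}\|_{L_{p_1^*}}<\infty$ for any $p_1\in[1,\infty]$. Let $p_1,p_2\in[1,\infty]$ and let $\imath_{p_1,p_2}:\mathcal F_{s,p_1,p_2,\boldsymbol\gamma}\to\mathcal F_{s,p_1,p_2,\boldsymbol\gamma,\omega}$, $\imath_{p_1,p_2}(f)=f$. If $p_1\le p_2$, then $$\|\imath_{p_1,p_2}\|\le\|\imath_{1,\infty}\|^{1/p_1-1/p_2}\,\|\imath_{1,1}\|^{1/p_2}\,\|\imath_{\infty,\infty}\|^{1-1/p_1},$$ and if $p_2<p_1$, then $$\|\imath_{p_1,p_2}\|\le\|\imath_{\infty,1}\|^{1/p_2-1/p_1}\,\|\imath_{1,1}\|^{1/p_1}\,\|\imath_{\infty,\infty}\|^{1-1/p_2}.$$ For product weights ($\gamma_{\mathfrak u}=\prod_{j\in\mathfrak u}\gamma_j$ with $(\gamma_j)_{j\in\mathbb N}$ a nonincreasing sequence of positive numbers) we have $$\|\imath_{p_1,p_2}\|\le\prod_{j=1}^s\left(1+\gamma_j\|\overline\kappa_{1,\omega}\|_{L_\infty}\right)^{1/p_1}\left(1+\gamma_j\|\overline\kappa_{\infty,\omega}\|_{L_1}\right)^{1-1/p_1}.$$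
   Context: Notation. $s\in\mathbb N\cup\{\infty\}$; $[s]=\{1,\dots,s\}$ ($[\infty]=\mathbb N$); $\mathfrak u,\mathfrak v$ denote finite subsets of $[s]$; $\boldsymbol x_{\mathfrak u}=(x_j)_{j\in\mathfrak u}$. $p_i^*$ is the conjugate of $p_i\in[1,\infty]$; $1/\infty=0$. $D\subseteq\mathbb R$ is a (possibly unbounded) interval containing $0$; $\psi:D\to\mathbb R_+$ is measurable and a.e. positive; $\kappa:D\times D\to\mathbb R$ is measurable; $\omega$ is a probability density on $D$. $L_{q}=L_q(D)$ is the unweighted Lebesgue space. $L_{p_1,\psi}$ has norm $\|g\|_{L_{p_1,\psi}}=(\int_D|g(t)|^{p_1}\psi(t)\,\mathrm dt)^{1/p_1}$; for nonempty $\mathfrak u$, $L_{\mathfrak u,p_1,\psi}$ consists of functions on $D^{|\mathfrak u|}$ with norm $(\int_{D^{|\mathfrak u|}}|g_{\mathfrak u}(\boldsymbol t_{\mathfrak u})|^{p_1}\prod_{j\in\mathfrak u}\psi(t_j)\,\mathrm d\boldsymbol t_{\mathfrak u})^{1/p_1}$; for $p_1=\infty$ these are essential suprema and $\psi^{1/p_1}=1$. For $\mathfrak u=\emptyset$, $L_{\emptyset,p_1,\psi}$ is the space of constants with the absolute value. For nonempty $\mathfrak u$, $$K_{\mathfrak u}(g_{\mathfrak u})(\boldsymbol x_{\mathfrak u})=\int_{D^{|\mathfrak u|}}g_{\mathfrak u}(\boldsymbol t_{\mathfrak u})\prod_{j\in\mathfrak u}\kappa(x_j,t_j)\,\mathrm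 d\boldsymbol t_{\mathfrak u},\qquad K_{\mathfrak u,\omega}(g_{\mathfrak u})(\boldsymbol x_{\mathfrak u})=\int_{D^{|\mathfrak u|}}g_{\mathfrak u}(\boldsymbol t_{\mathfrak u})\prod_{j\in\mathfrak u}\big(\kappa(x_j,t_j)-I(\kappa(\cdot,t_j))\big)\,\mathrm d\boldsymbol t_{\mathfrak u},$$ where $I(f)=\int_Df(x)\omega(x)\,\mathrm dx$; $K_\emptyset$, $K_{\emptyset,\omega}$ are the identity on constants. Standing assumptions, for all parameters $p_1,p_2\in[1,\infty]$ involved: $\widehat\kappa_{p_1}(x)=\big(\int_D(|\kappa(x,t)|/\psi^{1/p_1}(t))^{p_1^*}\,\mathrm dt\big)^{1/p_1^*}<\infty$ for all $x\in D$ (essential supremum over $t$ if $p_1^*=\infty$); each $K_{\mathfrak u}$ is injective ($K_{\mathfrak u}(g_{\mathfrak u})\equiv0$ implies $g_{\mathfrak u}=0$ a.e.); $\kappa(0,\cdot)\equiv0$; and $\big(\sum_{\mathfrak u}(\gamma_{\mathfrak u}\prod_{j\in\mathfrak u}\widehat\kappa_{p_1}(x_j))^{p_2^*}\big)^{1/p_2^*}<\infty$ for all $\boldsymbol x\in D^s$ (automatic if $s<\infty$). Also $$\overline\kappa_{p_1,\omega}(t)=\int_D\frac{|\kappa(x,t)|}{\psi^{1/p_1}(t)}\,\omega(x)\,\mathrm dx .$$ Weights $\gamma_{\mathfrak u}\ge0$ are such that $\gamma_{\mathfrak u}>0$ implies $\gamma_{\mathfrak v}>0$ for all $\mathfrak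 v\subseteq\mathfrak u$. Only components with $\gamma_{\mathfrak u}>0$ are present in the spaces below. $\mathcal F_{s,p_1,p_2,\boldsymbol\gamma}$ is the Banach space of $f=\sum_{\mathfrak u}K_{\mathfrak u}(g_{\mathfrak u})$, $g_{\mathfrak u}\in L_{\mathfrak u,p_1,\psi}$, with norm $\big(\sum_{\mathfrak u}\gamma_{\mathfrak u}^{-p_2}\|g_{\mathfrak u}\|_{L_{\mathfrak u,p_1,\psi}}^{p_2}\big)^{1/p_2}$ (supremum if $p_2=\infty$). $\mathcal F_{s,p_1,p_2,\boldsymbol\gamma,\omega}$ is the space of $f=\sum_{\mathfrak u}K_{\mathfrak u,\omega}(g_{\mathfrak u})$ with norm $\big(\sum_{\mathfrak u}\gamma_{\mathfrak u}^{-p_2}\|g_{\mathfrak u}\|_{L_{\mathfrak u,p_1,\psi}}^{p_2}\big)^{1/p_2}$ (same conventions). Under the condition on the weights the two spaces coincide as sets of functions. $\|\imath_{p_1,p_2}\|$ is the operator norm. If $s=\infty$, the spaces are the completions of the finite sums with respect to these norms, $\imath_{p_1,p_2}$ is considered on finite sums (and extended by continuity when bounded), and norms and products may be $+\infty$. *)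

(* Defs.v *)
From HB Require Import structures.
From mathcomp Require Import all_boot all_order all_algebra finmap.
From mathcomp Require Import all_classical all_reals all_analysis.
Import Order.TTheory GRing.Theory Num.Theory.
Import numFieldNormedType.Exports.

Set Implicit Arguments.
Unset Strict Implicit.
Unset Printing Implicit Defensive.

Local Open Scope classical_set_scope.
Local Open Scope ring_scope.

(* Lebesgue measure on n-tuples of reals (for the product Borel sigma-algebra),
   by recursion on n: transport of the product of the one-dimensional measure
   with the n-dimensional one; in dimension 0, the unit mass at the empty
   tuple. *)
Section lebesgue_tuple.
Context {R : realType}.
Local Open Scope ereal_scope.
Notation T := (measurableTypeR R).

Section step.
Context (n : nat) (m : {sigma_finite_measure set (n.-tuple T) -> \bar R}).

Definition tcons (p : T * n.-tuple T) : n.+1.-tuple T := [tuple of p.1 :: p.2].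

Definition tuncons (t : n.+1.-tuple T) : T * n.-tuple T :=
  (thead t, [tuple of behead t]).

Lemma tconsK : cancel tcons tuncons.
Proof. by move=> [x t]; congr pair; apply: val_inj. Qed.

Lemma measurable_tcons : measurable_fun [set: T * n.-tuple T] tcons.
Proof. exact: measurable_cons. Qed.

Lemma measurable_tuncons : measurable_fun [set: n.+1.-tuple T] tuncons.
Proof.
by apply: measurable_fun_pair; [exact: measurable_tnth|exact: measurable_behead].
Qed.

Definition lebesgue_cons (A : set (n.+1.-tuple T)) : \bar R :=
  pushforward (lebesgue_measure \x m) tcons A.

Let lebesgue_cons0 : lebesgue_cons set0 = 0.
Proof. by rewrite /lebesgue_cons /pushforward preimage_set0 measure0. Qed.

Let lebesgue_cons_ge0 A : 0 <= lebesgue_cons A.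
Proof. by rewrite /lebesgue_cons /pushforward; exact: measure_ge0. Qed.

Let lebesgue_cons_sigma_additive : semi_sigma_additive lebesgue_cons.
Proof.
move=> F mF tF mUF; rewrite /lebesgue_cons /pushforward preimage_bigcup.
have mtF i : measurable (tcons @^-1` F i).
  by rewrite -[X in measurable X]setTI; exact: measurable_tcons.
apply: measure_semi_sigma_additive => //; last exact: bigcup_measurable.
apply/trivIsetP => /= i j _ _ ij; rewrite -preimage_setI.
by move/trivIsetP : tF => /(_ _ _ _ _ ij) ->//; rewrite preimage_set0.
Qed.

HB.instance Definition _ := isMeasure.Build _ _ _
  lebesgue_cons lebesgue_cons0 lebesgue_cons_ge0 lebesgue_cons_sigma_additive.

Let lebesgue_cons_sigma_finite : sigma_finite setT lebesgue_cons.
Proof.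
have /sigma_finiteP[F [TF ndF Foo]] :=
  sigma_finiteT (lebesgue_measure : {sigma_finite_measure set T -> \bar R}).
have /sigma_finiteP[G [TG ndG Goo]] := sigma_finiteT m.
exists (fun k => tuncons @^-1` (F k `*` G k)).
  rewrite -preimage_bigcup (_ : \bigcup_k (F k `*` G k) = setT) ?preimage_setT//.
  rewrite -setXTT TF TG predeqE => -[x y]; split.
    by move=> [k _ []/= ? ?]; split; exists k.
  move=> [/= [k _ Fkx] [l _ Gly]]; exists (maxn k l) => //; split.
  - by move: x Fkx; exact/subsetPset/ndF/leq_maxl.
  - by move: y Gly; exact/subsetPset/ndG/leq_maxr.
move=> k; have [? ?] := Foo k; have [? ?] := Goo k.
have mFG : measurable (F k `*` G k) by exact: measurableX.
split; first by rewrite -[X in measurable X]setTI; exact: measurable_tuncons.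
rewrite /lebesgue_cons /pushforward -comp_preimage.
rewrite (_ : tuncons \o tcons = id); last exact/funext/tconsK.
by rewrite product_measure1E// lte_mul_pinfty// ge0_fin_numE.
Qed.

HB.instance Definition _ := Measure_isSigmaFinite.Build _ _ _
  lebesgue_cons lebesgue_cons_sigma_finite.

End step.

Fixpoint lebesgue_tuple n : {sigma_finite_measure set (n.-tuple T) -> \bar R} :=
  match n with
  | 0 => \d_([tuple] : 0.-tuple T)
  | n'.+1 => lebesgue_cons (lebesgue_tuple n')
  end.

End lebesgue_tuple.

(* s = None stands for s = oo; coordinates are numbered from 1. *)
Definition coords (s : option nat) : set nat :=
  [set j | (0 < j)%N && (if s is Some m then (j <= m)%N else true)].

(* The l_q norm, with values in [0, +oo], of a family of nonnegative extended
   reals indexed by U. The element 0 makes the supremum over an empty U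
   equal to 0. *)
Definition lq_norm (R : realType) (I : choiceType) (q : \bar R) (U : set I)
    (a : I -> \bar R) : \bar R :=
  (match q with
   | r%:E => (\esum_(i in U) a i `^ r) `^ r^-1
   | _ => ereal_sup (0 |` (a @` U))
   end)%E.

Section spaces.
Context {R : realType}.
Variables (s : option nat) (D : interval R).
Variables (psi omega : R -> R) (kappa : R -> R -> R) (gamma : {fset nat} -> R).

Notation T := (measurableTypeR R).
Notation mu := (@lebesgue_measure R).
Notation mun n := (@lebesgue_tuple R n).

(* D^n *)
Definition cube n : set (n.-tuple T) := [set t | forall i, tnth t i \in D].

(* 1/p as a real number, with 1/oo = 0 *)
Definition expo (p : \bar R) : R := fine (p^-1)%E.

(* The norm of L_{u,p,psi} for a set u with n elements, written as the
   unweighted L_p norm of g * (\prod_j psi (t_j)) ^ (1/p) on D^n (for p = oo the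
   weight is psi ^ 0 = 1). For n = 0 it is the absolute value of the constant. *)
Definition L_norm n (p : \bar R) (g : n.-tuple T -> R) : \bar R :=
  ('N[mun n]_p [
    (fun t => (g t * (\prod_(i < n) psi (tnth t i)) `^ expo p)%:E) \_ (@cube n)])%E.

Definition L_space n (p : \bar R) (g : n.-tuple T -> R) : Prop :=
  measurable_fun (@cube n) g /\ (L_norm p g < +oo)%E.

(* K_u for a set u with n elements and a univariate kernel k. *)
Definition Kop (k : R -> R -> R) n (g : n.-tuple T -> R) (x : n.-tuple T) : R :=
  \int[mun n]_(t in @cube n) (g t * \prod_(i < n) k (tnth x i) (tnth t i)).

(* kappa(x,t) - I(kappa(.,t)); K_{u,omega} is Kop kappa_anova. *)
Definition kappa_anova (x t : R) : R :=
  kappa x t - \int[mu]_(z in [set` D]) (kappa z t * omega z).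

(* x_u, the elements of u being listed in the order of the sequence
   underlying u. *)
Definition restr (x : nat -> R) (u : {fset nat}) : #|` u|.-tuple T :=
  [tuple x (nth 0%N u i) | i < #|` u|].

(* A component family g is taken over a finite set U of indices: f is the sum,
   over u in U, of K_u (g_u), as a function on D^s. *)
Definition represents (k : R -> R -> R) (p1 : \bar R) (f : (nat -> R) -> R)
    (U : {fset {fset nat}}) (g : forall u : {fset nat}, #|` u|.-tuple T -> R) :=
  [/\ forall u, u \in U -> [set` u] `<=` coords s /\ 0 < gamma u,
      forall u, u \in U -> L_space p1 (g u) &
      forall x : nat -> R, (forall j, coords s j -> x j \in D) ->
        f x = \sum_(u <- U) Kop k (g u) (restr x u)].

(* The finite sums in F_{s,p1,p2,gamma} (k = kappa) or F_{s,p1,p2,gamma,omega}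
   (k = kappa_anova). This is the whole space if s is finite, and a subspace
   whose completion is the space if s is infinite. *)
Definition in_space (k : R -> R -> R) (p1 : \bar R) (f : (nat -> R) -> R) : Prop :=
  exists U g, represents k p1 f U g.

Definition components_norm (p1 p2 : \bar R) (U : {fset {fset nat}})
    (g : forall u : {fset nat}, #|` u|.-tuple T -> R) : \bar R :=
  lq_norm p2 [set` U] (fun u => ((gamma u)^-1%:E * L_norm p1 (g u))%E).

(* The components of f are unique (up to null sets) when the operators K_u are
   injective; the infimum is then the common value of components_norm over all
   representations of f. It is +oo when f has no representation. *)
Definition space_norm (k : R -> R -> R) (p1 p2 : \bar R)
    (f : (nat -> R) -> R) : \bar R :=
  ereal_inf [set N | exists U g,
    represents k p1 f U g /\ N = components_norm p1 p2 U g].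

(* The operator norm of f |-> f from F_{s,p1,p2,gamma} to
   F_{s,p1,p2,gamma,omega}, possibly +oo. *)
Definition embedding_norm (p1 p2 : \bar R) : \bar R :=
  ereal_sup [set space_norm kappa_anova p1 p2 f | f in
    [set f | in_space kappa p1 f /\ (space_norm kappa p1 p2 f <= 1)%E]].

Definition kappa_hat (p1 : \bar R) (x : R) : \bar R :=
  ('N[mu]_(hoelder_conjugate p1) [
    (fun t => (`|kappa x t| / psi t `^ expo p1)%:E) \_ [set` D]])%E.

Definition kappa_bar (p1 : \bar R) (t : R) : \bar R :=
  (\int[mu]_(x in [set` D]) (`|kappa x t| / psi t `^ expo p1 * omega x)%:E)%E.

(* The norm of kappa_bar in the unweighted space L_{p1*}(D). *)
Definition kappa_bar_norm (p1 : \bar R) : \bar R :=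
  ('N[mu]_(hoelder_conjugate p1) [(kappa_bar p1) \_ [set` D]])%E.

Definition injective_K (p1 : \bar R) : Prop :=
  forall u : {fset nat}, [set` u] `<=` coords s ->
  forall g : #|` u|.-tuple T -> R, L_space p1 g ->
    (forall x, @cube _ x -> Kop kappa g x = 0) ->
    {ae mun #|` u|, forall t, @cube _ t -> g t = 0}.

Definition summable_kappa_hat (p1 p2 : \bar R) : Prop :=
  forall x : nat -> R, (forall j, coords s j -> x j \in D) ->
    (lq_norm (hoelder_conjugate p2) [set u : {fset nat} | [set` u] `<=` coords s]
      (fun u => (gamma u)%:E * \prod_(j <- u) kappa_hat p1 (x j)) < +oo)%E.

Definition standing_assumptions (p1 p2 : \bar R) : Prop :=
  [/\ forall x, x \in D -> (kappa_hat p1 x < +oo)%E,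
      injective_K p1 & summable_kappa_hat p1 p2].

Definition downward_closed_weights : Prop :=
  (forall u, [set` u] `<=` coords s -> 0 <= gamma u) /\
  (forall u v : {fset nat}, [set` u] `<=` coords s ->
    fsubset v u -> 0 < gamma u -> 0 < gamma v).

End spaces.

(* \prod_{j=1}^s a_j, a limit of partial products if s is infinite. *)
Definition coords_prod (R : realType) (s : option nat) (a : nat -> \bar R) : \bar R :=
  (match s with
   | Some m => \prod_(1 <= j < m.+1) a j
   | None => limn (fun m => \prod_(1 <= j < m.+1) a j)
   end)%E.

(* Main.v *)
(* With m(t) = I(kappa(., t)), expanding kappa = (kappa - m) + m turns
   sum_u K_u(g_u) into sum_v K_{v,omega}(h_v), where
   h_v = sum_{u >= v} \int g_u prod_{j in u \ v} m(t_j) dt_{u \ v}.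
   Put M = ess sup |m|/psi, B = \int |m|, and let k = |u \ v|. Hoelder's
   inequality for the measure |m| dt bounds the u-th summand of h_v, in
   L_{v,p1,psi}, by M^(k/p1) B^(k(1-1/p1)) |g_u|, so that the norm of the embedding
   is at most the l_{p2} norm of the matrix
   (gamma_u/gamma_v M^k)^(1/p1) (gamma_u/gamma_v B^k)^(1-1/p1).
   Tensor products of functions e with the sign of m, of norm 1 and with
   \int e m close to M (p1 = 1) or equal to B (p1 = oo), show that the row and
   column sums of the matrices gamma_u/gamma_v M^k and gamma_u/gamma_v B^k are
   bounded by the norms of the embeddings for p1, p2 in {1, oo}; this uses that
   the components h_v are unique. Schur's test and Hoelder's inequality for finite
   sums then interpolate. For product weights, the row and column sums are bounded
   by prod_j (1 + gamma_j M) and prod_j (1 + gamma_j B). *)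

Require Import Defs.
From mathcomp Require Import all_boot all_order all_algebra finmap.
From mathcomp Require Import all_classical all_reals all_analysis.
From mathcomp Require Import measurable_realfun ess_sup_inf ring lra.
Import Order.TTheory GRing.Theory Num.Theory.
Import numFieldNormedType.Exports.

Set Implicit Arguments.
Unset Strict Implicit.
Unset Printing Implicit Defensive.

Local Open Scope classical_set_scope.
Local Open Scope ring_scope.

(** * Lebesgue measure on tuples *)

Section tuple_integral.
Context {R : realType}.
Local Notation T := (measurableTypeR R).
Local Notation mu := (@lebesgue_measure R).
Local Notation mun n := (@lebesgue_tuple R n).
Local Open Scope ereal_scope.

(** The endpoint norms enter only through finite matrices: on a finite family U they bound row sums
    (target l_oo) and column sums (target l_1). With theta = 1/p1 and e = 1/p2, the entries for p1
    are geometric means K = P^theta Q^(1-theta) of the entries P for M and Q for B, and the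
    exponents of the theorem are those of the factorisations K = S^(1-e) Z^e to which Schur's test
    applies. If e <= theta, Z = P and S mixes P and Q; if theta < e, S = Q and Z mixes them. Three
    obstacles shape the rest. The elements of v and u \ v interleave in the tuple t_u, so splitting
    an integral over D^u requires a reordering of variables, done on integrals over labelled
    coordinates. M is an essential supremum that need not be attained, so the lower bounds hold for
    constants c >= M - eps and pass to the limit because a finite row or column sum is a polynomial
    in c. Endpoint norms may be +oo, possibly with exponent 0; as all of them are at least 1 once
    some component is present, the product in the theorem is finite only if each power is. *)

Lemma integral_tuple0 (G : 0.-tuple T -> \bar R) :
  measurable_fun [set: 0.-tuple T] G -> \int[mun 0]_t G t = G [tuple].
Proof. by move=> mG; rewrite integral_dirac// diracT mul1e. Qed.

Lemma ge0_integral_tupleS n (G : n.+1.-tuple T -> \bar R) :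
  measurable_fun [set: n.+1.-tuple T] G -> (forall t, 0 <= G t) ->
  \int[mun n.+1]_t G t = \int[mu]_a \int[mun n]_t G (tcons (a, t)).
Proof.
move=> mG G0; have mt := @measurable_tcons R n.
transitivity (\int[mu \x mun n]_z G (tcons z)).
  have := @ge0_integral_pushforward _ _ _ _ _ _ mt (mu \x mun n) setT G
    measurableT mG (fun t _ => G0 t).
  by rewrite preimage_setT => <-; exact: eq_measure_integral.
by rewrite fubini_tonelli1//; exact: measurableT_comp mG mt.
Qed.

End tuple_integral.

(** * Iterated integrals over labelled coordinates *)

Section environment_integral.
Context {R : realType}.
Local Notation T := (measurableTypeR R).
Local Notation mu := (@lebesgue_measure R).
Local Notation mun n := (@lebesgue_tuple R n).
Local Open Scope ereal_scope.
Implicit Types (l : seq nat) (x : nat -> T) (F : (nat -> T) -> \bar R).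

Definition upd x (j : nat) (a : T) : nat -> T := fun i => if i == j then a else x i.

Definition ins l n (t : n.-tuple T) x : nat -> T :=
  fun j => if j \in l then nth 0%R t (index j l) else x j.

(* Measurability on the infinite product nat -> R is only tested along
   measurable families e of points. This is stable under updating coordinates
   and integrating over them, and no sigma-algebra on nat -> R is needed. *)
Definition env_measurable F := forall d (O : measurableType d) (e : O -> nat -> T),
  (forall j, measurable_fun [set: O] (fun w => e w j)) ->
  measurable_fun [set: O] (fun w => F (e w)).

(** Here the order of integration is a list of labels, so that a change of order is a permutation of
    that list; on tuples it would be a reindexing of the integrand. *)
Fixpoint env_integral l F x : \bar R :=
  if l is j :: l' then \int[mu]_a env_integral l' F (upd x j a) else F x.

Lemma env_integral_ge0 l F : (forall x, 0 <= F x) -> forall x, 0 <= env_integral l F x.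
Proof.
by move=> F0; elim: l => [//|j l IH] x /=; apply: integral_ge0 => a _; exact: IH.
Qed.

Lemma measurable_upd d (O : measurableType d) (e : O -> nat -> T) (f : O -> T) j :
  (forall i, measurable_fun [set: O] (fun w => e w i)) -> measurable_fun [set: O] f ->
  forall i, measurable_fun [set: O] (fun w => upd (e w) j (f w) i).
Proof. by move=> me mf i; rewrite /upd; case: (i == j). Qed.

Lemma measurable_ins d (O : measurableType d) (e : O -> nat -> T) n
    (f : O -> n.-tuple T) l :
  (forall i, measurable_fun [set: O] (fun w => e w i)) -> measurable_fun [set: O] f ->
  forall i, measurable_fun [set: O] (fun w => ins l (f w) (e w) i).
Proof.
move=> me mf i; rewrite /ins; case: (i \in l) => //.
case: (leqP n (index i l)) => [gen|ltn].
  rewrite (_ : (fun _ => _) = cst 0%R)//.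
  by apply/funext => w; apply: nth_default; rewrite size_tuple.
rewrite (_ : (fun _ => _) = (fun t => tnth t (Ordinal ltn)) \o f).
  exact: measurableT_comp (measurable_tnth _) mf.
by apply/funext => w /=; rewrite (tnth_nth 0%R).
Qed.

Lemma env_measurable_integral l F :
  (forall x, 0 <= F x) -> env_measurable F -> env_measurable (env_integral l F).
Proof.
move=> F0 mF; elim: l => [//|j l IH] d O e me /=.
(* The integration variable is adjoined to the parameters; measurability in the remaining parameters
   is then part of Tonelli's theorem. *)
pose G (z : O * T) := env_integral l F (upd (e z.1) j z.2).
have mG : measurable_fun [set: O * T] G.
  apply: IH => i; apply: measurable_upd => // k.
  exact: measurableT_comp (me k) _.
apply: (measurable_fun_fubini_tonelli_F (m2 := mu) G mG) => z.
exact: env_integral_ge0.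
Qed.

Lemma env_integral_cat l1 l2 F x :
  env_integral (l1 ++ l2) F x = env_integral l1 (env_integral l2 F) x.
Proof.
by elim: l1 x => [//|j l1 IH] x /=; apply: eq_integral => a _; exact: IH.
Qed.

Lemma env_integral_swap i j F x : (forall x, 0 <= F x) -> env_measurable F ->
  env_integral [:: i; j] F x = env_integral [:: j; i] F x.
Proof.
move=> F0 mF /=; have [->//|ij] := eqVneq i j.
transitivity (\int[mu]_b \int[mu]_a F (upd (upd x i a) j b)).
  have := @fubini_tonelli _ _ _ _ _ mu mu (fun z => F (upd (upd x i z.1) j z.2)).
  apply => [|z//]; apply: mF => k; apply: measurable_upd => // k'.
  exact: measurable_upd.
apply: eq_integral => b _; apply: eq_integral => a _; congr F.
apply/funext => k; rewrite /upd; case: (eqVneq k j) => // ->.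
by rewrite eq_sym (negPf ij).
Qed.

Lemma env_integral_front l1 j l2 F x : (forall x, 0 <= F x) -> env_measurable F ->
  env_integral (l1 ++ j :: l2) F x = env_integral (j :: l1 ++ l2) F x.
Proof.
move=> F0 mF; elim: l1 x => [//|i l1 IH] x.
have -> : (i :: l1) ++ j :: l2 = [:: i] ++ (l1 ++ j :: l2) by [].
rewrite env_integral_cat.
transitivity (env_integral [:: i; j] (env_integral (l1 ++ l2) F) x).
  by apply: eq_integral => a _; exact: IH.
rewrite env_integral_swap//; first exact: env_integral_ge0.
exact: env_measurable_integral.
Qed.

Lemma env_integral_perm l1 l2 F x : (forall x, 0 <= F x) -> env_measurable F ->
  perm_eq l1 l2 -> env_integral l1 F x = env_integral l2 F x.
Proof.
move=> F0 mF; elim: l1 l2 x => [|j l1 IH] l2 x.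
  by rewrite perm_sym => /perm_nilP ->.
move=> p; have jl2 : j \in l2 by rewrite -(perm_mem p) mem_head.
case/splitPr: jl2 p => s1 s2 p.
rewrite env_integral_front//=; apply: eq_integral => a _; apply: IH.
by rewrite -(perm_cons j) (perm_trans p)// -cat_rcons -cats1 -catA perm_catCA.
Qed.

Lemma env_integral_tuple l F x : (forall x, 0 <= F x) -> env_measurable F -> uniq l ->
  env_integral l F x = \int[mun (size l)]_t F (ins l t x).
Proof.
move=> F0 mF; elim: l x => [|j l IH] x.
  move=> _; rewrite integral_tuple0//; apply: mF => j; exact: measurable_ins.
move=> /= /andP[jl ul]; rewrite ge0_integral_tupleS//; last first.
  by apply: mF => i; exact: measurable_ins.
apply: eq_integral => a _; rewrite IH//; apply: eq_integral => t _.
congr F; apply/funext => i; rewrite /ins /upd inE /=.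
by have [->|ij] /= := eqVneq i j; rewrite ?(negPf jl) ?eqxx// eq_sym (negPf ij).
Qed.

End environment_integral.

(** * Tuples labelled by finite sets, and the splitting of their integrals *)

Section tuple_coordinates.
Context {R : realType}.
Local Notation T := (measurableTypeR R).
Local Notation mu := (@lebesgue_measure R).
Local Notation mun n := (@lebesgue_tuple R n).
Implicit Types (u v w : {fset nat}).

(* The coordinate of t labelled by j, the coordinates being labelled by the
   elements of u as in [restr]. *)
Definition coord u (t : #|` u|.-tuple T) (j : nat) : T := nth 0 t (index j u).

(** The identification of D^v x D^w with D^u when u is the disjoint union of v and w. Concatenation
    does not suffice, because the labels of v and w may interleave in the enumeration of u. *)
Definition merge u v w (z : #|` v|.-tuple T * #|` w|.-tuple T) : #|` u|.-tuple T :=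
  [tuple let j := nth 0%N u i in if j \in v then coord z.1 j else coord z.2 j
  | i < #|` u|].

Lemma mem_nth_fset u (i : 'I_#|` u|) : nth 0%N u i \in u.
Proof. by apply: mem_nth. Qed.

Lemma coord_nth u (t : #|` u|.-tuple T) (i : 'I_#|` u|) :
  coord t (nth 0%N u i) = tnth t i.
Proof. by rewrite /coord index_uniq ?fset_uniq// (tnth_nth 0). Qed.

Lemma coord_restr (x : nat -> R) u j : j \in u -> coord (restr x u) j = x j.
Proof.
move=> ju; have ltj : (index j u < #|` u|)%N by rewrite index_mem.
by rewrite /coord -(tnth_nth _ _ (Ordinal ltj)) tnth_mktuple nth_index.
Qed.

Lemma eq_coord u (t t' : #|` u|.-tuple T) :
  {in u, forall j, coord t j = coord t' j} -> t = t'.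
Proof.
by move=> tt'; apply: eq_from_tnth => i; rewrite -!coord_nth tt'// mem_nth_fset.
Qed.

Lemma restr_ins u (t : #|` u|.-tuple T) x : restr (ins u t x) u = t.
Proof. by apply: eq_coord => j ju; rewrite coord_restr// /ins ju. Qed.

Lemma coord_merge u v w z j : j \in u ->
  coord (@merge u v w z) j = if j \in v then coord z.1 j else coord z.2 j.
Proof.
move=> ju; have ltj : (index j u < #|` u|)%N by rewrite index_mem.
by rewrite /coord -(tnth_nth _ _ (Ordinal ltj)) tnth_mktuple nth_index.
Qed.

Lemma measurable_coord u j : measurable_fun setT (fun t : #|` u|.-tuple T => coord t j).
Proof.
rewrite /coord; case: (leqP #|` u| (index j u)) => [gen|ltn].
  rewrite (_ : (fun _ => _) = cst 0)//.
  by apply/funext => t; apply: nth_default; rewrite size_tuple.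
rewrite (_ : (fun _ => _) = (fun t : #|` u|.-tuple T => tnth t (Ordinal ltn))).
  exact: measurable_tnth.
by apply/funext => t /=; rewrite (tnth_nth 0).
Qed.

Lemma measurable_merge u v w : measurable_fun setT (@merge u v w).
Proof.
apply/measurable_fun_tnthP => i.
rewrite (_ : _ \o _ = fun z => if nth 0%N u i \in v then coord z.1 (nth 0%N u i)
   else coord z.2 (nth 0%N u i)); last by apply/funext => z; rewrite /= tnth_mktuple.
case: (_ \in v).
  have h1 := measurable_coord (u := v) (nth 0%N u i).
  have h2 := measurableT_comp h1 (@measurable_fst _ _ (#|` v|.-tuple T) (#|` w|.-tuple T)).
  exact: h2.
apply: (measurableT_comp (measurable_coord (u := w) (nth 0%N u i))).
exact: measurable_snd.
Qed.

(** Read as a function of a point of nat -> R, [G] has an iterated integral along the list u.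
    Permuting the list to [v ++ w] and grouping the two blocks gives the product measure. *)
Lemma ge0_integral_merge u v w (G : #|` u|.-tuple T -> \bar R) :
  perm_eq u (v ++ w) -> measurable_fun setT G -> (forall t, 0 <= G t)%E ->
  (\int[mun #|` u|]_t G t = \int[mun #|` v| \x mun #|` w|]_z G (merge u z))%E.
Proof.
move=> uvw mG G0; pose F (x : nat -> T) := G (restr x u).
have mF : env_measurable F.
  move=> d O e me; apply: measurableT_comp mG _; apply/measurable_fun_tnthP => i.
  rewrite (_ : _ \o _ = fun o => e o (nth 0%N u i))//.
  by apply/funext => o; rewrite /= tnth_mktuple.
have F0 x : (0 <= F x)%E by exact: G0.
transitivity (env_integral u F (cst 0)).
  rewrite (env_integral_tuple _ F0 mF (fset_uniq u)); apply: eq_integral => t _.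
  by rewrite /F restr_ins.
rewrite (env_integral_perm _ F0 mF uvw) env_integral_cat.
rewrite (env_integral_tuple _ (env_integral_ge0 w F0)
  (@env_measurable_integral _ w _ F0 mF) (fset_uniq v)).
have mGm := measurableT_comp mG (@measurable_merge u v w).
rewrite (fubini_tonelli1 (fun z => G (merge u z)) mGm (fun z => G0 _)).
apply: eq_integral => a _; rewrite (env_integral_tuple _ F0 mF (fset_uniq w)).
apply: eq_integral => b _; rewrite /F; congr G; apply: eq_coord => j ju.
rewrite coord_restr// coord_merge// /ins.
have : uniq (v ++ w) by rewrite -(perm_uniq uvw) fset_uniq.
 rewrite cat_uniq => /and3P[_ /hasPn vw _].
case: ifPn => [jw|jw]; first by rewrite (negPf (vw _ jw)).
by move: ju; rewrite (perm_mem uvw) mem_cat (negPf jw) orbF => ->.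
Qed.

Lemma integral_merge u v w (G : #|` u|.-tuple T -> \bar R) :
  perm_eq u (v ++ w) -> measurable_fun setT G ->
  (\int[mun #|` u|]_t G t = \int[mun #|` v| \x mun #|` w|]_z G (merge u z))%E.
Proof.
move=> uvw mG; rewrite integralE [RHS]integralE.
rewrite (ge0_integral_merge uvw (measurable_funepos mG) (funepos_ge0 G)).
rewrite (ge0_integral_merge uvw (measurable_funeneg mG) (funeneg_ge0 G)).
by congr (_ - _)%E; apply: eq_integral => z _; rewrite ?funeposE ?funenegE.
Qed.

Lemma prod_coord u (t : #|` u|.-tuple T) (f : nat -> T -> R) :
  \prod_(i < #|` u|) f (nth 0%N u i) (tnth t i) = \prod_(j <- u) f j (coord t j).
Proof.
rewrite (big_nth 0%N) big_mkord; apply: eq_bigr => i _.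
by rewrite coord_nth.
Qed.

Lemma prod_merge u v w (z : #|` v|.-tuple T * #|` w|.-tuple T) (f : nat -> T -> R) : perm_eq u (v ++ w) ->
  \prod_(j <- u) f j (coord (merge u z) j) =
  \prod_(j <- v) f j (coord z.1 j) * \prod_(j <- w) f j (coord z.2 j).
Proof.
move=> uvw; rewrite big_seq.
under eq_bigr => j ju do rewrite coord_merge//.
rewrite -big_seq (perm_big _ uvw) big_cat/=.
have : uniq (v ++ w) by rewrite -(perm_uniq uvw) fset_uniq.
rewrite cat_uniq => /and3P[_ /hasPn vw _].
congr *%R; rewrite big_seq [RHS]big_seq; apply: eq_bigr => j jv.
  by rewrite jv.
by rewrite (negPf (vw _ jv)).
Qed.

Lemma ge0_integral_prod n (f : 'I_n -> T -> R) :
  (forall i, measurable_fun setT (f i)) -> (forall i t, 0 <= f i t) ->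
  (\int[mun n]_t (\prod_(i < n) f i (tnth t i))%:E = \prod_(i < n) \int[mu]_a (f i a)%:E)%E.
Proof.
elim: n f => [|n IH] f mf f0.
  under eq_integral do rewrite big_ord0.
  by rewrite integral_tuple0 ?big_ord0//.
have mprod k (g : 'I_k -> T -> R) : (forall i, measurable_fun setT (g i)) ->
    measurable_fun setT (fun t : k.-tuple T => (\prod_(i < k) g i (tnth t i))%:E).
  move=> mg; apply/measurable_EFinP; apply: measurable_prod => i _.
  exact: measurableT_comp (mg i) (measurable_tnth i).
rewrite (ge0_integral_tupleS (mprod _ _ mf)); last first.
  by move=> t; rewrite lee_fin; apply: prodr_ge0.
rewrite big_ord_recl -IH //.
have Ige0 : (0 <= \int[mun n]_t (\prod_(i < n) f (lift ord0 i) (tnth t i))%:E)%E.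
  by apply: integral_ge0 => t _; rewrite lee_fin; exact: prodr_ge0.
rewrite -ge0_integralZr//; last 2 first.
- exact/measurable_EFinP.
- by move=> a _; rewrite lee_fin.
apply: eq_integral => a _; rewrite -ge0_integralZl//; last 3 first.
- exact: (mprod _ (fun i => f (lift ord0 i)) (fun i => mf _)).
- by move=> t _; rewrite lee_fin; apply: prodr_ge0.
- by rewrite lee_fin.
apply: eq_integral => t _; rewrite big_ord_recl EFinM; congr (_ * (_)%:E)%E.
by apply: eq_bigr => i _; rewrite tnthS.
Qed.

(** A cylinder over a null set is null: its measure is a product with one factor 0, and 0 times +oo
    is 0. Finitely many coordinates are then combined. *)
Lemma ae_tuple n (P : 'I_n -> set T) :
  (forall i, {ae mu, forall a, P i a}) ->
  {ae mun n, forall t, forall i, P i (tnth t i)}.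
Proof.
move=> aeP.
have aei (i : 'I_n) : {ae mun n, forall t, P i (tnth t i)}.
  have [N [mN N0 PN]] := aeP i.
  have mtN : measurable ((fun t : n.-tuple T => tnth t i) @^-1` N).
    by rewrite -[X in measurable X]setTI; exact: measurable_tnth.
  exists ((fun t => tnth t i) @^-1` N); split => //; last by move=> t; exact: PN.
  rewrite -[X in mun n X]setIT -integral_indic//.
  pose f k : T -> R := if k == i then \1_N else cst 1.
  transitivity (\int[mun n]_t (\prod_(k < n) f k (tnth t k))%:E)%E.
    apply: eq_integral => t _; rewrite (bigD1 i)//= big1.
      by rewrite /f eqxx mulr1.
    by move=> k ki; rewrite /f (negPf ki).
  rewrite ge0_integral_prod; last 2 first.
  - by move=> k; rewrite /f; case: ifP.
  - by move=> k t; rewrite /f; case: ifP.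
  rewrite (bigD1 i)//= {1}/f eqxx integral_indic// setIT.
  by rewrite [X in (X * _)%E](_ : _ = 0%E) ?mul0e.
have := @filter_bigI _ _ [fset i in 'I_n]%fset (fun i => [set t | P i (tnth t i)])
  _ (ae_filter_ringOfSetsType (mun n)) (fun i _ => aei i).
by apply: filterS => t Pt i; apply: Pt; rewrite /= !inE.
Qed.

Lemma measurable_cube (D : interval R) n : measurable (@cube R D n).
Proof.
rewrite (_ : @cube R D n = \bigcap_(i in [set: 'I_n])
  ((fun t : n.-tuple T => tnth t i) @^-1` [set` D])); last first.
  by apply/seteqP; split => [t tD i _|t tD i]; [exact: (tD i)|exact: (tD i I)].
apply: fin_bigcap_measurable => // i _.
by rewrite -[X in measurable X]setTI; apply: measurable_tnth => //; exact: measurable_itv.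
Qed.

Lemma cube_coord (D : interval R) u (t : #|` u|.-tuple T) :
  cube D t <-> {in u, forall j, coord t j \in D}.
Proof.
split => [tD j ju|tD i]; last by rewrite -coord_nth tD// mem_nth_fset.
have ltj : (index j u < #|` u|)%N by rewrite index_mem.
by have := tD (Ordinal ltj); rewrite (tnth_nth 0).
Qed.

Lemma cube_merge (D : interval R) u v w (z : #|` v|.-tuple T * #|` w|.-tuple T) :
  perm_eq u (v ++ w) -> cube D (merge u z) <-> cube D z.1 /\ cube D z.2.
Proof.
move=> uvw; have : uniq (v ++ w) by rewrite -(perm_uniq uvw) fset_uniq.
rewrite cat_uniq => /and3P[_ /hasPn vw _].
have memu j : (j \in u) = (j \in v) || (j \in w) by rewrite (perm_mem uvw) mem_cat.
split => [/cube_coord mD|[/cube_coord D1 /cube_coord D2]].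
  split; apply/cube_coord => j jv.
    by have := mD j; rewrite coord_merge memu jv//; apply.
  have := mD j; rewrite coord_merge memu jv ?orbT//.
  by rewrite (negPf (vw _ jv)); apply.
apply/cube_coord => j; rewrite memu => jvw.
rewrite coord_merge ?memu//; case: ifPn => [/D1//|jv].
by apply: D2; move: jvw; rewrite (negPf jv).
Qed.

Lemma prod_patchE (D : interval R) n (f : 'I_n -> T -> R) (t : n.-tuple T) :
  \prod_(i < n) (f i \_ [set` D]) (tnth t i) =
  ((fun t => \prod_(i < n) f i (tnth t i)) \_ (@cube R D n)) t.
Proof.
rewrite patchE; case: ifPn => [|/negP tD].
  rewrite inE => tD; apply: eq_bigr => i _.
  by rewrite patchE mem_set//=; exact: tD.
have [i iD] : exists i, ~ (tnth t i \in D).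
  by apply/not_existsP => h; apply: tD; rewrite inE => i; apply: contrapT; exact: h.
by rewrite (bigD1 i)//= patchE memNset// mul0r.
Qed.

Lemma integral_cube_prod (D : interval R) n (f : 'I_n -> T -> R) :
  (forall i, measurable_fun setT (f i)) -> (forall i t, 0 <= f i t) ->
  (\int[mun n]_(t in @cube R D n) (\prod_(i < n) f i (tnth t i))%:E =
   \prod_(i < n) \int[mu]_(a in [set` D]) (f i a)%:E)%E.
Proof.
move=> mf f0; rewrite integral_mkcond.
transitivity (\int[mun n]_t (\prod_(i < n) (f i \_ [set` D]) (tnth t i))%:E)%E.
  by apply: eq_integral => t _; rewrite prod_patchE !patchE; case: ifP.
rewrite (@ge0_integral_prod n (fun i => f i \_ [set` D])).
- apply: eq_bigr => i _; rewrite [RHS]integral_mkcond.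
  by apply: eq_integral => a _; rewrite restrict_EFin.
- move=> i; apply/(measurable_restrictT _ _).1; first exact: measurable_itv.
  exact: measurable_funTS.
- by move=> i t; rewrite patchE; case: ifP.
Qed.

End tuple_coordinates.

(** * L_p spaces *)

Section exponents.
Context {R : realType}.
Implicit Types (p : \bar R) (r : R).

Lemma expoE r : expo r%:E = r^-1.
Proof. exact: fine_invr. Qed.

Lemma expoy : expo (+oo%E : \bar R) = 0.
Proof. by rewrite /expo invey. Qed.

Lemma ge1_cases p : (1 <= p)%E -> p = +oo%E \/ exists2 r, 1 <= r & p = r%:E.
Proof. by case: p => [r||] p1; [right; exists r|left|]. Qed.

Lemma expo_ge0 p : (1 <= p)%E -> 0 <= expo p.
Proof.
move=> /ge1_cases[->|[r r1 ->]]; first by rewrite expoy.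
by rewrite expoE invr_ge0 (le_trans _ r1).
Qed.

Lemma expo_le1 p : (1 <= p)%E -> expo p <= 1.
Proof.
move=> /ge1_cases[->|[r r1 ->]]; first by rewrite expoy.
by rewrite expoE invf_le1// (lt_le_trans _ r1).
Qed.

Lemma hoelder_conjugate_gt1 r : 1 < r -> hoelder_conjugate r%:E = (r / (r - 1))%:E.
Proof.
move=> r1; rewrite /hoelder_conjugate/= eqe gt_eqF ?(lt_trans _ r1)//.
by rewrite -EFinB inver subr_eq0 gt_eqF.
Qed.

End exponents.

Section Lnorm_lemmas.
Context d (T : measurableType d) (R : realType).
Variable mu : {measure set T -> \bar R}.
Implicit Types (f g : T -> \bar R) (p : \bar R).
Local Open Scope ereal_scope.

Lemma ae_le_Lnormy f : {ae mu, forall x, `|f x| <= 'N[mu]_+oo[f]}.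
Proof.
(* On a space of measure 0 the norm is 0 by convention, and there every property holds almost
   everywhere. *)
rewrite unlock; case: ifPn => [mu0|]; first exact: ess_sup_ge.
rewrite -leNgt => mu0; exists setT; split => //.
by apply/eqP; rewrite eq_le mu0 measure_ge0.
Qed.

Lemma Lnormy_le f (c : \bar R) : 0 <= c -> {ae mu, forall x, `|f x| <= c} ->
  'N[mu]_+oo[f] <= c.
Proof. by move=> c0 fc; rewrite unlock; case: ifPn => // _; apply/ess_supP. Qed.

Lemma Lnormr_pow f (r : R) : (0 < r)%R ->
  'N[mu]_r%:E[f] = (\int[mu]_x (`|f x| `^ r)) `^ r^-1.
Proof. by rewrite unlock. Qed.

Lemma ler_poweR (x y : \bar R) (r : R) : (0 <= r)%R -> 0 <= x -> x <= y -> x `^ r <= y `^ r.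
Proof.
move=> r0 x0 xy; apply: gt0_ler_poweR => //.
  by rewrite in_itv/= x0 leey.
by rewrite in_itv/= (le_trans x0 xy) leey.
Qed.

Lemma measurable_abse_poweR f r : measurable_fun setT f ->
  measurable_fun setT (fun x => `|f x| `^ r).
Proof.
move=> mf; apply: (measurableT_comp (measurable_poweR r)).
exact: measurableT_comp.
Qed.

Lemma le_Lnorm p f g : 1 <= p -> measurable_fun setT f -> measurable_fun setT g ->
  {ae mu, forall x, `|f x| <= `|g x|} -> 'N[mu]_p[f] <= 'N[mu]_p[g].
Proof.
move=> /ge1_cases[->|[r r1 ->]] mf mg fg.
  apply: Lnormy_le; first exact: Lnorm_ge0.
  by apply: filterS2 fg (ae_le_Lnormy g) => x; exact: le_trans.
have r0 : (0 < r)%R by rewrite (lt_le_trans _ r1).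
rewrite !Lnormr_pow//; apply: ler_poweR; first by rewrite invr_ge0 ltW.
  by apply: integral_ge0 => x _; exact: poweR_ge0.
apply: ae_ge0_le_integral => //.
- by move=> x _; exact: poweR_ge0.
- exact: measurable_abse_poweR.
- by move=> x _; exact: poweR_ge0.
- exact: measurable_abse_poweR.
by apply: filterS fg => x fgx _; apply: ler_poweR => //; exact: ltW.
Qed.

Lemma integral_norm_lty (f : T -> R) :
  measurable_fun setT f -> \int[mu]_x `|f x|%:E < +oo ->
  mu.-integrable setT (EFin \o f).
Proof.
move=> mf fy; apply/integrableP; split; first exact/measurable_EFinP.
by under eq_integral do rewrite abse_EFin.
Qed.

Lemma Lnorm1_EFin (f : T -> R) : 'N[mu]_1[EFin \o f] = \int[mu]_x `|f x|%:E.
Proof. by rewrite Lnorm1. Qed.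

Lemma hoelder_y (f g : T -> R) : measurable_fun setT f -> measurable_fun setT g ->
  'N[mu]_1[EFin \o f] < +oo -> 'N[mu]_+oo[EFin \o g] < +oo ->
  \int[mu]_x `|f x * g x|%:E < +oo.
Proof.
rewrite Lnorm1_EFin => mf mg fy gy.
have gfin : 'N[mu]_+oo[EFin \o g] \is a fin_num by rewrite ge0_fin_numE// Lnorm_ge0.
pose c := fine 'N[mu]_+oo[EFin \o g].
have c0 : (0 <= c)%R by rewrite fine_ge0// Lnorm_ge0.
apply: (@le_lt_trans _ _ (\int[mu]_x (c%:E * `|f x|%:E))).
  apply: ae_ge0_le_integral => //.
  - by apply/measurable_EFinP; apply: measurableT_comp => //; exact: measurable_funM.
  - by move=> x _; rewrite mule_ge0.
  - by apply: measurable_funeM; apply/measurable_EFinP; exact: measurableT_comp.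
  apply: filterS (ae_le_Lnormy (EFin \o g)) => x /= + _.
  rewrite -[leRHS](fineK gfin) -/c lee_fin => gc.
  by rewrite lee_fin normrM mulrC ler_wpM2r.
rewrite ge0_integralZl//; last by apply/measurable_EFinP; exact: measurableT_comp.
by rewrite lte_mul_pinfty// ?lee_fin.
Qed.

Lemma integrable_hoelder p (f g : T -> R) : 1 <= p ->
  measurable_fun setT f -> measurable_fun setT g ->
  'N[mu]_p[EFin \o f] < +oo -> 'N[mu]_(hoelder_conjugate p)[EFin \o g] < +oo ->
  mu.-integrable setT (fun x => (f x * g x)%:E).
Proof.
move=> /ge1_cases p1 mf mg.
have mfg := measurable_funM mf mg.
move=> fp gp; apply: integral_norm_lty => //.
case: p1 fp gp => [->|[r r1 ->]].
  rewrite hoelder_conjugatey => fy g1.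
  by under eq_integral do rewrite mulrC; exact: hoelder_y.
move: r1; rewrite le_eqVlt => /predU1P[<-|r1].
  by rewrite hoelder_conjugate1 => f1 gy; exact: hoelder_y.
rewrite hoelder_conjugate_gt1// => fr gr.
have r0 : (0 < r)%R by rewrite (lt_trans _ r1).
have rB0 : (0 < r - 1)%R by rewrite subr_gt0.
have := @hoelder _ _ _ mu f g r (r / (r - 1))%R mf mg r0 (divr_gt0 r0 rB0).
rewrite Lnorm1 invf_div -[X in (X + _)%R]mul1r -mulrDl addrC subrK divff ?gt_eqF// => /(_ erefl).
by move=> /le_lt_trans; apply; rewrite lte_mul_pinfty ?Lnorm_ge0 ?ge0_fin_numE ?Lnorm_ge0.
Qed.

(** Hoelder's inequality for the factorisation f w = (f w^(1/r)) w^(1-1/r) with exponents r and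
    r/(r-1), raised to the power r. The case r = 1, where the conjugate exponent is infinite, is an
    equality. *)
Lemma integral_weight_poweR (f w : T -> R) r : (1 <= r)%R ->
  measurable_fun setT f -> measurable_fun setT w ->
  (forall x, 0 <= f x)%R -> (forall x, 0 <= w x)%R ->
  (\int[mu]_x (f x * w x)%:E) `^ r <=
  (\int[mu]_x (w x)%:E) `^ (r - 1) * \int[mu]_x (f x `^ r * w x)%:E.
Proof.
move=> r1 mf mw f0 w0.
have Ifw : 0 <= \int[mu]_x (f x `^ r * w x)%:E.
  by apply: integral_ge0 => x _; rewrite lee_fin mulr_ge0 ?powR_ge0.
move: r1; rewrite le_eqVlt => /predU1P[r1|r1].
  rewrite -r1 subrr poweRe0 mul1e poweRe1; last first.
    by apply: integral_ge0 => x _; rewrite lee_fin mulr_ge0.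
  by under [leRHS]eq_integral do rewrite powRr1//.
have r0 : (0 < r)%R by rewrite (lt_trans _ r1).
have rB0 : (0 < r - 1)%R by rewrite subr_gt0.
pose F x := (f x * w x `^ r^-1)%R; pose G x := (w x `^ (1 - r^-1))%R.
have mF : measurable_fun setT F.
  by apply: measurable_funM => //; exact: (measurableT_comp (measurable_powR _)).
have mG : measurable_fun setT G by exact: (measurableT_comp (measurable_powR _)).
have rr : (r^-1 + (r / (r - 1))^-1 = 1)%R.
  by rewrite invf_div -[X in (X + _)%R]mul1r -mulrDl addrC subrK divff ?gt_eqF.
have wE x : (w x `^ r^-1 * w x `^ (1 - r^-1) = w x)%R.
  have rE : (r^-1 + (1 - r^-1) = 1)%R by rewrite addrC subrK.
  by rewrite -powRD rE ?oner_eq0// powRr1.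
have /(ler_poweR (ltW r0)) := hoelder mu mF mG r0 (divr_gt0 r0 rB0) rr.
rewrite Lnorm1 => /(_ (integral_ge0 _ (fun _ _ => abse_ge0 _))).
under eq_integral do rewrite /= /F /G -mulrA wE ger0_norm ?mulr_ge0//.
move=> /le_trans; apply.
rewrite poweRM ?Lnorm_ge0// poweR_Lnorm ?gt_eqF//.
rewrite muleC; apply: lee_pmul; rewrite ?poweR_ge0//.
- by apply: integral_ge0 => x _; exact: poweR_ge0.
- rewrite Lnormr_pow ?divr_gt0// -poweRrM.
  rewrite (_ : (_^-1 * r = r - 1)%R); last by rewrite invf_div divfK ?gt_eqF.
  apply: ler_poweR; first exact: ltW.
    by apply: integral_ge0 => x _; exact: poweR_ge0.
  rewrite le_eqVlt; apply/orP; left; apply/eqP; apply: eq_integral => x _.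
  rewrite /G/= ger0_norm ?powR_ge0// -powRrM.
  rewrite (_ : ((1 - r^-1) * _ = 1)%R) ?powRr1//.
  by field; rewrite ?gt_eqF.
- rewrite le_eqVlt; apply/orP; left; apply/eqP; apply: eq_integral => x _.
  rewrite /F/= ger0_norm ?mulr_ge0 ?powR_ge0//.
  by rewrite powRM ?powR_ge0// -powRrM mulVf ?gt_eqF// powRr1.
Qed.

End Lnorm_lemmas.

Lemma ge0_integralMl d (T : measurableType d) (R : realType)
    (mu : {measure set T -> \bar R}) (f : T -> R) (k : R) :
  measurable_fun setT f -> (forall x, 0 <= f x) -> 0 <= k ->
  (\int[mu]_x (k * f x)%:E = k%:E * \int[mu]_x (f x)%:E)%E.
Proof.
move=> mf f0 k0; under eq_integral do rewrite EFinM.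
by rewrite ge0_integralZl//; [exact/measurable_EFinP|move=> x _; rewrite lee_fin].
Qed.

(** * Weighted norms of marginals *)

Section product_measure.
Context d1 d2 (X : measurableType d1) (Y : measurableType d2) (R : realType).
Variables (m1 : {sigma_finite_measure set X -> \bar R})
          (m2 : {sigma_finite_measure set Y -> \bar R}).
Local Open Scope ereal_scope.

Lemma ae_prod (P : X * Y -> Prop) : {ae m1 \x m2, forall z, P z} ->
  {ae m1, forall x, {ae m2, forall y, P (x, y)}}.
Proof.
move=> [N [mN N0 PN]].
have ms : measurable_fun setT (m2 \o xsection N) by exact: measurable_fun_xsection.
have : \int[m1]_x `|(m2 \o xsection N) x| = 0.
  under eq_integral do rewrite gee0_abs//.
  exact: N0.
move=> /(ae_eq_integral_abs m1 measurableT ms); apply: filterS => x /= /(_ I) xN.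
exists (xsection N x); split => //; first exact: measurable_xsection.
by move=> y Py; rewrite /xsection/= inE; exact: PN.
Qed.

(** Since [fine] sends infinite values to 0, a real-valued integral is bounded by the extended one
    without any integrability assumption. *)
Lemma le_abse_fine (x : \bar R) : `|fine x|%:E <= `|x|.
Proof. by case: x => [r||] /=; rewrite ?normr0 ?leey ?lexx. Qed.

Definition marginal (G : X * Y -> R) (a : Y -> R) (x : X) : R :=
  (\int[m2]_y (G (x, y) * a y))%R.

Variables (G : X * Y -> R) (a : Y -> R).
Hypothesis mG : measurable_fun setT G.
Hypothesis ma : measurable_fun setT a.

Lemma measurable_weighted : measurable_fun setT (fun z => G z * a z.2)%R.
Proof. by apply: measurable_funM => //; exact: measurableT_comp ma measurable_snd. Qed.

Lemma measurable_marginal : measurable_fun setT (marginal G a).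
Proof.
have mF := measurable_weighted; move/measurable_EFinP in mF.
rewrite (_ : marginal G a = fine \o
  ((fubini_F m2 (fun z => (G z * a z.2)%:E)^\+)
  \- (fubini_F m2 (fun z => (G z * a z.2)%:E)^\-))); last first.
  apply/funext => x; rewrite /= /marginal /Rintegral integralE.
  by congr (fine (_ - _)); apply: eq_integral => y _; rewrite ?funeposE ?funenegE.
apply: (measurableT_comp (fine_measurable _)) => //; apply: emeasurable_funB.
- exact: measurable_fun_fubini_tonelli_F (measurable_funepos mF) (funepos_ge0 _).
- exact: measurable_fun_fubini_tonelli_F (measurable_funeneg mF) (funeneg_ge0 _).
Qed.

Lemma le_marginal x :
  `|marginal G a x|%:E <= \int[m2]_y (`|G (x, y)| * `|a y|)%:E.
Proof.
apply: le_trans (le_abse_fine _) _.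
apply: le_trans (le_abse_integral _ _ _) _ => //.
  apply/measurable_EFinP; apply: measurable_funM => //.
  exact: measurableT_comp mG (measurable_pair1 x).
by under eq_integral do rewrite abse_EFin normrM.
Qed.

Variables (rho : X -> R) (sigma : Y -> R) (M B : R).
Hypothesis mrho : measurable_fun setT rho.
Hypothesis msigma : measurable_fun setT sigma.
Hypothesis rho0 : (forall x, 0 <= rho x)%R.
Hypothesis sigma0 : (forall y, 0 <= sigma y)%R.
Hypotheses (M0 : (0 <= M)%R) (B0 : (0 <= B)%R).
Hypothesis aM : {ae m2, forall y, (`|a y| <= M * sigma y)%R}.
Hypothesis aB : \int[m2]_y `|a y|%:E <= B%:E.

Let N p := 'N[m1 \x m2]_p[(fun z => (G z * (rho z.1 * sigma z.2) `^ expo p)%:E)].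

Lemma Lnormy_marginal : N +oo < +oo ->
  'N[m1]_+oo[EFin \o marginal G a] <= B%:E * N +oo.
Proof.
move=> Ny; have Nfin : N +oo \is a fin_num by rewrite ge0_fin_numE// Lnorm_ge0.
apply: Lnormy_le; first by rewrite mule_ge0// Lnorm_ge0.
have aeG := ae_le_Lnormy (m1 \x m2)
  (fun z => (G z * (rho z.1 * sigma z.2) `^ expo (+oo : \bar R))%:E).
apply: filterS (ae_prod aeG) => x Gx /=.
apply: le_trans (le_marginal x) _.
apply: (@le_trans _ _ (\int[m2]_y (N +oo * `|a y|%:E))).
  apply: ae_ge0_le_integral => //.
  - apply/measurable_EFinP; apply: measurable_funM => //.
      by apply: measurableT_comp => //; exact: measurableT_comp mG (measurable_pair1 x).
    exact: measurableT_comp.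
  - by move=> y _; rewrite mule_ge0// Lnorm_ge0.
  - by apply: measurable_funeM; apply/measurable_EFinP; exact: measurableT_comp.
  apply: filterS Gx => y Gxy _; rewrite EFinM; apply: lee_wpmul2r => //.
  by move: Gxy; rewrite -/(N +oo) expoy powRr0 mulr1.
rewrite ge0_integralZl ?Lnorm_ge0//; last first.
  by apply/measurable_EFinP; exact: measurableT_comp.
by rewrite muleC lee_pmul ?Lnorm_ge0// integral_ge0.
Qed.

(** Pointwise in x, Hoelder for the measure |a| dy yields the mass B^(r-1) and leaves |G|^r
    integrated against |a|. This last |a| is traded for M sigma, which restores the weight occurring
    in the norm of G. Integration in x and an r-th root conclude. *)
Lemma Lnormr_marginal r : (1 <= r)%R ->
  'N[m1]_r%:E[(fun x => (marginal G a x * rho x `^ r^-1)%:E)] <=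
  (M `^ r^-1 * B `^ (1 - r^-1))%:E * N r%:E.
Proof.
move=> r1; have r0 : (0 < r)%R by rewrite (lt_le_trans _ r1).
have rB0 : (0 <= r - 1)%R by rewrite subr_ge0.
have mGr : measurable_fun setT (fun z => `|G z| `^ r)%R.
  by apply: (measurableT_comp (measurable_powR _)); exact: measurableT_comp.
pose W z := (`|G z| `^ r * (rho z.1 * sigma z.2))%:E.
have mW : measurable_fun setT W.
  apply/measurable_EFinP; apply: measurable_funM => //; apply: measurable_funM.
    exact: measurableT_comp mrho measurable_fst.
  exact: measurableT_comp msigma measurable_snd.
have W0 z : 0 <= W z by rewrite lee_fin !mulr_ge0// powR_ge0.
have key x : (`|marginal G a x| `^ r * rho x)%:E <=
    (B `^ (r - 1) * M)%:E * \int[m2]_y W (x, y).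
  have mGx : measurable_fun setT (fun y => G (x, y)).
    exact: measurableT_comp mG (measurable_pair1 x).
  have mGxr : measurable_fun setT (fun y => `|G (x, y)| `^ r)%R.
    exact: measurableT_comp mGr (measurable_pair1 x).
  have h1 : (`|marginal G a x| `^ r)%:E <=
      (B `^ (r - 1))%:E * \int[m2]_y (`|G (x, y)| `^ r * `|a y|)%:E.
    rewrite -poweR_EFin.
    apply: le_trans (ler_poweR (ltW r0) _ (le_marginal x)) _ => //.
    have mna : measurable_fun setT (fun y => `|a y|)%R by exact: measurableT_comp.
    have mnG : measurable_fun setT (fun y => `|G (x, y)|)%R by exact: measurableT_comp.
    apply: le_trans (integral_weight_poweR m2 r1 mnG mna
      (fun _ => normr_ge0 _) (fun _ => normr_ge0 _)) _.
    apply: lee_pmul => //; first exact: poweR_ge0.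
      by apply: integral_ge0 => y _; rewrite lee_fin mulr_ge0// powR_ge0.
    by rewrite -poweR_EFin; apply: ler_poweR => //; exact: integral_ge0.
  have h2 : \int[m2]_y (`|G (x, y)| `^ r * `|a y|)%:E <=
      M%:E * \int[m2]_y (`|G (x, y)| `^ r * sigma y)%:E.
    rewrite -ge0_integralMl//; last 2 first.
    - exact: measurable_funM.
    - by move=> y; rewrite mulr_ge0// powR_ge0.
    apply: ae_ge0_le_integral; first exact: measurableT.
    - by move=> y _; rewrite lee_fin mulr_ge0// powR_ge0.
    - apply/measurable_EFinP; apply: measurable_funM => //.
      exact: measurableT_comp.
    - by move=> y _; rewrite lee_fin !mulr_ge0// powR_ge0.
    - apply/measurable_EFinP; apply: measurable_funM => //.
      exact: measurable_funM.
    apply: filterS aM => y ay _; rewrite lee_fin mulrCA.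
    by rewrite ler_wpM2l ?powR_ge0.
  rewrite EFinM (_ : \int[m2]_y W (x, y) =
    (rho x)%:E * \int[m2]_y (`|G (x, y)| `^ r * sigma y)%:E); last first.
    rewrite -ge0_integralMl//; last 2 first.
    - exact: measurable_funM.
    - by move=> y; rewrite mulr_ge0// powR_ge0.
    by apply: eq_integral => y _; rewrite /W /= mulrCA.
  rewrite (EFinM _ M) muleCA [leLHS]muleC.
  apply: lee_wpmul2l; first by rewrite lee_fin.
  apply: le_trans h1 _; rewrite -muleA; apply: lee_wpmul2l => //.
  by rewrite lee_fin powR_ge0.
have I0 x : 0 <= \int[m2]_y W (x, y) by apply: integral_ge0 => y _; exact: W0.
have BM0 : (0 <= B `^ (r - 1) * M)%R by rewrite mulr_ge0// powR_ge0.
have mm := measurable_marginal.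
have keyI : \int[m1]_x (`|marginal G a x| `^ r * rho x)%:E <=
    (B `^ (r - 1) * M)%:E * \int[m1 \x m2]_z W z.
  have mI : measurable_fun setT (fun x => \int[m2]_y W (x, y)).
    exact: (measurable_fun_fubini_tonelli_F (m2 := m2) W mW W0).
  rewrite (fubini_tonelli1 W mW W0).
  rewrite -(ge0_integralZl m1 measurableT mI (fun x _ => I0 x)) ?lee_fin//.
  apply: ge0_le_integral; first exact: measurableT.
  - by move=> x _; rewrite lee_fin mulr_ge0// powR_ge0.
  - apply/measurable_EFinP; apply: measurable_funM => //.
    by apply: (measurableT_comp (measurable_powR _)); exact: measurableT_comp.
  - exact: measurable_funeM.
  - by move=> x _; exact: key.
have powE (c s : R) : (0 <= s)%R -> (`|c * s `^ r^-1| `^ r = `|c| `^ r * s)%R.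
  move=> s0; rewrite normrM (ger0_norm (powR_ge0 _ _)) powRM ?powR_ge0//.
  by rewrite -powRrM mulVf ?gt_eqF// powRr1.
rewrite Lnormr_pow// /N Lnormr_pow//.
have -> : \int[m1]_x (`|(marginal G a x * rho x `^ r^-1)%:E| `^ r) =
    \int[m1]_x (`|marginal G a x| `^ r * rho x)%:E.
  by apply: eq_integral => x _; rewrite abse_EFin poweR_EFin powE.
have -> : \int[m1 \x m2]_z
      (`|(G z * (rho z.1 * sigma z.2) `^ expo r%:E)%:E| `^ r) =
    \int[m1 \x m2]_z W z.
  by apply: eq_integral => z _; rewrite expoE abse_EFin poweR_EFin powE// mulr_ge0.
apply: le_trans (ler_poweR _ _ keyI) _.
- by rewrite invr_ge0 ltW.
- by apply: integral_ge0 => x _; rewrite lee_fin mulr_ge0// powR_ge0.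
rewrite poweRM ?lee_fin// ?integral_ge0// poweR_EFin powRM ?powR_ge0//.
rewrite mulrC -powRrM (_ : (r - 1) * r^-1 = 1 - r^-1)%R//.
by rewrite mulrBl mul1r divff// gt_eqF.
Qed.

Lemma Lnorm_marginal p : 1 <= p -> N p < +oo ->
  'N[m1]_p[(fun x => (marginal G a x * rho x `^ expo p)%:E)] <=
  (M `^ expo p * B `^ (1 - expo p))%:E * N p.
Proof.
move=> /ge1_cases[->|[r r1 ->]] Np; last by rewrite expoE; exact: Lnormr_marginal.
rewrite expoy subr0 powRr0 powRr1// mul1r.
have := Lnormy_marginal Np; congr (_ <= _).
by apply: eq_Lnorm => x; rewrite powRr0 mulr1.
Qed.

End product_measure.

Section tuple_Lnorm.
Context {R : realType}.
Local Notation T := (measurableTypeR R).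
Local Notation mu := (@lebesgue_measure R).
Local Notation mun n := (@lebesgue_tuple R n).
Implicit Types (u v w : {fset nat}).

Lemma powR_prod (I : Type) (s : seq I) (F : I -> R) r : (forall i, 0 <= F i) ->
  (\prod_(i <- s) F i) `^ r = \prod_(i <- s) F i `^ r.
Proof.
move=> F0; elim: s => [|i s IH]; first by rewrite !big_nil powR1.
by rewrite !big_cons powRM ?prodr_ge0// IH.
Qed.

Lemma measurable_prod_tnth n (f : 'I_n -> T -> R) :
  (forall i, measurable_fun setT (f i)) ->
  measurable_fun setT (fun t : n.-tuple T => \prod_(i < n) f i (tnth t i)).
Proof.
move=> mf; apply: measurable_prod => i _.
exact: measurableT_comp (mf i) (measurable_tnth i).
Qed.

Lemma measurable_prod_coord u (f : nat -> T -> R) : (forall j, measurable_fun setT (f j)) ->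
  measurable_fun setT (fun t : #|` u|.-tuple T => \prod_(j <- u) f j (coord t j)).
Proof.
move=> mf; apply: measurable_prod => j _.
exact: measurableT_comp (mf j) (@measurable_coord _ u j).
Qed.

Lemma Lnorm_tensor n q (f : 'I_n -> T -> R) : (1 <= q)%E ->
  (forall i, measurable_fun setT (f i)) ->
  (forall i, 'N[mu]_q[EFin \o f i] < +oo)%E ->
  ('N[mun n]_q[(fun t => (\prod_(i < n) f i (tnth t i))%:E)] < +oo)%E.
Proof.
move=> q1 mf fq; case: (ge1_cases q1) fq => [->|[r r1 ->]] fq.
  have Nfin i : 'N[mu]_+oo[EFin \o f i]%E \is a fin_num by rewrite ge0_fin_numE// Lnorm_ge0.
  apply: (@le_lt_trans _ _ (\prod_(i < n) fine 'N[mu]_+oo[EFin \o f i])%:E); last exact: ltry.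
  apply: Lnormy_le.
    by rewrite lee_fin; apply: prodr_ge0 => i _; rewrite fine_ge0// Lnorm_ge0.
  apply: filterS (ae_tuple (fun i => ae_le_Lnormy mu (EFin \o f i))) => t ft.
  rewrite abse_EFin lee_fin normr_prod; apply: ler_prod => i _.
  by rewrite normr_ge0/= -lee_fin fineK//; exact: ft.
have r0 : 0 < r by rewrite (lt_le_trans _ r1).
rewrite Lnormr_pow//; apply: poweR_lty.
rewrite (_ : (\int[mun n]_t _ = \prod_(i < n) \int[mu]_a (`|f i a| `^ r)%:E)%E); last first.
  rewrite -(@ge0_integral_prod _ _ (fun i a => `|f i a| `^ r)).
  - apply: eq_integral => t _; rewrite abse_EFin poweR_EFin normr_prod; congr EFin.
    by rewrite powR_prod.
  - move=> i; apply: (measurableT_comp (measurable_powR _)); exact: measurableT_comp.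
  - by move=> i t; exact: powR_ge0.
rewrite ltey_eq prode_fin_num// => i _.
rewrite ge0_fin_numE; last by apply: integral_ge0 => x _; rewrite lee_fin powR_ge0.
by have := poweR_lty r (fq i); rewrite poweR_Lnorm ?gt_eqF.
Qed.

Lemma preimage_merge_measure0 u v w (N : set (#|` u|.-tuple T)) :
  perm_eq u (v ++ w) -> measurable N -> mun #|` u| N = 0%E ->
  (mun #|` v| \x mun #|` w|)%E (@merge _ u v w @^-1` N) = 0%E.
Proof.
move=> uvw mN N0.
have mmN : measurable (@merge _ u v w @^-1` N).
  by rewrite -[X in measurable X]setTI; exact: measurable_merge.
rewrite -[X in ((_ \x _) X)%E]setIT -integral_indic//.
have mI : measurable_fun setT (fun t : #|` u|.-tuple T => (\1_N t)%:E : \bar R).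
  exact/measurable_EFinP.
have I0 t : (0 <= (\1_N t)%:E :> \bar R)%E by rewrite lee_fin.
by have := ge0_integral_merge uvw mI I0 => <-; rewrite integral_indic// setIT; exact: N0.
Qed.

Lemma Lnorm_merge u v w p (F : #|` u|.-tuple T -> \bar R) :
  perm_eq u (v ++ w) -> (1 <= p)%E -> measurable_fun setT F ->
  ('N[mun #|` v| \x mun #|` w|]_p[(fun z => F (merge u z))] <= 'N[mun #|` u|]_p[F])%E.
Proof.
move=> uvw /ge1_cases[->|[r r1 ->]] mF.
  apply: Lnormy_le; first exact: Lnorm_ge0.
  have [N [mN N0 PN]] := ae_le_Lnormy (mun #|` u|) F.
  exists (@merge _ u v w @^-1` N); split; last by move=> z /= h; exact: PN.
    by rewrite -[X in measurable X]setTI; exact: measurable_merge.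
  exact: preimage_merge_measure0.
have r0 : 0 < r by rewrite (lt_le_trans _ r1).
rewrite !Lnormr_pow// (ge0_integral_merge uvw)//; first exact: measurable_abse_poweR.
by move=> t; exact: poweR_ge0.
Qed.

End tuple_Lnorm.

(** * Integral operators with product kernels *)

Section kernel_integrals.
Context {R : realType}.
Variables (D : interval R) (psi : R -> R).
Hypothesis psi_meas : measurable_fun [set` D] psi.
Hypothesis psi_ge0 : forall t, t \in D -> 0 <= psi t.
Hypothesis psi_gt0 : {ae lebesgue_measure, forall t, t \in D -> 0 < psi t}.
Local Notation T := (measurableTypeR R).
Local Notation mu := (@lebesgue_measure R).
Local Notation mun n := (@lebesgue_tuple R n).
Implicit Types (u v w : {fset nat}).

Lemma measurable_patch (f : R -> R) : measurable_fun [set` D] f ->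
  measurable_fun setT (f \_ [set` D]).
Proof. by move=> mf; apply/(measurable_restrictT _ _).1. Qed.

Lemma measurable_patch_cube n (g : n.-tuple T -> R) : measurable_fun (@cube R D n) g ->
  measurable_fun setT (g \_ (@cube R D n)).
Proof. by move=> mf; apply/(measurable_restrictT _ _).1 => //; exact: measurable_cube. Qed.

Lemma patch_psi_ge0 t : 0 <= (psi \_ [set` D]) t.
Proof. by rewrite patchE; case: ifPn => //; rewrite inE; exact: psi_ge0. Qed.

Lemma prod_patch n (t : n.-tuple T) (f : 'I_n -> R -> R) : @cube R D n t ->
  \prod_(i < n) (f i \_ [set` D]) (tnth t i) = \prod_(i < n) f i (tnth t i).
Proof.
by move=> tD; rewrite prod_patchE patchE mem_set.
Qed.

Lemma L_normE n p (g : n.-tuple T -> R) :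
  (L_norm D psi p g = 'N[mun n]_p[(fun t => ((g \_ (@cube R D n)) t *
     (\prod_(i < n) (psi \_ [set` D]) (tnth t i)) `^ expo p)%:E)])%E.
Proof.
apply: eq_Lnorm => t; rewrite [LHS]patchE patchE; case: ifPn => [|_]; last by rewrite mul0r.
by rewrite inE => tD; rewrite prod_patch.
Qed.

Lemma measurable_L_norm_integrand n p (g : n.-tuple T -> R) :
  measurable_fun (@cube R D n) g ->
  measurable_fun setT (fun t => (g \_ (@cube R D n)) t *
     (\prod_(i < n) (psi \_ [set` D]) (tnth t i)) `^ expo p).
Proof.
move=> mg; apply: measurable_funM; first exact: measurable_patch_cube.
apply: (measurableT_comp (measurable_powR _)).
by apply: (@measurable_prod_tnth _ _ (fun=> psi \_ [set` D])) => i; exact: measurable_patch.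
Qed.

(** Under this condition, integration against phi is a bounded functional on L_{p,psi}. Both
    kappa(x, .) and the mean I(kappa(., t)) satisfy it, hence so does their difference. *)
Definition dual_space p (phi : R -> R) := measurable_fun [set` D] phi /\
  ('N[mu]_(hoelder_conjugate p)[(fun t => (phi t / psi t `^ expo p)%:E) \_ [set` D]] < +oo)%E.

Lemma patch_div (phi : R -> R) (e : R) :
  (fun t => (phi t / psi t `^ e)%:E) \_ [set` D] =
  EFin \o (fun t => (phi \_ [set` D]) t / (psi \_ [set` D]) t `^ e).
Proof.
by apply/funext => t; rewrite /= !patchE; case: ifP => // _; rewrite mul0r.
Qed.

Lemma measurable_div_psi (phi : R -> R) (e : R) : measurable_fun [set` D] phi ->
  measurable_fun setT (fun t => (phi \_ [set` D]) t / (psi \_ [set` D]) t `^ e).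
Proof.
move=> mphi; apply: measurable_funM; first exact: measurable_patch.
under eq_fun do rewrite -powRN.
by apply: (measurableT_comp (measurable_powR _)); exact: measurable_patch.
Qed.

Lemma dual_spaceB p (f g : R -> R) : (1 <= p)%E -> dual_space p f -> dual_space p g ->
  dual_space p (fun t => f t - g t).
Proof.
move=> p1 [mf fy] [mg gy]; split; first exact: measurable_funB.
move: fy gy; rewrite !patch_div => fy gy.
set F := (fun t => (f \_ _) t / _) in fy.
set G := (fun t => (g \_ _) t / _) in gy.
have mF : measurable_fun setT F by exact: measurable_div_psi.
have mG : measurable_fun setT G by exact: measurable_div_psi.
have mNG : measurable_fun setT (\- G) by exact: measurableT_comp.
have := @eminkowski _ _ _ mu F (\- G) _ mF mNG
  (hoelder_conj_ge1 p1).
rewrite (_ : EFin \o (F \+ \- G) = EFin \o (fun t => ((fun t => f t - g t) \_ [set` D]) t /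
  (psi \_ [set` D]) t `^ expo p)); last first.
  apply/funext => t; rewrite /F /G /= !patchE; case: ifP => _; first by rewrite mulrBl.
  by rewrite !mul0r oppr0 addr0.
move=> /le_lt_trans; apply; apply: lte_add_pinfty => //.
by rewrite (_ : EFin \o (\- G) = (\- (EFin \o G))%E) ?oppe_Lnorm.
Qed.

Lemma ae_psi_gt0 n : {ae mun n, forall t, @cube R D n t ->
  forall i, 0 < (psi \_ [set` D]) (tnth t i)}.
Proof.
apply: filterS (ae_tuple (fun=> psi_gt0)) => t h tD i.
by rewrite patchE mem_set ?h//; exact: tD.
Qed.

(** Hoelder's inequality after moving the weight: almost everywhere on D^n, psi is positive in each
    coordinate, so a factor psi^(1/p) can be attached to g and divided out of each phi. *)
Lemma integrable_kernel n p (g : n.-tuple T -> R) (phi : 'I_n -> R -> R) : (1 <= p)%E ->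
  L_space D psi p g -> (forall i, dual_space p (phi i)) ->
  (mun n).-integrable setT (fun t => ((g \_ (@cube R D n)) t *
    \prod_(i < n) (phi i \_ [set` D]) (tnth t i))%:E).
Proof.
move=> p1 [mg]; rewrite L_normE => gy dphi.
have mphi i : measurable_fun setT (phi i \_ [set` D]) by apply: measurable_patch; case: (dphi i).
pose f i t := (phi i \_ [set` D]) t / (psi \_ [set` D]) t `^ expo p.
have mf i : measurable_fun setT (f i) by apply: measurable_div_psi; case: (dphi i).
have fy i : ('N[mu]_(hoelder_conjugate p)[EFin \o f i] < +oo)%E.
  by case: (dphi i) => _; rewrite patch_div.
have fyn := @Lnorm_tensor _ _ _ f (hoelder_conj_ge1 p1) mf fy.
have := integrable_hoelder p1 (measurable_L_norm_integrand p mg)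
  (measurable_prod_tnth mf) gy fyn.
move/integrableP => [mI Iy]; apply/integrableP; split.
  apply/measurable_EFinP; apply: measurable_funM; first exact: measurable_patch_cube.
  exact: (@measurable_prod_tnth _ _ (fun i => phi i \_ [set` D])).
apply: le_lt_trans Iy; apply: ae_ge0_le_integral => //.
- apply: measurableT_comp => //; apply/measurable_EFinP.
  apply: measurable_funM; first exact: measurable_patch_cube.
  exact: (@measurable_prod_tnth _ _ (fun i => phi i \_ [set` D])).
- exact: measurableT_comp.
apply: filterS (ae_psi_gt0 n) => t psit _.
rewrite [X in `|(X * _)%:E|%E]patchE; case: ifPn; last by rewrite mul0r abse0.
rewrite inE => tD; have {}psit := psit tD.
rewrite patchE mem_set// -mulrA; rewrite le_eqVlt; apply/orP; left; apply/eqP.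
congr (`|(_ * _)%:E|)%E.
rewrite powR_prod; last by move=> i; exact: patch_psi_ge0.
rewrite -big_split/=; apply: eq_bigr => i _.
by rewrite /f mulrC divfK// gt_eqF// powR_gt0.
Qed.

Lemma KopE (k : R -> R -> R) n (g : n.-tuple T -> R) (x : n.-tuple T) :
  Kop D k g x = \int[mun n]_t ((g \_ (@cube R D n)) t *
    \prod_(i < n) (k (tnth x i) \_ [set` D]) (tnth t i)).
Proof.
rewrite /Kop Rintegral_mkcond; apply: eq_Rintegral => t _.
rewrite !patchE; case: ifPn => [|_]; last by rewrite mul0r.
by rewrite inE => tD; rewrite (prod_patch (fun i => k (tnth x i))).
Qed.

End kernel_integrals.

(** * The mean of the kernel and its bounds M and B *)

Section kernel_mean.
Context {R : realType}.
Variables (D : interval R) (psi omega : R -> R) (kappa : R -> R -> R).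
Hypothesis psi_meas : measurable_fun [set` D] psi.
Hypothesis psi_ge0 : forall t, t \in D -> 0 <= psi t.
Hypothesis psi_gt0 : {ae lebesgue_measure, forall t, t \in D -> 0 < psi t}.
Hypothesis kappa_meas : measurable_fun ([set` D] `*` [set` D])
  (fun z : R * R => kappa z.1 z.2).
Hypothesis omega_meas : measurable_fun [set` D] omega.
Hypothesis omega_ge0 : forall t, t \in D -> 0 <= omega t.
Local Notation T := (measurableTypeR R).
Local Notation mu := (@lebesgue_measure R).

Definition kernel_mean (t : R) : R :=
  \int[mu]_(z in [set` D]) (kappa z t * omega z).

(** The kernel with its variables exchanged and extended by 0, which makes the mean a [marginal];
    measurability and the basic estimate are inherited from there. *)
Let G (q : T * T) : R :=
  ((fun z : R * R => kappa z.1 z.2) \_ ([set` D] `*` [set` D])) (q.2, q.1).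

Lemma measurable_kernelT : measurable_fun setT
  ((fun z : T * T => kappa z.1 z.2 : R) \_ ([set` D] `*` [set` D])).
Proof.
by apply/(measurable_restrictT _ _).1 => //; apply: measurableX; exact: measurable_itv.
Qed.

Let mG : measurable_fun setT G.
Proof.
apply: (measurableT_comp measurable_kernelT).
exact: measurable_fun_pair measurable_snd measurable_fst.
Qed.

Let ma : measurable_fun [set: T] (omega \_ [set` D]).
Proof. exact: measurable_patch. Qed.

Let patchG t z : t \in D -> ((fun z => kappa z t) \_ [set` D]) z = G (t, z).
Proof.
move=> tD; rewrite /G !patchE; case: ifPn => [|/negP]; rewrite inE /= => zD; first by rewrite mem_set.
by rewrite memNset// => -[].
Qed.

Let patchG0 t z : t \notin D -> G (t, z) = 0.
Proof. by move=> tD; rewrite /G patchE memNset// => -[_ /=]; exact/negP. Qed.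

Lemma kernel_meanE : kernel_mean \_ [set` D] = marginal mu G (omega \_ [set` D]).
Proof.
apply/funext => t; rewrite patchE /marginal; case: ifPn => [|tD].
  rewrite inE/= => tD; rewrite /kernel_mean Rintegral_mkcond; apply: eq_Rintegral => z _.
  rewrite -patchG// !patchE; case: ifP => // _; by rewrite mul0r.
rewrite /Rintegral integral0_eq// => z _.
by rewrite patchG0 ?mul0r//; move: tD; rewrite notin_setE /= => /negP.
Qed.

Lemma measurable_kernel_meanT : measurable_fun setT (kernel_mean \_ [set` D]).
Proof. by rewrite kernel_meanE; exact: measurable_marginal. Qed.

Lemma measurable_kernel_mean : measurable_fun [set` D] kernel_mean.
Proof.
by apply/(measurable_restrictT _ _).2 => //; exact: measurable_kernel_meanT.
Qed.

Let Kb e t := (\int[mu]_z (`|G (t, z)| / (psi \_ [set` D]) t `^ e *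
  (omega \_ [set` D]) z)%:E)%E.

Let kappa_barE p : (kappa_bar D psi omega kappa p) \_ [set` D] = Kb (expo p).
Proof.
apply/funext => t; rewrite patchE /Kb; case: ifPn => [|tD].
  rewrite inE/= => tD; rewrite /kappa_bar integral_mkcond; apply: eq_integral => z _.
  rewrite -patchG// !patchE (mem_set (_ : [set` D] t))//.
  by case: ifP => // _; rewrite mulr0.
rewrite integral0_eq// => z _.
by rewrite patchG0 ?normr0 ?mul0r//; move: tD; rewrite notin_setE /= => /negP.
Qed.

Let omega_patch_ge0 z : 0 <= (omega \_ [set` D]) z.
Proof. by rewrite patchE; case: ifPn => //; rewrite inE; exact: omega_ge0. Qed.

Let mKb e : measurable_fun setT (Kb e).
Proof.
apply: (measurable_fun_fubini_tonelli_F (m2 := mu)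
  (fun q : T * T => (`|G q| / (psi \_ [set` D]) q.1 `^ e * (omega \_ [set` D]) q.2)%:E)).
  apply/measurable_EFinP; apply: measurable_funM; last first.
    exact: measurableT_comp ma measurable_snd.
  apply: measurable_funM; first exact: measurableT_comp.
  under eq_fun do rewrite -powRN.
  apply: (measurableT_comp (measurable_powR _)).
  exact: measurableT_comp (measurable_patch psi_meas) measurable_fst.
by move=> q; rewrite lee_fin mulr_ge0// divr_ge0// powR_ge0.
Qed.

(** The modulus is moved inside the integral that defines the mean. Through this bound, finiteness
    of the norms of kappa_bar places the mean in the dual spaces and makes M and B finite. *)
Lemma le_kernel_mean p q : (1 <= q)%E ->
  ('N[mu]_q[(fun t => (kernel_mean t / psi t `^ expo p)%:E) \_ [set` D]] <=
   'N[mu]_q[(kappa_bar D psi omega kappa p) \_ [set` D]])%E.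
Proof.
move=> q1; rewrite kappa_barE patch_div; apply: le_Lnorm => //.
  apply/measurable_EFinP; apply: measurable_div_psi => //; exact: measurable_kernel_mean.
apply: aeW => t; rewrite abse_EFin normrM kernel_meanE.
have pe : 0 <= ((psi \_ [set` D]) t `^ expo p)^-1 by rewrite invr_ge0 powR_ge0.
rewrite (ger0_norm pe) [leRHS]gee0_abs; last first.
  by apply: integral_ge0 => z _; rewrite lee_fin mulr_ge0// mulr_ge0.
have lm := le_marginal (mu : {sigma_finite_measure set T -> \bar R}) mG ma t.
rewrite mulrC EFinM; apply: (@le_trans _ _ (_%:E * _)%E).
  by apply: lee_wpmul2l lm; rewrite lee_fin.
rewrite -ge0_integralMl//; last first.
  apply: measurable_funM; last exact: measurableT_comp.
  by apply: measurableT_comp => //; exact: measurableT_comp mG (measurable_pair1 t).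
rewrite le_eqVlt; apply/orP; left; apply/eqP; apply: eq_integral => z _.
by rewrite mulrA (mulrC _ `|G _|) (ger0_norm (omega_patch_ge0 z)).
Qed.

Lemma dual_space_mean p : (1 <= p)%E ->
  (kappa_bar_norm D psi omega kappa p < +oo)%E -> dual_space D psi p kernel_mean.
Proof.
move=> p1 kb; split; first exact: measurable_kernel_mean.
by apply: le_lt_trans (le_kernel_mean _ _) kb; exact: hoelder_conj_ge1.
Qed.

Lemma measurable_kernel x : x \in D -> measurable_fun [set` D] (kappa x).
Proof.
move=> xD; apply/(measurable_restrictT _ _).2; first exact: measurable_itv.
rewrite (_ : _ \_ _ = fun t : T => G (t, x)).
  exact: measurableT_comp mG (measurable_pair2 x).
apply/funext => t; rewrite /G !patchE; case: ifPn => [|/negP]; rewrite inE /= => tD.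
  by rewrite mem_set.
by rewrite memNset// => -[].
Qed.

Lemma dual_space_kernel p x : x \in D -> (kappa_hat D psi kappa p x < +oo)%E ->
  dual_space D psi p (kappa x).
Proof.
move=> xD kh; split; first exact: measurable_kernel.
rewrite -Lnorm_abse; move: kh; congr (_ < _)%E; apply: eq_Lnorm => t /=.
rewrite !patchE; case: ifP => //= _; last by rewrite normr0.
by rewrite normrM (ger0_norm (x := _^-1)) ?invr_ge0 ?powR_ge0.
Qed.

Lemma dual_space_anova p x : (1 <= p)%E -> x \in D ->
  (kappa_hat D psi kappa p x < +oo)%E ->
  (kappa_bar_norm D psi omega kappa p < +oo)%E ->
  dual_space D psi p (kappa_anova D omega kappa x).
Proof.
move=> p1 xD kh kb; apply: dual_spaceB => //; first exact: dual_space_kernel.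
exact: dual_space_mean.
Qed.

(** The constant M of the overview as a real number; [fine] loses nothing as soon as the norm of
    kappa_bar for p = 1 is finite. Likewise [mean_int] is B. *)
Definition mean_sup : R :=
  fine ('N[mu]_+oo[(fun t => (kernel_mean t / psi t)%:E) \_ [set` D]])%E.

Definition mean_int : R := fine (\int[mu]_t `|(kernel_mean \_ [set` D]) t|%:E)%E.

Lemma mean_sup_ge0 : 0 <= mean_sup.
Proof. by rewrite fine_ge0// Lnorm_ge0. Qed.

Lemma mean_int_ge0 : 0 <= mean_int.
Proof. by rewrite fine_ge0// integral_ge0. Qed.

Hypothesis kb1 : (kappa_bar_norm D psi omega kappa 1 < +oo)%E.
Hypothesis kby : (kappa_bar_norm D psi omega kappa +oo < +oo)%E.

Let psi1 : (fun t => (kernel_mean t / psi t)%:E) \_ [set` D] =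
  (fun t => (kernel_mean t / psi t `^ expo (1%:E : \bar R))%:E) \_ [set` D].
Proof.
apply/funext => t; rewrite !patchE; case: ifPn => //; rewrite inE => tD.
by rewrite expoE invr1 powRr1// psi_ge0.
Qed.

Let sup_le : ('N[mu]_+oo[(fun t => (kernel_mean t / psi t)%:E) \_ [set` D]] <=
  kappa_bar_norm D psi omega kappa 1)%E.
Proof.
by rewrite psi1 /kappa_bar_norm hoelder_conjugate1; apply: le_kernel_mean; rewrite leey.
Qed.

Lemma mean_supE :
  mean_sup%:E = ('N[mu]_+oo[(fun t => (kernel_mean t / psi t)%:E) \_ [set` D]])%E.
Proof. rewrite fineK// ge0_fin_numE ?Lnorm_ge0//. exact: (le_lt_trans sup_le kb1). Qed.

Lemma mean_sup_le : (mean_sup%:E <= kappa_bar_norm D psi omega kappa 1)%E.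
Proof. by rewrite mean_supE. Qed.

Let int_le : (\int[mu]_t `|(kernel_mean \_ [set` D]) t|%:E <=
  kappa_bar_norm D psi omega kappa +oo)%E.
Proof.
have := @le_kernel_mean +oo%E 1%E (lexx _).
rewrite /kappa_bar_norm hoelder_conjugatey; congr (_ <= _)%E.
rewrite Lnorm1; apply: eq_integral => t _; rewrite -abse_EFin; congr (`|_|)%E.
by rewrite !patchE; case: ifP => // _; rewrite expoy powRr0 divr1.
Qed.

Lemma mean_intE : mean_int%:E = (\int[mu]_t `|(kernel_mean \_ [set` D]) t|%:E)%E.
Proof. by rewrite fineK// ge0_fin_numE ?integral_ge0// (le_lt_trans int_le kby). Qed.

Lemma mean_int_le : (mean_int%:E <= kappa_bar_norm D psi omega kappa +oo)%E.
Proof. by rewrite mean_intE. Qed.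

Lemma ae_mean_sup : {ae mu, forall t,
  `|(kernel_mean \_ [set` D]) t| <= mean_sup * (psi \_ [set` D]) t}.
Proof.
have := ae_le_Lnormy mu ((fun t => (kernel_mean t / psi t)%:E) \_ [set` D]).
apply: (@filterS2 _ _ (ae_filter_ringOfSetsType mu) _ _ _ _ psi_gt0) => t psit.
rewrite -mean_supE !patchE; case: ifPn; last by rewrite normr0 mulr0.
rewrite inE => tD; have {}psit := psit tD.
by rewrite abse_EFin lee_fin normrM normfV (gtr0_norm psit) ler_pdivrMr.
Qed.

End kernel_mean.

(** * Components of the second decomposition *)

Lemma powR_exprn (R : realType) (x r : R) k : 0 <= x -> (x ^+ k) `^ r = (x `^ r) ^+ k.
Proof. by move=> x0; rewrite -!powR_mulrn ?powR_ge0// -!powRrM mulrC. Qed.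

Section fset_expansion.
Context {R : realType}.

Lemma mem_fsetval (K : choiceType) (u : {fset K}) (A : {set u}) (i : u) :
  (val i \in [fsetval y in A]%fset) = (i \in A).
Proof.
rewrite in_fset_val; case: insubP => [z _ /val_inj ->//|/negP].
by case; exact: valP.
Qed.

Lemma prod_fpowerset (u : {fset nat}) (a b : nat -> R) :
  \prod_(j <- u) (a j + b j) =
  \sum_(v <- fpowerset u) \prod_(j <- u) (if j \in v then a j else b j).
Proof.
rewrite big_seq_fsetE bigA_distr /fpowerset big_imfset; last first.
  move=> A B _ _ /fsetP AB; apply/setP => y.
  by have := AB (val y); rewrite !mem_fsetval.
rewrite [RHS]/= big_enum; apply: eq_big => [J|J _].
  by rewrite powersetE finset.subsetT.
by rewrite big_seq_fsetE; apply: eq_bigr => i _; rewrite mem_fsetval.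
Qed.

Lemma perm_fsetD (u v : {fset nat}) : fsubset v u -> perm_eq u (v ++ (u `\` v)%fset).
Proof.
move=> /fsubsetP vu; apply: uniq_perm; first exact: fset_uniq.
  rewrite cat_uniq !fset_uniq/= andbT; apply/hasPn => j.
  by rewrite in_fsetD => /andP[].
move=> j; rewrite mem_cat in_fsetD.
by case: (boolP (j \in v)) => //= /vu.
Qed.

Lemma Rintegral_bigsum d (T : measurableType d) (mu : {measure set T -> \bar R})
    (I : eqType) (s : seq I) (f : I -> T -> R) :
  (forall i, i \in s -> mu.-integrable setT (EFin \o f i)) ->
  mu.-integrable setT (fun x => (\sum_(i <- s) f i x)%:E) /\
  \int[mu]_x (\sum_(i <- s) f i x) = \sum_(i <- s) \int[mu]_x f i x.
Proof.
elim: s => [|i s IH] fi.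
  rewrite big_nil; under eq_Rintegral do rewrite big_nil; split.
    by under eq_fun do rewrite big_nil; exact: integrable0.
  by rewrite Rintegral_cst// mul0r.
have [|mI eI] := IH; first by move=> k ks; apply: fi; rewrite inE ks orbT.
have fii := fi i (mem_head _ _).
split; first by under eq_fun do rewrite big_cons EFinD; exact: integrableD.
by under eq_Rintegral do rewrite big_cons; rewrite big_cons -eI RintegralD.
Qed.

End fset_expansion.

Section anova_components.
Context {R : realType}.
Variables (D : interval R) (psi omega : R -> R) (kappa : R -> R -> R).
Hypothesis psi_meas : measurable_fun [set` D] psi.
Hypothesis psi_ge0 : forall t, t \in D -> 0 <= psi t.
Hypothesis psi_gt0 : {ae lebesgue_measure, forall t, t \in D -> 0 < psi t}.
Hypothesis kappa_meas : measurable_fun ([set` D] `*` [set` D])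
  (fun z : R * R => kappa z.1 z.2).
Hypothesis omega_meas : measurable_fun [set` D] omega.
Hypothesis omega_ge0 : forall t, t \in D -> 0 <= omega t.
Variable p : \bar R.
Hypothesis p1 : (1 <= p)%E.
Hypothesis kappa_hat_fin : forall x, x \in D -> (kappa_hat D psi kappa p x < +oo)%E.
Hypothesis kappa_bar_fin : forall q : \bar R, (1 <= q)%E ->
  (kappa_bar_norm D psi omega kappa q < +oo)%E.
Local Notation T := (measurableTypeR R).
Local Notation mu := (@lebesgue_measure R).
Local Notation mun n := (@lebesgue_tuple R n).
Implicit Types (u v w : {fset nat}).

Local Notation mean := (kernel_mean D omega kappa \_ [set` D]).
Local Notation M := (mean_sup D psi omega kappa).
Local Notation B := (mean_int D omega kappa).
Local Notation kan := (kappa_anova D omega kappa).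

Definition prod_mean w (b : #|` w|.-tuple T) : R := \prod_(j <- w) mean (coord b j).

(* h_v = \int g_u(t_u) \prod_(j in u \ v) I(kappa(., t_j)) dt_(u \ v), the
   contribution of K_u(g_u) to the component v of the second decomposition. *)
Definition component u v (g : #|` u|.-tuple T -> R) : #|` v|.-tuple T -> R :=
  marginal (mun #|` (u `\` v)%fset|)
    (fun z => (g \_ (@cube R D #|` u|)) (merge u z)) (@prod_mean (u `\` v)%fset).
Arguments component {u} v g _.

Lemma measurable_prod_mean w : measurable_fun setT (@prod_mean w).
Proof.
by apply: (@measurable_prod_coord _ w (fun=> mean)) => j; exact: measurable_kernel_meanT.
Qed.

Let measurable_merged u v w (g : #|` u|.-tuple T -> R) : measurable_fun (@cube R D _) g ->
  measurable_fun setT (fun z : #|` v|.-tuple T * #|` w|.-tuple T =>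
    (g \_ (@cube R D #|` u|)) (merge u z)).
Proof.
move=> mg; exact: measurableT_comp (measurable_patch_cube mg) (@measurable_merge _ u v w).
Qed.

Lemma measurable_component u v (g : #|` u|.-tuple T -> R) :
  measurable_fun (@cube R D _) g -> measurable_fun setT (component v g).
Proof.
move=> mg; apply: measurable_marginal; first exact: measurable_merged.
exact: measurable_prod_mean.
Qed.

Lemma component_patch u v (g : #|` u|.-tuple T -> R) : fsubset v u ->
  component v g \_ (@cube R D _) = component v g.
Proof.
move=> vu; apply/funext => a; rewrite patchE; case: ifPn => //; rewrite notin_setE => aD.
rewrite /component /marginal /Rintegral integral0_eq// => b _.
rewrite patchE memNset ?mul0r// => /(cube_merge _ _ (perm_fsetD vu)) [+ _].
exact: aD.
Qed.

Lemma prod_coord_const u (t : #|` u|.-tuple T) (f : T -> R) :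
  \prod_(j <- u) f (coord t j) = \prod_(i < #|` u|) f (tnth t i).
Proof. by rewrite -(prod_coord t (fun=> f)). Qed.

Lemma ae_prod_mean w : {ae mun #|` w|, forall b, `|@prod_mean w b| <=
  M ^+ #|` w| * \prod_(j <- w) (psi \_ [set` D]) (coord b j)}.
Proof.
have := @ae_tuple R #|` w| (fun=> [set t | `|mean t| <= M * (psi \_ [set` D]) t])
  (fun=> ae_mean_sup psi_meas psi_ge0 psi_gt0 kappa_meas omega_meas omega_ge0 (kappa_bar_fin (lexx _))).
apply: filterS => b hb; rewrite /prod_mean !prod_coord_const normr_prod.
rewrite -[X in M ^+ X]card_ord -prodr_const -big_split/=.
by apply: ler_prod => i _; rewrite normr_ge0 hb.
Qed.

Lemma integral_prod_mean w :
  (\int[mun #|` w|]_b `|@prod_mean w b|%:E = (B ^+ #|` w|)%:E)%E.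
Proof.
transitivity (\int[mun #|` w|]_b (\prod_(i < #|` w|) `|mean (tnth b i)|)%:E)%E.
  by apply: eq_integral => b _; rewrite /prod_mean prod_coord_const normr_prod.
rewrite (@ge0_integral_prod _ _ (fun _ t => `|mean t|)).
- rewrite -(mean_intE psi_meas kappa_meas omega_meas omega_ge0 (kappa_bar_fin (leey _))).
  by rewrite prodEFin prodr_const card_ord.
- by move=> _; apply: measurableT_comp => //; exact: measurable_kernel_meanT.
- by [].
Qed.

(** An instance of the bound for marginals on D^v x D^(u \ v): for a product of k means, the
    constants M and B become M^k and B^k, and the common power k can be taken out. *)
Lemma L_norm_component u v (g : #|` u|.-tuple T -> R) : fsubset v u ->
  L_space D psi p g ->
  (L_norm D psi p (component v g) <=
   ((M `^ expo p * B `^ (1 - expo p)) ^+ #|` (u `\` v)%fset|)%:E * L_norm D psi p g)%E.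
Proof.
move=> vu [mg gy]; set w := (u `\` v)%fset.
pose psiD := psi \_ [set` D].
have mpsi : measurable_fun setT psiD by exact: measurable_patch.
have psi0 t : 0 <= psiD t by exact: patch_psi_ge0.
pose rho x (a : #|` x|.-tuple T) := \prod_(j <- x) psiD (coord a j).
have mrho x : measurable_fun setT (@rho x).
  exact: (@measurable_prod_coord _ x (fun=> psiD)).
have rho0 x a : 0 <= @rho x a by apply: prodr_ge0.
have normE x (h : #|` x|.-tuple T -> R) : L_norm D psi p h =
    ('N[mun #|` x|]_p[(fun t => ((h \_ (@cube R D _)) t * rho x t `^ expo p)%:E)])%E.
  rewrite L_normE; apply: eq_Lnorm => t; rewrite /rho prod_coord_const.
  congr ((_ * (_ `^ _))%:E).
rewrite (normE v) component_patch//.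
have mF : measurable_fun setT (fun t : #|` u|.-tuple T =>
    ((g \_ (@cube R D _)) t * rho u t `^ expo p)%:E).
  apply/measurable_EFinP; apply: measurable_funM; first exact: measurable_patch_cube.
  exact: (measurableT_comp (measurable_powR _) (mrho u)).
have uvw := perm_fsetD vu.
have := Lnorm_merge uvw p1 mF.
rewrite (_ : (fun z => _) = (fun z => ((g \_ (@cube R D _)) (@merge _ u v w z) *
    (rho v z.1 * rho w z.2) `^ expo p)%:E)); last first.
  by apply/funext => z; rewrite /rho (prod_merge _ (fun=> psiD) uvw).
rewrite -normE => le_merge.
have M0 := mean_sup_ge0 D psi omega kappa; have B0 := mean_int_ge0 D omega kappa.
have intw := integral_prod_mean w.
have le_int : (\int[mun #|` w|]_b `|prod_mean b|%:E <= (B ^+ #|` w|)%:E)%E by rewrite intw.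
have := @Lnorm_marginal _ _ _ _ _ (mun #|` v|) (mun #|` w|)
  (fun z => (g \_ (@cube R D _)) (merge u z)) (@prod_mean w)
  (measurable_merged mg) (@measurable_prod_mean w)
  (@rho v) (@rho w) (M ^+ #|` w|) (B ^+ #|` w|) (mrho v) (mrho w) (rho0 v) (rho0 w)
  (exprn_ge0 _ M0) (exprn_ge0 _ B0) (ae_prod_mean w) le_int p p1
  (le_lt_trans le_merge gy).
move=> /le_trans; apply.
rewrite exprMn -(powR_exprn _ _ M0) -(powR_exprn _ _ B0).
apply: lee_wpmul2l => //.
by rewrite lee_fin mulr_ge0// powR_ge0.
Qed.

Lemma L_space_component u v (g : #|` u|.-tuple T -> R) : fsubset v u ->
  L_space D psi p g -> L_space D psi p (component v g).
Proof.
move=> vu gL; split.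
  by apply: measurable_funTS; apply: measurable_component; case: gL.
apply: le_lt_trans (L_norm_component vu gL) _.
rewrite lte_mul_pinfty ?lee_fin//; last by case: gL.
by rewrite exprn_ge0// mulr_ge0// powR_ge0.
Qed.

End anova_components.
Arguments component {R} D omega kappa {u} v g _.

Section anova_expansion.
Context {R : realType}.
Variables (D : interval R) (psi omega : R -> R) (kappa : R -> R -> R).
Hypothesis psi_meas : measurable_fun [set` D] psi.
Hypothesis psi_ge0 : forall t, t \in D -> 0 <= psi t.
Hypothesis psi_gt0 : {ae lebesgue_measure, forall t, t \in D -> 0 < psi t}.
Hypothesis kappa_meas : measurable_fun ([set` D] `*` [set` D])
  (fun z : R * R => kappa z.1 z.2).
Hypothesis omega_meas : measurable_fun [set` D] omega.
Hypothesis omega_ge0 : forall t, t \in D -> 0 <= omega t.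
Variable p : \bar R.
Hypothesis p1 : (1 <= p)%E.
Hypothesis kappa_hat_fin : forall x, x \in D -> (kappa_hat D psi kappa p x < +oo)%E.
Hypothesis kappa_bar_fin : forall q : \bar R, (1 <= q)%E ->
  (kappa_bar_norm D psi omega kappa q < +oo)%E.
Local Notation T := (measurableTypeR R).
Local Notation mun n := (@lebesgue_tuple R n).
Local Notation mean := (kernel_mean D omega kappa).
Local Notation kan := (kappa_anova D omega kappa).
Implicit Types (u v w : {fset nat}).

Lemma integrable_merge u v w (F : #|` u|.-tuple T -> R) : perm_eq u (v ++ w) ->
  (mun #|` u|).-integrable setT (EFin \o F) ->
  (mun #|` v| \x mun #|` w|)%E.-integrable setT (fun z => (F (merge u z))%:E).
Proof.
move=> uvw /integrableP[mF Fy]; apply/integrableP; split.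
  exact: measurableT_comp mF (@measurable_merge _ u v w).
have mnF := measurableT_comp (@abse_measurable R setT) mF.
by rewrite (ge0_integral_merge uvw mnF (fun t => abse_ge0 _)) in Fy.
Qed.

Lemma Rintegral_merge u v w (g : #|` u|.-tuple T -> R)
    (A : #|` v|.-tuple T -> R) (b : #|` w|.-tuple T -> R) (F : #|` u|.-tuple T -> R) :
  perm_eq u (v ++ w) -> (mun #|` u|).-integrable setT (EFin \o F) ->
  measurable_fun setT g -> measurable_fun setT A -> measurable_fun setT b ->
  (forall z : #|` v|.-tuple T * #|` w|.-tuple T,
    F (merge u z) = g (merge u z) * (A z.1 * b z.2)) ->
  \int[mun #|` u|]_t F t =
  \int[mun #|` v|]_a (marginal (mun #|` w|) (fun z => g (merge u z)) b a * A a).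
Proof.
move=> uvw IF mg mA mb FE; congr fine.
rewrite (integral_merge uvw (measurable_int _ IF)).
have IFm := integrable_merge uvw IF.
rewrite -(integral12_prod_meas1 IFm).
have mgm : measurable_fun setT (fun z : #|` v|.-tuple T * #|` w|.-tuple T => g (merge u z)).
  exact: measurableT_comp mg (@measurable_merge _ u v w).
apply: ae_eq_integral => //.
- exact: (measurable_fubini_F IFm).
- apply/measurable_EFinP; apply: measurable_funM; last exact: mA.
  exact: (@measurable_marginal _ _ _ _ _ (mun #|` w|) _ _ mgm mb).
apply: filterS (ae_integrable1 IFm) => a Ia _.
rewrite /fubini_F; under eq_integral do rewrite FE /=.
(* Fubini only makes g A(a) b integrable. Where A(a) is nonzero, dividing by it gives the
   integrability needed to take A(a) out; where A(a) = 0, both sides vanish. *)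
have [Aa0|Aa0] := eqVneq (A a) 0.
  by rewrite Aa0 mulr0 integral0_eq// => y _; rewrite mul0r mulr0.
have Igb : (mun #|` w|).-integrable setT (fun y => (g (merge u (a, y)) * b y)%:E).
  rewrite (_ : (fun y => _) = fun y => ((A a)^-1%:E * (F (merge u (a, y)))%:E)%E).
    exact: integrableZl.
  apply/funext => y; rewrite FE -EFinM; congr EFin.
  by rewrite mulrCA (mulrA (A a)^-1) mulVf// mul1r.
under eq_integral do rewrite mulrCA EFinM.
rewrite integralZl// EFinM muleC; congr (_ * _)%E.
by rewrite /marginal /Rintegral fineK// integrable_fin_num.
Qed.

Lemma Kop_restr (k : R -> R -> R) u (g : #|` u|.-tuple T -> R) (x : nat -> R) :
  Kop D k g (restr x u) = \int[mun #|` u|]_t ((g \_ (@cube R D _)) t *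
    \prod_(j <- u) (k (x j) \_ [set` D]) (coord t j)).
Proof.
rewrite KopE; apply: eq_Rintegral => t _; congr (_ * _).
rewrite -(prod_coord t (fun j => k (x j) \_ [set` D])).
by apply: eq_bigr => i _; rewrite tnth_mktuple.
Qed.

Lemma integrable_kernel_coord u (g : #|` u|.-tuple T -> R) (phi : nat -> R -> R) :
  L_space D psi p g -> {in u, forall j, dual_space D psi p (phi j)} ->
  (mun #|` u|).-integrable setT (fun t => ((g \_ (@cube R D _)) t *
    \prod_(j <- u) (phi j \_ [set` D]) (coord t j))%:E).
Proof.
move=> gL dphi.
have := @integrable_kernel _ _ _ psi_meas psi_ge0 psi_gt0 _ _ g
  (fun i => phi (nth 0%N u i)) p1 gL (fun i => dphi _ (mem_nth_fset i)).
congr (integrable _ _ _); apply/funext => t.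
by rewrite -(prod_coord t (fun j => phi j \_ [set` D])).
Qed.

(** Every term of the expanded product is integrable, because both the centred kernel and the mean
    lie in the dual space. The expansion can thus be integrated term by term, and integrating out u
    \ v first turns the term of v into an operator applied to the component v. *)
Lemma Kop_expand u (g : #|` u|.-tuple T -> R) (x : nat -> R) :
  L_space D psi p g -> (forall j, j \in u -> x j \in D) ->
  Kop D kappa g (restr x u) =
  \sum_(v <- fpowerset u) Kop D kan (component D omega kappa v g) (restr x v).
Proof.
move=> gL xD; rewrite Kop_restr.
pose phi v j := if j \in v then kan (x j) else mean.
have dphi v : {in u, forall j, dual_space D psi p (phi v j)}.
  move=> j ju; rewrite /phi; case: ifP => _.
    by apply: dual_space_anova => //; [exact: xD|exact/kappa_hat_fin/xD|exact: kappa_bar_fin].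
  by apply: dual_space_mean => //; exact: kappa_bar_fin.
have Iphi v := integrable_kernel_coord gL (dphi v).
have expand t : (g \_ (@cube R D _)) t * \prod_(j <- u) (kappa (x j) \_ [set` D]) (coord t j) =
    \sum_(v <- fpowerset u) (g \_ (@cube R D _)) t *
      \prod_(j <- u) (phi v j \_ [set` D]) (coord t j).
  rewrite -big_distrr/=; congr (_ * _).
  rewrite (eq_bigr (fun j => (kan (x j) \_ [set` D]) (coord t j) +
      (mean \_ [set` D]) (coord t j))).
    rewrite prod_fpowerset; apply: eq_bigr => v _; apply: eq_bigr => j _.
    by rewrite /phi; case: ifP.
  move=> j _; rewrite !patchE; case: ifP => _; last by rewrite addr0.
  by rewrite /kappa_anova subrK.
under eq_Rintegral do rewrite expand.
have [_ ->] := Rintegral_bigsum (fun v (_ : v \in fpowerset u) => Iphi v).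
rewrite big_seq [RHS]big_seq; apply: eq_bigr => v; rewrite fpowersetE => vu.
have mg : measurable_fun setT (g \_ (@cube R D _)).
  by apply: measurable_patch_cube; case: gL.
have uvw := perm_fsetD vu.
have mkan : {in u, forall j, measurable_fun setT (kan (x j) \_ [set` D])}.
  move=> j ju; apply: measurable_patch; apply: measurable_funB.
    by apply: measurable_kernel => //; exact: xD.
  exact: measurable_kernel_mean.
rewrite Kop_restr component_patch//.
rewrite (Rintegral_merge (v := v) (w := (u `\` v)%fset) (g := g \_ (@cube R D _))
  (A := fun a => \prod_(j <- v) (kan (x j) \_ [set` D]) (coord a j))
  (b := @prod_mean _ D omega kappa (u `\` v)%fset) uvw (Iphi v))//.
(* The point x is known to lie in D only at the labels of u; elsewhere the factor is replaced by 0,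
   so that measurability holds for every label. *)
- rewrite [X in measurable_fun _ X](_ : _ = fun a : #|` v|.-tuple T =>
    \prod_(j <- v) ((if j \in u then kan (x j) else cst 0) \_ [set` D]) (coord a j)).
    apply: (@measurable_prod_coord _ v
      (fun j => (if j \in u then kan (x j) else cst 0) \_ [set` D])) => j.
    case: ifPn => [/mkan//|_]; exact: measurable_patch.
  apply/funext => a; rewrite big_seq [RHS]big_seq; apply: eq_bigr => j jv.
  by rewrite (fsubsetP vu _ jv).
- exact: measurable_prod_mean.
move=> z; rewrite (prod_merge _ (fun j => phi v j \_ [set` D]) uvw); congr (_ * (_ * _)).
  rewrite big_seq [RHS]big_seq; apply: eq_bigr => j jv.
  by rewrite /phi jv.
rewrite /prod_mean big_seq [RHS]big_seq; apply: eq_bigr => j.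
by rewrite in_fsetD => /andP[jv _]; rewrite /phi (negPf jv).
Qed.

End anova_expansion.

(** * Uniqueness of the components *)

Section differences.
Context {R : realType}.
Implicit Types (f : (nat -> R) -> R) (x : nat -> R) (l : seq nat).

Definition diff0 (j : nat) f x : R := f x - f (upd x j 0).

Definition diffs l f : (nat -> R) -> R := foldr diff0 f l.

Definition indep (j : nat) f := forall x (a : R), f (upd x j a) = f x.

Lemma upd_upd x j (a b : R) : upd (upd x j a) j b = upd x j b.
Proof. by apply/funext => i; rewrite /upd; case: eqP. Qed.

Lemma updC x i j (a b : R) : i != j -> upd (upd x i a) j b = upd (upd x j b) i a.
Proof.
move=> ij; apply/funext => k; rewrite /upd; case: (eqVneq k j) => // ->.
by rewrite eq_sym (negPf ij).
Qed.

Lemma indep_diffs j l f : indep j f -> indep j (diffs l f).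
Proof.
move=> fj; elim: l => [//|i l IH] x a; rewrite /= /diff0 IH.
have [->|ij] := eqVneq i j; first by rewrite upd_upd.
by rewrite updC 1?eq_sym// IH.
Qed.

Lemma diffs_indep j l f x : j \in l -> indep j f -> diffs l f x = 0.
Proof.
move=> + fj; elim: l x => [//|i l IH] x; rewrite inE /= /diff0 => /predU1P[<-|jl].
  by rewrite indep_diffs// subrr.
by rewrite !IH// subr0.
Qed.

Lemma diffs_sum (I : Type) (r : seq I) (F : I -> (nat -> R) -> R) l x :
  diffs l (fun y => \sum_(i <- r) F i y) x = \sum_(i <- r) diffs l (F i) x.
Proof. by elim: l x => [//|j l IH] x; rewrite /= /diff0 !IH -sumrB. Qed.

Lemma diffs_eq0 (P : (nat -> R) -> Prop) f : (forall x j, P x -> P (upd x j 0)) ->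
  (forall x, P x -> f x = 0) -> forall l x, P x -> diffs l f x = 0.
Proof.
move=> Pupd f0; elim=> [//|j l IH] x Px /=.
by rewrite /diff0 !IH ?subr0//; exact: Pupd.
Qed.

End differences.

Section uniqueness.
Context {R : realType}.
Variables (s : option nat) (D : interval R) (psi omega : R -> R) (kappa : R -> R -> R).
Hypothesis D0 : 0 \in D.
Hypothesis psi_meas : measurable_fun [set` D] psi.
Hypothesis psi_ge0 : forall t, t \in D -> 0 <= psi t.
Hypothesis psi_gt0 : {ae lebesgue_measure, forall t, t \in D -> 0 < psi t}.
Hypothesis kappa_meas : measurable_fun ([set` D] `*` [set` D])
  (fun z : R * R => kappa z.1 z.2).
Hypothesis omega_meas : measurable_fun [set` D] omega.
Hypothesis omega_ge0 : forall t, t \in D -> 0 <= omega t.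
Hypothesis kappa0 : forall t, t \in D -> kappa 0 t = 0.
Variable p : \bar R.
Hypothesis p1 : (1 <= p)%E.
Hypothesis kappa_hat_fin : forall x, x \in D -> (kappa_hat D psi kappa p x < +oo)%E.
Hypothesis kappa_bar_fin : forall q : \bar R, (1 <= q)%E ->
  (kappa_bar_norm D psi omega kappa q < +oo)%E.
Hypothesis injK : injective_K s D psi kappa p.
Local Notation T := (measurableTypeR R).
Local Notation mun n := (@lebesgue_tuple R n).
Local Notation kan := (kappa_anova D omega kappa).
Implicit Types (u v w : {fset nat}) (x : nat -> R).


(** The list [l] holds the directions in which a difference at the anchor has already been taken:
    there the centred kernel has become kappa. *)
Definition mixed_kernel v (g : #|` v|.-tuple T -> R) (l : seq nat) x : R :=
  \int[mun #|` v|]_t ((g \_ (@cube R D _)) t *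
    \prod_(j <- v) ((if j \in l then kappa (x j) else kan (x j)) \_ [set` D]) (coord t j)).

Let dual_mixed (l : seq nat) x j : (forall j, x j \in D) ->
  dual_space D psi p (if j \in l then kappa (x j) else kan (x j)).
Proof.
move=> xD; case: ifP => _; first by apply: dual_space_kernel => //; exact: kappa_hat_fin.
by apply: dual_space_anova => //; [exact: kappa_hat_fin|exact: kappa_bar_fin].
Qed.

Lemma mixed_kernel_diff v (g : #|` v|.-tuple T -> R) l j x : (forall j, x j \in D) ->
  L_space D psi p g -> j \in v -> j \notin l ->
  diff0 j (mixed_kernel g l) x = mixed_kernel g (j :: l) x.
Proof.
move=> xD gL jv jl; rewrite /diff0 /mixed_kernel.
have x'D i : upd x j 0 i \in D by rewrite /upd; case: ifP.
have I1 := integrable_kernel_coord psi_meas psi_ge0 psi_gt0 p1 gL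
  (fun i _ => dual_mixed l i xD).
have I2 := integrable_kernel_coord psi_meas psi_ge0 psi_gt0 p1 gL
  (fun i _ => dual_mixed l i x'D).
rewrite -RintegralB//; apply: eq_Rintegral => t _; rewrite -mulrBr; congr (_ * _).
rewrite !(bigD1_seq j)//= !inE eqxx (negPf jl)/=.
have rest : \prod_(i <- v | i != j)
      ((if i \in l then kappa (upd x j 0 i) else kan (upd x j 0 i)) \_ [set` D]) (coord t i) =
    \prod_(i <- v | i != j)
      ((if i \in l then kappa (x i) else kan (x i)) \_ [set` D]) (coord t i).
  by apply: eq_bigr => i ij; rewrite /upd (negPf ij).
have rest' : \prod_(i <- v | i != j)
      ((if i \in j :: l then kappa (x i) else kan (x i)) \_ [set` D]) (coord t i) =
    \prod_(i <- v | i != j)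
      ((if i \in l then kappa (x i) else kan (x i)) \_ [set` D]) (coord t i).
  by apply: eq_bigr => i ij; rewrite inE (negPf ij).
rewrite rest rest' -mulrBl; congr (_ * _).
rewrite {1}/upd eqxx !patchE; case: ifPn; last by rewrite subr0.
by rewrite inE => tD; rewrite /kappa_anova opprB addrA subrK kappa0// subr0.
Qed.

Lemma mixed_kernel_diffs v (g : #|` v|.-tuple T -> R) l x : (forall j, x j \in D) ->
  L_space D psi p g -> uniq l -> {subset l <= v} ->
  diffs l (mixed_kernel g [::]) x = mixed_kernel g l x.
Proof.
move=> xD gL; elim: l x xD => [//|j l IH] x xD /= /andP[jl ul] jlv.
rewrite -mixed_kernel_diff//; last exact/jlv/mem_head.
have lv : {subset l <= v} by move=> i il; apply: jlv; rewrite inE il orbT.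
by rewrite /diff0 !IH// => i; rewrite /upd; case: ifP.
Qed.

(* If v is maximal in V, the difference operators at the anchor 0 in the
   directions of v kill every term u != v of the sum and replace the kernel
   kappa - I(kappa) of the term v by kappa(x, t) - kappa(0, t) = kappa(x, t), so
   that K_v (d v) = 0. *)
Lemma anova_unique (V : {fset {fset nat}}) (d : forall v, #|` v|.-tuple T -> R) :
  (forall v, v \in V -> [set` v] `<=` coords s) ->
  (forall v, v \in V -> L_space D psi p (d v)) ->
  (forall x, (forall j, x j \in D) ->
    \sum_(v <- V) Kop D kan (d v) (restr x v) = 0) ->
  forall v, v \in V -> {ae mun #|` v|, forall t, @cube R D _ t -> d v t = 0}.
Proof.
have [n] := ubnP #|` V|; elim: n V => // n IH V; rewrite ltnS => Vn Vs VL V0 v0 v0V.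
have [v vV vmax] : exists2 v, v \in V & forall u, u \in V -> (#|` u| <= #|` v|)%N.
  have [v] := @arg_maxnP _ [` v0V]%fset predT (fun u : V => #|` val u|) isT.
  move=> _ vmax; exists (val v); first exact: valP.
  by move=> u uV; exact: (vmax [` uV]%fset).
have mixE u x : Kop D kan (d u) (restr x u) = mixed_kernel (d u) [::] x.
  by rewrite Kop_restr.
have Kv0 y : @cube R D _ y -> Kop D kappa (d v) y = 0.
  move=> yD; pose x := ins v y (cst 0).
  have xD j : x j \in D.
    rewrite /x /ins; case: ifPn => // jv.
    by have /cube_coord := yD; apply.
  rewrite -(restr_ins y (cst 0)) -/x.
  transitivity (mixed_kernel (d v) v x).
    rewrite Kop_restr; apply: eq_Rintegral => t _; congr (_ * _).
    by rewrite big_seq [RHS]big_seq; apply: eq_bigr => j jv; rewrite jv.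
  rewrite -mixed_kernel_diffs ?fset_uniq//; last exact: VL.
  have : diffs v (fun x => \sum_(u <- V) mixed_kernel (d u) [::] x) x = 0.
    apply: (@diffs_eq0 _ (fun x => forall j, x j \in D)) => // [z j zD i|z zD].
      by rewrite /upd; case: ifP.
    by rewrite -[RHS](V0 z zD); apply: eq_bigr => u _; rewrite mixE.
  rewrite diffs_sum (big_fsetD1 v)//= big1_fset ?addr0// => u.
  rewrite in_fsetD1 => /andP[uv uV] _.
  have /fsubsetPn[j jv ju] : ~~ fsubset v u.
    apply: contra uv => vu; apply/eqP/esym/eqP; rewrite eqEfcard vu; exact: vmax.
  apply: (diffs_indep _ jv) => z a; rewrite -!mixE; congr Kop.
  apply: eq_coord => i iu; rewrite !coord_restr// /upd.
  by case: eqP => // ij; move: ju; rewrite -ij iu.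
have dv0 := injK (Vs v vV) (VL v vV) Kv0.
have [->//|v0v] := eqVneq v0 v.
(* Since d v vanishes almost everywhere, its term drops out of the sum, and the induction on the
   number of terms continues without v. *)
apply: (IH (V `\ v)%fset); rewrite ?in_fsetD1 ?v0v//.
- by apply: leq_trans Vn; rewrite [in leqRHS](cardfsD1 v) vV.
- by move=> u; rewrite in_fsetD1 => /andP[_]; exact: Vs.
- by move=> u; rewrite in_fsetD1 => /andP[_]; exact: VL.
move=> x xD; have := V0 x xD; rewrite (big_fsetD1 v)//=.
suff -> : Kop D kan (d v) (restr x v) = 0 by rewrite add0r.
rewrite mixE /mixed_kernel.
have I1 := integrable_kernel_coord psi_meas psi_ge0 psi_gt0 p1 (VL v vV)
  (fun i _ => dual_mixed [::] i xD).
rewrite /Rintegral (ae_eq_integral (cst 0%E)) ?integral0//.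
  exact: measurable_int I1.
apply: filterS dv0 => t dt _ /=.
by rewrite patchE; case: ifPn; rewrite ?mul0r// inE => tD; rewrite dt// mul0r.
Qed.

End uniqueness.

(** * Finite sums in the spaces L_{u,p,psi} *)

Section L_space_sums.
Context {R : realType}.
Variables (D : interval R) (psi : R -> R).
Hypothesis psi_meas : measurable_fun [set` D] psi.
Hypothesis psi_ge0 : forall t, t \in D -> 0 <= psi t.
Hypothesis psi_gt0 : {ae lebesgue_measure, forall t, t \in D -> 0 < psi t}.
Variable p : \bar R.
Hypothesis p1 : (1 <= p)%E.
Local Notation T := (measurableTypeR R).
Local Notation mun n := (@lebesgue_tuple R n).

Let F n (g : n.-tuple T -> R) t := ((g \_ (@cube R D n)) t *
     (\prod_(i < n) (psi \_ [set` D]) (tnth t i)) `^ expo p).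

Let mF n (g : n.-tuple T -> R) : measurable_fun (@cube R D n) g -> measurable_fun setT (F g).
Proof. exact: measurable_L_norm_integrand. Qed.

Let normE n (g : n.-tuple T -> R) : L_norm D psi p g = ('N[mun n]_p[EFin \o F g])%E.
Proof. exact: L_normE. Qed.

Lemma L_norm_ge0 n (g : n.-tuple T -> R) : (0 <= L_norm D psi p g)%E.
Proof. exact: Lnorm_ge0. Qed.

Lemma L_normD n (g h : n.-tuple T -> R) :
  measurable_fun (@cube R D n) g -> measurable_fun (@cube R D n) h ->
  (L_norm D psi p (fun t => (g t + h t)%R) <= L_norm D psi p g + L_norm D psi p h)%E.
Proof.
move=> mg mh; have := eminkowski (mun n) (mF mg) (mF mh) p1.
rewrite !normE; congr (_ <= _)%E; apply: eq_Lnorm => t; congr EFin.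
by rewrite /F/= -mulrDl !patchE; case: ifP => //; rewrite addr0.
Qed.

Lemma L_norm_cst0 n : L_norm D psi p (fun _ : n.-tuple T => 0) = 0%E.
Proof.
have p0 : p != 0%E by rewrite gt_eqF// (lt_le_trans _ p1).
rewrite normE -[RHS](Lnorm0 (mun n) p0); apply: eq_Lnorm => t /=.
by rewrite /F patchE; case: ifP => _; rewrite mul0r.
Qed.

Lemma L_space0 n : L_space D psi p (fun _ : n.-tuple T => 0).
Proof. by split; [exact: measurable_cst|rewrite L_norm_cst0]. Qed.

Lemma L_spaceD n (g h : n.-tuple T -> R) : L_space D psi p g -> L_space D psi p h ->
  L_space D psi p (fun t => (g t + h t)%R).
Proof.
move=> [mg gy] [mh hy]; split; first exact: measurable_funD.
apply: le_lt_trans (L_normD mg mh) _.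
by rewrite lte_add_pinfty.
Qed.

Lemma L_norm_opp n (g : n.-tuple T -> R) :
  L_norm D psi p (fun t => - g t) = L_norm D psi p g.
Proof.
rewrite !normE -[RHS]oppe_Lnorm; apply: eq_Lnorm => t /=; congr EFin.
by rewrite /F -mulNr !patchE; case: ifP => //; rewrite oppr0.
Qed.

Lemma L_spaceN n (g : n.-tuple T -> R) : L_space D psi p g ->
  L_space D psi p (fun t => - g t).
Proof.
by move=> [mg gy]; split; [exact: measurableT_comp|rewrite L_norm_opp].
Qed.

Lemma L_space_sum n (I : eqType) (s : seq I) (g : I -> n.-tuple T -> R) :
  (forall i, i \in s -> L_space D psi p (g i)) ->
  L_space D psi p (fun t => \sum_(i <- s) g i t).
Proof.
elim: s => [|i s IH] gs.
  by under eq_fun do rewrite big_nil; exact: L_space0.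
under eq_fun do rewrite big_cons; apply: L_spaceD; first exact/gs/mem_head.
by apply: IH => k ks; apply: gs; rewrite inE ks orbT.
Qed.

Lemma L_norm_sum n (I : eqType) (s : seq I) (g : I -> n.-tuple T -> R) :
  (forall i, i \in s -> L_space D psi p (g i)) ->
  (L_norm D psi p (fun t => \sum_(i <- s) g i t)%R <= \sum_(i <- s) L_norm D psi p (g i))%E.
Proof.
elim: s => [|i s IH] gs.
  by rewrite big_nil; under eq_fun do rewrite big_nil; rewrite L_norm_cst0.
have gs' k : k \in s -> L_space D psi p (g k) by move=> ks; apply: gs; rewrite inE ks orbT.
under eq_fun do rewrite big_cons; rewrite big_cons.
apply: le_trans (L_normD _ _) _.
- by case: (gs i (mem_head _ _)).
- by case: (L_space_sum gs').
by apply: leeD => //; exact: IH.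
Qed.

Lemma ae_eq_L_norm n (g h : n.-tuple T -> R) :
  measurable_fun (@cube R D n) g -> measurable_fun (@cube R D n) h ->
  {ae mun n, forall t, @cube R D n t -> g t = h t} ->
  L_norm D psi p g = L_norm D psi p h.
Proof.
move=> mg mh gh; rewrite !normE; apply/eqP; rewrite eq_le.
have E : {ae mun n, forall t, F g t = F h t}.
  apply: filterS gh => t ght; rewrite /F !patchE; case: ifPn => //.
  by rewrite inE => tD; rewrite ght.
by apply/andP; split; apply: le_Lnorm => //;
  try (by apply/measurable_EFinP; exact: mF);
  apply: filterS E => t /= ->.
Qed.

Lemma Kop_sum n (I : eqType) (s : seq I) (g : I -> n.-tuple T -> R) (k : R -> R -> R)
    (x : n.-tuple T) : (forall i, dual_space D psi p (k (tnth x i))) ->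
  (forall i, i \in s -> L_space D psi p (g i)) ->
  Kop D k (fun t => \sum_(i <- s) g i t) x = \sum_(i <- s) Kop D k (g i) x.
Proof.
move=> dk gs; rewrite KopE; under [RHS]eq_bigr do rewrite KopE.
have Ig i : i \in s -> (mun n).-integrable setT (EFin \o (fun t => (g i \_ (@cube R D n)) t *
    \prod_(l < n) (k (tnth x l) \_ [set` D]) (tnth t l))).
  by move=> si; exact: (integrable_kernel psi_meas psi_ge0 psi_gt0 p1 (gs i si)).
have [_ <-] := Rintegral_bigsum Ig; apply: eq_Rintegral => t _.
rewrite -big_distrl/=; congr (_ * _); rewrite patchE; case: ifPn => tD.
  by apply: eq_bigr => i _; rewrite patchE tD.
by rewrite big1// => i _; rewrite patchE (negPf tD).
Qed.

Lemma KopB n (g h : n.-tuple T -> R) (k : R -> R -> R) (x : n.-tuple T) :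
  (forall i, dual_space D psi p (k (tnth x i))) ->
  L_space D psi p g -> L_space D psi p h ->
  Kop D k (fun t => g t - h t) x = Kop D k g x - Kop D k h x.
Proof.
move=> dk gL hL; rewrite !KopE -RintegralB//; last 2 first.
- exact: (integrable_kernel psi_meas psi_ge0 psi_gt0 p1 gL).
- exact: (integrable_kernel psi_meas psi_ge0 psi_gt0 p1 hL).
apply: eq_Rintegral => t _; rewrite -mulrBl; congr (_ * _).
by rewrite !patchE; case: ifP => //; rewrite subr0.
Qed.

Lemma Kop0 n (k : R -> R -> R) (x : n.-tuple T) : Kop D k (fun=> 0) x = 0.
Proof.
rewrite /Kop /Rintegral integral0_eq// => t _; by rewrite mul0r.
Qed.

End L_space_sums.

(** * Passing from the first decomposition to the second *)

Section representations.
Context {R : realType}.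
Variables (s : option nat) (D : interval R) (psi omega : R -> R) (kappa : R -> R -> R).
Variable gamma : {fset nat} -> R.
Hypothesis D0 : 0 \in D.
Hypothesis psi_meas : measurable_fun [set` D] psi.
Hypothesis psi_ge0 : forall t, t \in D -> 0 <= psi t.
Hypothesis psi_gt0 : {ae lebesgue_measure, forall t, t \in D -> 0 < psi t}.
Hypothesis kappa_meas : measurable_fun ([set` D] `*` [set` D])
  (fun z : R * R => kappa z.1 z.2).
Hypothesis omega_meas : measurable_fun [set` D] omega.
Hypothesis omega_ge0 : forall t, t \in D -> 0 <= omega t.
Hypothesis kappa0 : forall t, t \in D -> kappa 0 t = 0.
Hypothesis gamma_weights : downward_closed_weights s gamma.
Variable p : \bar R.
Hypothesis p1 : (1 <= p)%E.
Hypothesis kappa_hat_fin : forall x, x \in D -> (kappa_hat D psi kappa p x < +oo)%E.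
Hypothesis kappa_bar_fin : forall q : \bar R, (1 <= q)%E ->
  (kappa_bar_norm D psi omega kappa q < +oo)%E.
Hypothesis injK : injective_K s D psi kappa p.
Local Notation T := (measurableTypeR R).
Local Notation mun n := (@lebesgue_tuple R n).
Local Notation kan := (kappa_anova D omega kappa).
Local Notation family := (forall u : {fset nat}, #|` u|.-tuple T -> R).
Implicit Types (u v w : {fset nat}) (x : nat -> R) (U V : {fset {fset nat}}).

(** A component g_u contributes to the components of all subsets of u in the second decomposition.
    Their weights are positive because positivity is inherited by subsets. *)
Definition down_closure U : {fset {fset nat}} := (\bigcup_(u <- U) fpowerset u)%fset.

Lemma mem_down_closure U v : reflect (exists2 u, u \in U & fsubset v u) (v \in down_closure U).
Proof.
apply: (iffP (bigfcupP _ _ _ _)) => [[u /andP[uU _]]|[u uU vu]].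
  by rewrite fpowersetE => vu; exists u.
by exists u; rewrite ?uU// fpowersetE.
Qed.

Definition anova_family U (g : family) : family := fun v t =>
  \sum_(u <- [seq u <- U | fsubset v u]) component D omega kappa v (g u) t.

Lemma L_space_anova_family U g v : (forall u, u \in U -> L_space D psi p (g u)) ->
  L_space D psi p (@anova_family U g v).
Proof.
move=> gL; apply: L_space_sum => // u; rewrite mem_filter => /andP[vu uU].
by apply: L_space_component => //; exact: gL.
Qed.

Lemma represents_anova f U g : represents s D psi gamma kappa p f U g ->
  represents s D psi gamma kan p f (down_closure U) (anova_family U g).
Proof.
move=> [Us gL fE]; split.
- move=> v /mem_down_closure[u uU vu]; have [us gu] := Us u uU; split.
    by move=> j /= jv; apply: us; exact: (fsubsetP vu).
  exact: gamma_weights.2 us vu gu.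
- by move=> v _; exact: L_space_anova_family.
move=> x xD; rewrite fE//.
have xDu u : u \in U -> forall j, j \in u -> x j \in D.
  by move=> uU j ju; apply: xD; apply: (Us u uU).1.
transitivity (\sum_(u <- U) \sum_(v <- down_closure U | fsubset v u)
    Kop D kan (component D omega kappa v (g u)) (restr x v)).
  rewrite big_seq [RHS]big_seq; apply: eq_bigr => u uU.
  rewrite (Kop_expand psi_meas psi_ge0 psi_gt0 kappa_meas omega_meas omega_ge0 p1
    kappa_hat_fin kappa_bar_fin (gL u uU) (xDu u uU)).
  rewrite [RHS]big_fset_condE; apply: eq_fbigl => v; rewrite fpowersetE !inE/=.
  apply/idP/andP => [vu|[_ //]]; split => //.
  by apply/mem_down_closure; exists u.
rewrite (exchange_big_dep predT)//= big_seq [RHS]big_seq; apply: eq_bigr => v.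
move=> /mem_down_closure[u uU vu].
rewrite (Kop_sum psi_meas psi_ge0 psi_gt0 p1).
- by rewrite big_filter.
- move=> i; rewrite tnth_mktuple.
  have xvD : x (nth 0%N v i) \in D.
    by apply: (xDu u uU); apply: (fsubsetP vu); exact: mem_nth_fset.
  by apply: dual_space_anova => //; [exact: kappa_hat_fin|exact: kappa_bar_fin].
move=> w; rewrite mem_filter => /andP[vw wU].
by apply: L_space_component => //; exact: gL.
Qed.

(** Two representations of the same function may have different index sets; extended by 0 they can
    be subtracted on the union. *)
Definition ext_family V (h : family) : family := fun v => if v \in V then h v else fun=> 0.

(** Components are determined only up to null sets, which suffices for their norms. A component
    missing from V' must be null, hence the value 0. *)
Lemma represents_unique f V h V' h' :
  represents s D psi gamma kan p f V h -> represents s D psi gamma kan p f V' h' ->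
  forall v, v \in V ->
    L_norm D psi p (h v) = if v \in V' then L_norm D psi p (h' v) else 0%E.
Proof.
move=> [Vs hL fE] [Vs' hL' fE'] v vV.
have extL W (k : family) w : (forall v, v \in W -> L_space D psi p (k v)) ->
    L_space D psi p (@ext_family W k w).
  by move=> kL; rewrite /ext_family; case: ifPn => [/kL//|_]; exact: L_space0.
have eL w : L_space D psi p (@ext_family V h w) by exact: extL.
have eL' w : L_space D psi p (@ext_family V' h' w) by exact: extL.
pose d w t := @ext_family V h w t - @ext_family V' h' w t.
have sumE W (k : family) x : fsubset W (V `|` V')%fset ->
    \sum_(w <- W) Kop D kan (k w) (restr x w) =
    \sum_(w <- (V `|` V')%fset) Kop D kan (@ext_family W k w) (restr x w).
  move=> WV; rewrite -(big_fset_incl _ WV); last first.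
    by move=> w _ wW; rewrite /ext_family (negPf wW) Kop0.
  by rewrite big_seq [RHS]big_seq; apply: eq_bigr => w wW; rewrite /ext_family wW.
have d0 := @anova_unique _ s _ _ _ _ D0 psi_meas psi_ge0 psi_gt0 kappa_meas omega_meas
  omega_ge0 kappa0 p p1 kappa_hat_fin kappa_bar_fin injK (V `|` V')%fset d.
have /= := d0 _ _ _ v; rewrite in_fsetU vV => /(_ _ _ _ isT) dv0.
have : {ae mun #|` v|, forall t, @cube R D _ t -> d v t = 0}.
  apply: dv0.
  - by move=> w; rewrite in_fsetU => /orP[/Vs[]//|/Vs'[]].
  - by move=> w _; apply: L_spaceD => //; exact: L_spaceN.
  move=> x xD; rewrite (eq_bigr (fun w => Kop D kan (@ext_family V h w) (restr x w) -
      Kop D kan (@ext_family V' h' w) (restr x w))).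
    rewrite sumrB -!sumE ?fsubsetUl ?fsubsetUr//.
    by rewrite -fE ?fE' ?subrr// => j _.
  move=> w _; apply: (KopB psi_meas psi_ge0 psi_gt0 p1) => // i; rewrite tnth_mktuple.
  by apply: dual_space_anova => //; [exact: kappa_hat_fin|exact: kappa_bar_fin].
move=> dE; transitivity (L_norm D psi p (@ext_family V' h' v)); last first.
  by rewrite /ext_family; case: ifP => // _; rewrite L_norm_cst0.
apply: ae_eq_L_norm => //; first by case: (hL v vV).
  by case: (eL' v).
apply: filterS dE => t dt /dt; rewrite /d {1}/ext_family vV => /eqP.
by rewrite subr_eq0 => /eqP.
Qed.

End representations.

(** * Weighted l_q norms *)

Section discrete.
Context {R : realType}.

(** Normalising by the two sums reduces this to the inequality x^t y^(1-t) <= t x + (1-t) y. In this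
    form of Hoelder's inequality the exponents t = 0 and t = 1 are admissible, as the interpolation
    requires. *)
Lemma hoelder_sum (I : Type) (s : seq I) (x y : I -> R) (t : R) :
  0 <= t <= 1 -> (forall i, 0 <= x i) -> (forall i, 0 <= y i) ->
  \sum_(i <- s) x i `^ t * y i `^ (1 - t) <=
  (\sum_(i <- s) x i) `^ t * (\sum_(i <- s) y i) `^ (1 - t).
Proof.
move=> /andP[]; rewrite le_eqVlt => /predU1P[<-|t0].
  move=> _ x0 y0; rewrite powRr0 mul1r subr0 powRr1 ?sumr_ge0//.
  by under eq_bigr do rewrite powRr0 mul1r powRr1//.
rewrite le_eqVlt => /predU1P[->|t1] x0 y0.
  rewrite subrr powRr0 mulr1 powRr1 ?sumr_ge0//.
  by under eq_bigr do rewrite powRr0 mulr1 powRr1//.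
have t'0 : 0 < 1 - t by rewrite subr_gt0.
set X := \sum_(i <- s) x i; set Y := \sum_(i <- s) y i.
have X0 : 0 <= X by apply: sumr_ge0.
have Y0 : 0 <= Y by apply: sumr_ge0.
(* The normalisation divides by the two sums. If one of them vanishes, so do all its terms, and with
   them the left-hand side. *)
have zero (z : I -> R) : (forall i, 0 <= z i) -> \sum_(i <- s) z i = 0 ->
    forall (f : I -> R) r, 0 < r -> \sum_(i <- s) z i `^ r * f i = 0.
  move=> z0 Z0 f r r0; elim: s Z0 {X Y X0 Y0} => [|i s IH]; first by rewrite !big_nil.
  rewrite !big_cons => /eqP; rewrite paddr_eq0//; last exact: sumr_ge0.
  by move=> /andP[/eqP -> /eqP /IH ->]; rewrite powR0 ?gt_eqF// mul0r addr0.
have [X_0|X_0] := eqVneq X 0.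
  by rewrite (zero x)// mulr_ge0// powR_ge0.
have [Y_0|Y_0] := eqVneq Y 0.
  by under eq_bigr do rewrite mulrC; rewrite (zero y)// mulr_ge0// powR_ge0.
have Xp : 0 < X by rewrite lt_def X_0.
have Yp : 0 < Y by rewrite lt_def Y_0.
have XY0 : 0 < X `^ t * Y `^ (1 - t) by rewrite mulr_gt0// powR_gt0.
rewrite -[leRHS]mul1r -ler_pdivrMr// mulr_suml.
apply: (@le_trans _ _ (\sum_(i <- s) (t * (x i / X) + (1 - t) * (y i / Y)))).
  apply: ler_sum => i _.
  have -> : x i `^ t * y i `^ (1 - t) / (X `^ t * Y `^ (1 - t)) =
      (x i / X) `^ t * (y i / Y) `^ (1 - t).
    have inv z r : 0 <= z -> z^-1 `^ r = (z `^ r)^-1 :> R.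
      by move=> z0; rewrite -[in LHS](powR_inv1 z0) -powRrM mulN1r powRN.
    by rewrite !powRM ?invr_ge0// !inv// invfM mulrACA.
  have := @conjugate_powR R ((x i / X) `^ t) ((y i / Y) `^ (1 - t)) t^-1 (1 - t)^-1.
  rewrite !invrK !powR_ge0 !invr_gt0 t0 t'0 addrC subrK => /(_ isT isT isT isT erefl).
  rewrite -!powRrM !mulfV ?gt_eqF// !powRr1 ?divr_ge0//.
  by rewrite (mulrC t) (mulrC (1 - t)).
rewrite big_split/= -!mulr_sumr -!mulr_suml -/X -/Y !divff// !mulr1.
by rewrite addrC subrK.
Qed.

Lemma lq_norm_fsetr (I : choiceType) (r : R) (U : {fset I}) (a : I -> \bar R) :
  lq_norm r%:E [set` U] a = ((\sum_(i <- U) a i `^ r) `^ r^-1)%E.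
Proof.
rewrite /lq_norm esum_fset//; last by move=> i _; exact: poweR_ge0.
by rewrite fsbig_finite//= set_fsetK.
Qed.

Lemma lq_norm_fsety_le (I : choiceType) (U : {fset I}) (a : I -> \bar R) (c : \bar R) :
  (0 <= c)%E -> (forall i, i \in U -> (a i <= c)%E) -> (lq_norm +oo [set` U] a <= c)%E.
Proof.
move=> c0 ac; apply: ge_ereal_sup => _ [->//|[i iU <-]]; exact: ac.
Qed.

Lemma lq_norm_fsety_ge (I : choiceType) (U : {fset I}) (a : I -> \bar R) i :
  i \in U -> (a i <= lq_norm +oo [set` U] a)%E.
Proof. by move=> iU; apply: ereal_sup_ubound; right; exists i. Qed.

Lemma lq_norm_ge0 (I : choiceType) (q : \bar R) (U : set I) (a : I -> \bar R) :
  (0 <= lq_norm q U a)%E.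
Proof.
by case: q => [r||] /=; [exact: poweR_ge0| |]; apply: ereal_sup_ubound; left.
Qed.

Lemma le_lq_norm (I : choiceType) (q : \bar R) (U : {fset I}) (a b : I -> \bar R) :
  (1 <= q)%E -> (forall i, i \in U -> (0 <= a i)%E) ->
  (forall i, i \in U -> (a i <= b i)%E) ->
  (lq_norm q [set` U] a <= lq_norm q [set` U] b)%E.
Proof.
move=> /ge1_cases[->|[r r1 ->]] a0 ab.
  apply: lq_norm_fsety_le; first exact: lq_norm_ge0.
  by move=> i iU; apply: le_trans (ab i iU) (lq_norm_fsety_ge _ iU).
have r0 : 0 < r by rewrite (lt_le_trans _ r1).
rewrite !lq_norm_fsetr//; apply: ler_poweR; first by rewrite invr_ge0 ltW.
  by apply: sume_ge0 => i _; exact: poweR_ge0.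
rewrite big_seq [leRHS]big_seq; apply: lee_sum => i iU.
by apply: ler_poweR; [exact: ltW|exact: a0|exact: ab].
Qed.

(** For q = r finite and e = 1/r, Hoelder applied to K n <= S^(1-e) (Z n^r)^e separates the row sums
    of S from a sum which, after exchanging the order of summation, meets only the column sums of Z.
    Allowing S and Z to differ from K and from each other is what makes the test usable for
    interpolation. *)
Lemma schur_test (I : choiceType) (U V : {fset I}) (q : \bar R) (K S Z : I -> I -> R)
    (a b : R) (n : I -> R) : (1 <= q)%E ->
  (forall v u, 0 <= K v u) -> (forall v u, 0 <= S v u) -> (forall v u, 0 <= Z v u) ->
  (forall v u, v \in V -> u \in U ->
    K v u <= S v u `^ (1 - expo q) * Z v u `^ expo q) ->
  0 <= a -> 0 <= b ->
  (forall v, v \in V -> \sum_(u <- U) S v u <= a) ->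
  (forall u, u \in U -> \sum_(v <- V) Z v u <= b) ->
  (forall u, 0 <= n u) ->
  (lq_norm q [set` V] (fun v => (\sum_(u <- U) K v u * n u)%:E) <=
   (a `^ (1 - expo q) * b `^ expo q)%:E * lq_norm q [set` U] (EFin \o n))%E.
Proof.
move=> /ge1_cases[->|[r r1 ->]] K0 S0 Z0 KSZ a0 b0 Sa Zb n0.
  move: KSZ; rewrite expoy subr0 powRr0 mulr1 powRr1// => KSZ.
  have N0 : (0 <= lq_norm +oo [set` U] (EFin \o n))%E by exact: lq_norm_ge0.
  apply: lq_norm_fsety_le; first by rewrite mule_ge0// lee_fin.
  move=> v vV; apply: (@le_trans _ _ (\sum_(u <- U) (S v u)%:E *
      lq_norm +oo [set` U] (EFin \o n))%E).
    rewrite -sumEFin big_seq [leRHS]big_seq; apply: lee_sum => u uU.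
    rewrite EFinM; apply: lee_pmul; rewrite ?lee_fin//.
      by have := KSZ v u vV uU; rewrite powRr0 mulr1 powRr1.
    exact: (lq_norm_fsety_ge (EFin \o n) uU).
  rewrite -ge0_sume_distrl; last by move=> u _; rewrite lee_fin.
  by apply: lee_wpmul2r => //; rewrite sumEFin lee_fin Sa.
have r0 : 0 < r by rewrite (lt_le_trans _ r1).
have [e0 e1] : 0 <= r^-1 /\ r^-1 <= 1 by rewrite invr_ge0 ltW// invf_le1.
rewrite expoE in KSZ *; set e := r^-1 in e0 e1 KSZ *.
have er : e * r = 1 by rewrite mulVf// gt_eqF.
have Kn0 v : 0 <= \sum_(u <- U) K v u * n u by apply: sumr_ge0 => u _; rewrite mulr_ge0.
have row v : v \in V -> (\sum_(u <- U) K v u * n u) `^ r <=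
    a `^ (r - 1) * \sum_(u <- U) Z v u * n u `^ r.
  move=> vV.
  have h : \sum_(u <- U) K v u * n u <=
      a `^ (1 - e) * (\sum_(u <- U) Z v u * n u `^ r) `^ e.
    apply: (@le_trans _ _ (\sum_(u <- U) (Z v u * n u `^ r) `^ e * S v u `^ (1 - e))).
      rewrite big_seq [leRHS]big_seq; apply: ler_sum => u uU.
      rewrite powRM ?powR_ge0// -powRrM mulrC [r * e]mulrC er powRr1// mulrC.
      by rewrite mulrAC ler_wpM2r// mulrC KSZ.
    apply: le_trans (hoelder_sum U _ _ _) _.
    - by rewrite e0 e1.
    - by move=> u; rewrite mulr_ge0// powR_ge0.
    - by [].
    rewrite mulrC ler_wpM2r ?powR_ge0//.
    by apply: ge0_ler_powR; rewrite ?nnegrE ?subr_ge0// ?sumr_ge0// Sa.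
  apply: le_trans (ge0_ler_powR (ltW r0) _ _ h) _; rewrite ?nnegrE ?mulr_ge0 ?powR_ge0//.
  rewrite powRM ?powR_ge0// -!powRrM er powRr1; last first.
    by apply: sumr_ge0 => u _; rewrite mulr_ge0// powR_ge0.
  by rewrite mulrBl er mul1r.
rewrite !lq_norm_fsetr//.
rewrite (_ : (\sum_(i <- U) _ = (\sum_(u <- U) n u `^ r)%:E)%E); last first.
  by rewrite -sumEFin; apply: eq_bigr => u _.
rewrite (_ : (\sum_(i <- V) _ = (\sum_(v <- V) (\sum_(u <- U) K v u * n u) `^ r)%:E)%E); last first.
  by rewrite -sumEFin; apply: eq_bigr => u _.
rewrite !poweR_EFin -EFinM lee_fin -/e.
have sn0 : 0 <= \sum_(u <- U) n u `^ r by apply: sumr_ge0 => u _; exact: powR_ge0.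
have tot : \sum_(v <- V) (\sum_(u <- U) K v u * n u) `^ r <=
    a `^ (r - 1) * b * \sum_(u <- U) n u `^ r.
  apply: (@le_trans _ _ (\sum_(v <- V) a `^ (r - 1) * \sum_(u <- U) Z v u * n u `^ r)).
    by rewrite big_seq [leRHS]big_seq; apply: ler_sum => v; exact: row.
  rewrite -mulr_sumr -mulrA ler_wpM2l ?powR_ge0// exchange_big/= mulr_sumr.
  rewrite big_seq [leRHS]big_seq; apply: ler_sum => u uU.
  by rewrite -mulr_suml ler_wpM2r ?powR_ge0// Zb.
apply: le_trans (ge0_ler_powR e0 _ _ tot) _.
- by rewrite nnegrE sumr_ge0// => v _; exact: powR_ge0.
- by rewrite nnegrE !mulr_ge0 ?powR_ge0.
rewrite !powRM ?mulr_ge0 ?powR_ge0// -powRrM mulrBl mul1r [r * e]mulrC er.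
exact: lexx.
Qed.

End discrete.

(** * Norm of the embedding *)

Section upper_bound.
Context {R : realType}.
Variables (s : option nat) (D : interval R) (psi omega : R -> R) (kappa : R -> R -> R).
Variable gamma : {fset nat} -> R.
Hypothesis D0 : 0 \in D.
Hypothesis psi_meas : measurable_fun [set` D] psi.
Hypothesis psi_ge0 : forall t, t \in D -> 0 <= psi t.
Hypothesis psi_gt0 : {ae lebesgue_measure, forall t, t \in D -> 0 < psi t}.
Hypothesis kappa_meas : measurable_fun ([set` D] `*` [set` D])
  (fun z : R * R => kappa z.1 z.2).
Hypothesis omega_meas : measurable_fun [set` D] omega.
Hypothesis omega_ge0 : forall t, t \in D -> 0 <= omega t.
Hypothesis gamma_weights : downward_closed_weights s gamma.
Variables p q : \bar R.
Hypotheses (p1 : (1 <= p)%E) (q1 : (1 <= q)%E).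
Hypothesis kappa_hat_fin : forall x, x \in D -> (kappa_hat D psi kappa p x < +oo)%E.
Hypothesis kappa_bar_fin : forall r : \bar R, (1 <= r)%E ->
  (kappa_bar_norm D psi omega kappa r < +oo)%E.
Local Notation M := (mean_sup D psi omega kappa).
Local Notation B := (mean_int D omega kappa).
Local Notation kan := (kappa_anova D omega kappa).
Implicit Types (u v w : {fset nat}) (x : nat -> R) (U V : {fset {fset nat}}).

Definition active U := forall u, u \in U -> [set` u] `<=` coords s /\ 0 < gamma u.

(** The argument [c] will be M, B, their geometric mean M^(1/p) B^(1-1/p), or the integral of a test
    function against the mean. *)
Definition weight_ratio (c : R) v u : R :=
  if fsubset v u then gamma u / gamma v * c ^+ #|` (u `\` v)%fset| else 0.

Lemma active_down_closure U : active U -> active (down_closure U).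
Proof.
move=> Us v /mem_down_closure[u uU vu]; have [us gu] := Us u uU; split.
  by move=> j /= jv; apply: us; exact: (fsubsetP vu).
exact: gamma_weights.2 us vu gu.
Qed.

Lemma embedding_norm_le (C : R) : 0 <= C ->
  (forall U (n : {fset nat} -> R), active U -> (forall u, 0 <= n u) ->
    (lq_norm q [set` down_closure U] (fun v => (\sum_(u <- U)
       weight_ratio (M `^ expo p * B `^ (1 - expo p)) v u * n u)%:E) <=
     C%:E * lq_norm q [set` U] (EFin \o n))%E) ->
  (embedding_norm s D psi omega kappa gamma p q <= C%:E)%E.
Proof.
move=> C0 HC; apply: ge_ereal_sup => _ [f [_ fn1] <-].
set c := M `^ expo p * B `^ (1 - expo p).
have c0 : 0 <= c by rewrite mulr_ge0// powR_ge0.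
(* The norm of f is an infimum over representations, so one of norm below 1 + e is chosen and e
   tends to 0. Rescaling e by C + 1 rather than C covers C = 0. *)
suff H (e : R) : 0 < e -> (space_norm s D psi gamma kan p q f <= C%:E * (1 + e)%:E)%E.
  apply/lee_addgt0Pr => e e0.
  have C1 : 0 < C + 1 by rewrite ltr_wpDl.
  apply: le_trans (H (e / (C + 1)) (divr_gt0 e0 C1)) _.
  rewrite -EFinM -EFinD lee_fin mulrDr mulr1 lerD2l mulrCA.
  by rewrite ger_pMr// ler_pdivrMr// mul1r lerDl.
move=> e0.
have : (space_norm s D psi gamma kappa p q f < (1 + e)%:E)%E.
  by apply: le_lt_trans fn1 _; rewrite lte_fin ltrDl.
move=> /ereal_inf_lt[_ [U [g [Ug ->]]]] Ne.
have [Us gL fE] := Ug; have Usd := active_down_closure Us.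
have Ugd := represents_anova psi_meas psi_ge0 psi_gt0 kappa_meas omega_meas omega_ge0
  gamma_weights p1 kappa_hat_fin kappa_bar_fin Ug.
apply: (@le_trans _ _ (components_norm D psi gamma p q (down_closure U)
    (anova_family D omega kappa U g))).
  by apply: ereal_inf_lbound; exists (down_closure U), (anova_family D omega kappa U g).
(* The sequence whose l_q norm is the norm of the chosen representation; the factor gamma u hidden
   in it is compensated by the numerator of [weight_ratio]. *)
pose n u : R := if u \in U then fine ((gamma u)^-1%:E * L_norm D psi p (g u))%E else 0.
have gammaV_ge0 V u : active V -> u \in V -> (0 <= (gamma u)^-1%:E)%E.
  by move=> Vs /Vs[_ gu]; rewrite lee_fin invr_ge0 ltW.
have Lfin u : u \in U -> L_norm D psi p (g u) \is a fin_num.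
  by move=> /gL[_ gy]; rewrite ge0_fin_numE// L_norm_ge0.
have nE u : u \in U -> (n u)%:E = ((gamma u)^-1%:E * L_norm D psi p (g u))%E.
  by move=> uU; rewrite /n uU fineK// fin_numM// Lfin.
have n0 u : 0 <= n u.
  rewrite /n; case: ifPn => // uU; rewrite fine_ge0// mule_ge0 ?L_norm_ge0//.
  exact: gammaV_ge0 uU.
apply: (@le_trans _ _ (C%:E * lq_norm q [set` U] (EFin \o n))%E); last first.
  apply: lee_wpmul2l => //; apply: le_trans (ltW Ne).
  by apply: le_lq_norm => // u uU; [rewrite lee_fin|rewrite /= nE].
apply: le_trans (HC U n Us n0); apply: le_lq_norm => // v vU.
  by rewrite mule_ge0 ?L_norm_ge0//; exact: gammaV_ge0 vU.
have vpos : 0 < gamma v by case: (Usd v vU).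
have Lcomp u : u \in [seq u <- U | fsubset v u] ->
    L_space D psi p (component D omega kappa v (g u)).
  by rewrite mem_filter => /andP[vu uU]; apply: L_space_component => //; exact: gL.
apply: (@le_trans _ _ ((gamma v)^-1%:E * \sum_(u <- [seq u <- U | fsubset v u])
    L_norm D psi p (component D omega kappa v (g u)))%E).
  apply: lee_wpmul2l; first exact: gammaV_ge0 vU.
  exact: L_norm_sum.
rewrite big_filter ge0_sume_distrr; last by move=> u _; exact: L_norm_ge0.
rewrite -sumEFin big_seq_cond [leRHS]big_seq [leRHS](bigID (fsubset v))/=.
rewrite [X in (_ + X)%E]big1; last first.
  by move=> u /andP[_ /negPf vu]; rewrite /weight_ratio vu mul0r.
rewrite adde0; apply: lee_sum => u /andP[uU vu].
apply: (@le_trans _ _ ((gamma v)^-1%:E * ((c ^+ #|` (u `\` v)%fset|)%:E *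
    L_norm D psi p (g u)))%E).
  apply: lee_wpmul2l; first exact: gammaV_ge0 vU.
  by apply: L_norm_component => //; exact: gL.
have [_ upos] := Us u uU.
rewrite EFinM nE// /weight_ratio vu -(fineK (Lfin u uU)) -!EFinM lee_fin.
rewrite le_eqVlt; apply/orP; left; apply/eqP; rewrite /c.
by field; rewrite !gt_eqF.
Qed.

End upper_bound.

(** * Lower bounds from tensor products *)

Section lower_bounds.
Context {R : realType}.
Variables (s : option nat) (D : interval R) (psi omega : R -> R) (kappa : R -> R -> R).
Variable gamma : {fset nat} -> R.
Hypothesis D0 : 0 \in D.
Hypothesis psi_meas : measurable_fun [set` D] psi.
Hypothesis psi_ge0 : forall t, t \in D -> 0 <= psi t.
Hypothesis psi_gt0 : {ae lebesgue_measure, forall t, t \in D -> 0 < psi t}.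
Hypothesis kappa_meas : measurable_fun ([set` D] `*` [set` D])
  (fun z : R * R => kappa z.1 z.2).
Hypothesis omega_meas : measurable_fun [set` D] omega.
Hypothesis omega_ge0 : forall t, t \in D -> 0 <= omega t.
Hypothesis kappa0 : forall t, t \in D -> kappa 0 t = 0.
Hypothesis gamma_weights : downward_closed_weights s gamma.
Variable p : \bar R.
Hypothesis p1 : (1 <= p)%E.
Hypothesis kappa_hat_fin : forall x, x \in D -> (kappa_hat D psi kappa p x < +oo)%E.
Hypothesis kappa_bar_fin : forall q : \bar R, (1 <= q)%E ->
  (kappa_bar_norm D psi omega kappa q < +oo)%E.
Hypothesis injK : injective_K s D psi kappa p.
Local Notation T := (measurableTypeR R).
Local Notation mu := (@lebesgue_measure R).
Local Notation mun n := (@lebesgue_tuple R n).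
Local Notation kan := (kappa_anova D omega kappa).
Local Notation mean := (kernel_mean D omega kappa \_ [set` D]).
Implicit Types (u v w : {fset nat}) (x : nat -> R) (U V : {fset {fset nat}}).

Definition tensor (e : R -> R) n (t : n.-tuple T) : R := \prod_(i < n) e (tnth t i).

Lemma L_normZ_le n (k : R) (g : n.-tuple T -> R) : measurable_fun (@cube R D n) g ->
  (L_norm D psi p (fun t => (k * g t)%R) <= `|k|%:E * L_norm D psi p g)%E.
Proof.
move=> mg; rewrite !L_normE.
have mF := measurable_L_norm_integrand psi_meas p mg.
set F := (fun t => _ * _) in mF.
rewrite -[X in (_ <= _ * X)%E]/('N[mun n]_p[EFin \o F])%E.
have -> : (fun t : n.-tuple T => (((fun t => k * g t) \_ (@cube R D n)) t *
    (\prod_(i < n) (psi \_ [set` D]) (tnth t i)) `^ expo p)%:E) =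
    (fun t => (k * F t)%:E).
  apply/funext => t; congr EFin; rewrite /F mulrA; congr (_ * _).
  by rewrite !patchE; case: ifP => //; rewrite mulr0.
case: (ge1_cases p1) => [py|[r r1 pr]].
  rewrite py; apply: Lnormy_le; first by rewrite mule_ge0 ?Lnorm_ge0.
  apply: filterS (ae_le_Lnormy (mun n) (EFin \o F)) => t Ft.
  rewrite abse_EFin normrM EFinM; apply: lee_wpmul2l; last exact: Ft.
  by rewrite lee_fin.
have r0 : 0 < r by rewrite (lt_le_trans _ r1).
rewrite pr !Lnormr_pow//.
rewrite (_ : (\int[mun n]_t _ = (`|k| `^ r)%:E * \int[mun n]_t (`|(F t)%:E| `^ r))%E).
  rewrite poweRM ?lee_fin ?powR_ge0//; last by apply: integral_ge0 => t _; exact: poweR_ge0.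
  by rewrite poweR_EFin -powRrM divff ?gt_eqF// powRr1.
rewrite -(@ge0_integralZl _ _ _ _ setT measurableT (fun t => `|(F t)%:E| `^ r)%E).
- apply: eq_integral => t _; rewrite /= normrM. by rewrite powRM.
- by apply: measurable_abse_poweR; exact/measurable_EFinP.
- by move=> t _; exact: poweR_ge0.
- by rewrite lee_fin powR_ge0.
Qed.

Variables (e : R -> R) (c : R).
Hypothesis me : measurable_fun [set` D] e.
Hypothesis e_mean_ge0 : forall t, 0 <= (e \_ [set` D]) t * mean t.
Hypothesis e_mean_int : (\int[mu]_t ((e \_ [set` D]) t * mean t)%:E = c%:E)%E.
Hypothesis norm_tensor : forall n, L_norm D psi p (@tensor e n) = 1%E.

Lemma tensor_int_ge0 : 0 <= c.
Proof. by rewrite -lee_fin -e_mean_int integral_ge0// => t _; rewrite lee_fin. Qed.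

Lemma measurable_tensor n : measurable_fun (@cube R D n) (@tensor e n).
Proof.
apply/(measurable_restrictT _ _).2; first exact: measurable_cube.
rewrite (_ : _ \_ _ = fun t => \prod_(i < n) (e \_ [set` D]) (tnth t i)).
  by apply: (@measurable_prod_tnth _ _ (fun=> e \_ [set` D])) => i; exact: measurable_patch.
by apply/funext => t; rewrite (prod_patchE _ (fun=> e)).
Qed.

Lemma patch_tensor u (t : #|` u|.-tuple T) :
  (@tensor e _ \_ (@cube R D _)) t = \prod_(j <- u) (e \_ [set` D]) (coord t j).
Proof.
by rewrite prod_coord_const (prod_patchE _ (fun=> e)).
Qed.

(** Each variable of u \ v that is integrated out contributes one factor, the integral c of e
    against the mean. *)
Lemma component_tensor u v (k : R) (a : #|` v|.-tuple T) : fsubset v u -> @cube R D _ a ->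
  component D omega kappa v (fun t : #|` u|.-tuple T => k * tensor e t) a =
  k * c ^+ #|` (u `\` v)%fset| * tensor e a.
Proof.
move=> vu aD; have uvw := perm_fsetD vu; set w := (u `\` v)%fset in uvw *.
rewrite /component /marginal.
pose H (b : #|` w|.-tuple T) := \prod_(i < #|` w|)
  ((e \_ [set` D]) (tnth b i) * mean (tnth b i)).
have mem : measurable_fun setT (fun t => (e \_ [set` D]) t * mean t).
  by apply: measurable_funM; [exact: measurable_patch|exact: measurable_kernel_meanT].
have H0 b : 0 <= H b by apply: prodr_ge0.
have mH : measurable_fun setT H.
  exact: (@measurable_prod_tnth _ _ (fun _ t => (e \_ [set` D]) t * mean t)).
have IH : (\int[mun #|` w|]_b (H b)%:E = (c ^+ #|` w|)%:E)%E.
  rewrite (@ge0_integral_prod _ _ (fun _ t => (e \_ [set` D]) t * mean t))//.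
  by rewrite e_mean_int prodEFin prodr_const card_ord.
transitivity (\int[mun #|` w|]_b ((k * tensor e a) * H b)); last first.
  rewrite RintegralZl//; last first.
    apply: integral_norm_lty => //.
    by under eq_integral do rewrite ger0_norm//; rewrite IH ltry.
  by rewrite /Rintegral IH/= mulrAC.
apply: eq_Rintegral => b _; rewrite -/w.
have -> : ((fun t : #|` u|.-tuple T => k * tensor e t) \_ (@cube R D _)) (merge u (a, b)) =
    k * (@tensor e _ \_ (@cube R D _)) (@merge _ u v w (a, b)).
  by rewrite !patchE; case: ifP => //; rewrite mulr0.
rewrite patch_tensor (prod_merge _ (fun=> e \_ [set` D]) uvw)/=.
rewrite prod_coord_const (prod_patch (fun=> e))// -/(tensor e a).
rewrite -!mulrA; congr (_ * (_ * _)).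
by rewrite /prod_mean !prod_coord_const -big_split.
Qed.

Definition test_family : forall u, #|` u|.-tuple T -> R := fun u t => gamma u * tensor e t.

Definition test_fun U (x : nat -> R) : R :=
  \sum_(u <- U) Kop D kappa (@test_family u) (restr x u).

Lemma L_norm_test_le u : 0 <= gamma u -> (L_norm D psi p (@test_family u) <= (gamma u)%:E)%E.
Proof.
move=> gu; have := L_normZ_le (gamma u) (@measurable_tensor #|` u|).
by rewrite norm_tensor mule1 ger0_norm.
Qed.

Lemma represents_test U : active s gamma U ->
  represents s D psi gamma kappa p (test_fun U) U test_family.
Proof.
move=> Us; split => // u uU; have [_ gu] := Us u uU; split.
  by apply: measurable_funM => //; exact: measurable_tensor.
by apply: le_lt_trans (L_norm_test_le (ltW gu)) _; rewrite ltry.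
Qed.

Lemma L_norm_anova_test U v : active s gamma U -> v \in down_closure U ->
  ((\sum_(u <- U) weight_ratio gamma c v u)%:E <=
   (gamma v)^-1%:E * L_norm D psi p (@anova_family _ D omega kappa U test_family v))%E.
Proof.
move=> Us vU; have [_ gv] := active_down_closure gamma_weights Us vU.
pose al := \sum_(u <- [seq u <- U | fsubset v u]) gamma u * c ^+ #|` (u `\` v)%fset|.
have c0 := tensor_int_ge0.
have -> : \sum_(u <- U) weight_ratio gamma c v u = (gamma v)^-1 * al.
  rewrite /al big_filter mulr_sumr [LHS](bigID (fsubset v))/= [X in _ + X]big1; last first.
    by move=> u /negPf vu; rewrite /weight_ratio vu.
  rewrite addr0; apply: eq_bigr => u vu; rewrite /weight_ratio vu.
  by rewrite -mulrA mulrCA mulrA.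
have al0 : 0 <= al.
  rewrite /al big_seq; apply: sumr_ge0 => u; rewrite mem_filter => /andP[_ /Us[_ gu]].
  by rewrite mulr_ge0 ?exprn_ge0// ltW.
rewrite EFinM; apply: lee_wpmul2l; first by rewrite lee_fin invr_ge0 ltW.
have hE (t : #|` v|.-tuple T) : @cube R D _ t ->
    @anova_family _ D omega kappa U test_family v t = al * tensor e t.
  move=> tD; rewrite /anova_family /al mulr_suml big_seq [RHS]big_seq.
  apply: eq_bigr => u; rewrite mem_filter => /andP[vu _].
  by rewrite component_tensor.
have [al_0|al_0] := eqVneq al 0; first by rewrite al_0 L_norm_ge0.
have alp : 0 < al by rewrite lt_def al_0.
have mh : measurable_fun (@cube R D _) (@anova_family _ D omega kappa U test_family v).
  have [_ + _] := represents_anova psi_meas psi_ge0 psi_gt0 kappa_meas omega_meas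
    omega_ge0 gamma_weights p1 kappa_hat_fin kappa_bar_fin (represents_test Us).
  by move=> /(_ v vU)[].
(* The component is al times a tensor of norm 1. The upper bound on the norm of a multiple, used
   with the factor 1/al, yields the lower bound al for the norm of the component. *)
have := L_normZ_le al^-1 mh.
rewrite (_ : L_norm D psi p _ = 1%E); last first.
  rewrite -(norm_tensor #|` v|); apply: eq_Lnorm => t; rewrite !patchE.
  case: ifPn => //; rewrite inE => tD; rewrite hE// mulrA mulVf// mul1r//.
rewrite ger0_norm ?invr_ge0// => h.
rewrite -[leLHS]mule1; apply: le_trans (lee_wpmul2l _ h) _; first by rewrite lee_fin.
by rewrite muleA -EFinM divff// mul1e.
Qed.

(** The norm in the target space is an infimum, so X has to bound every representation of the test
    function from below. By uniqueness each representation carries the same component norms, a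
    component absent from V' counting as 0. *)
Let space_norm_ge q U (X : \bar R) : active s gamma U -> (1 <= q)%E ->
  (lq_norm q [set` U] (fun u => ((gamma u)^-1%:E * L_norm D psi p (@test_family u))%E) <= 1)%E ->
  (forall V' h', (forall v, v \in V' -> 0 < gamma v) ->
    (forall v, v \in down_closure U ->
      ((\sum_(u <- U) weight_ratio gamma c v u)%:E <=
       if v \in V' then (gamma v)^-1%:E * L_norm D psi p (h' v) else 0)%E) ->
    (X <= components_norm D psi gamma p q V' h')%E) ->
  (X <= embedding_norm s D psi omega kappa gamma p q)%E.
Proof.
move=> Us q1 tU HX; have rt := represents_test Us.
apply: (@le_trans _ _ (space_norm s D psi gamma kan p q (test_fun U))); last first.
  apply: ereal_sup_ubound; exists (test_fun U) => //; split; first by exists U, test_family.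
  apply: le_trans tU; apply: ereal_inf_lbound.
  by exists U, test_family; split.
apply: le_ereal_inf_tmp => _ [V' [h' [rh' ->]]]; apply: HX.
  by case: rh' => + _ _ => Vs v /Vs[].
have ra := represents_anova psi_meas psi_ge0 psi_gt0 kappa_meas omega_meas
  omega_ge0 gamma_weights p1 kappa_hat_fin kappa_bar_fin rt.
move=> v vU; apply: le_trans (L_norm_anova_test Us vU) _.
rewrite (represents_unique D0 psi_meas psi_ge0 psi_gt0 kappa_meas omega_meas
  omega_ge0 kappa0 p1 kappa_hat_fin kappa_bar_fin injK ra rh' vU).
by case: ifP => // _; rewrite mule0.
Qed.

Let term_le1 u : 0 < gamma u ->
  ((gamma u)^-1%:E * L_norm D psi p (@test_family u) <= 1)%E.
Proof.
move=> gu; apply: (@le_trans _ _ ((gamma u)^-1%:E * (gamma u)%:E)%E).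
  by apply: lee_wpmul2l; [rewrite lee_fin invr_ge0 ltW|exact/L_norm_test_le/ltW].
by rewrite -EFinM mulVf// gt_eqF.
Qed.

(** In l_oo the components gamma_u times tensor, for all u in U, are admissible simultaneously.
    Since e times the mean is nonnegative, their contributions to component v add up without
    cancellation and give the whole row. *)
Lemma embedding_norm_row U v : active s gamma U -> v \in down_closure U ->
  ((\sum_(u <- U) weight_ratio gamma c v u)%:E <=
    embedding_norm s D psi omega kappa gamma p +oo)%E.
Proof.
move=> Us vU; apply: (space_norm_ge Us) => //; first exact: leey.
  by apply: lq_norm_fsety_le => // u /Us[_]; exact: term_le1.
move=> V' h' V'g /(_ v vU) /le_trans; apply; case: ifPn => [vV'|_]; last exact: lq_norm_ge0.
exact: (lq_norm_fsety_ge (fun v => (gamma v)^-1%:E * L_norm D psi p (h' v))%E vV').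
Qed.

(** In l_1 a single component of weighted norm at most 1 is used; the l_1 norm of everything it
    produces on the subsets of u is the column. *)
Lemma embedding_norm_col u : [set` u] `<=` coords s -> 0 < gamma u ->
  ((\sum_(v <- fpowerset u) weight_ratio gamma c v u)%:E <=
    embedding_norm s D psi omega kappa gamma p 1)%E.
Proof.
move=> us gu; have Us : active s gamma [fset u]%fset.
  by move=> w; rewrite inE => /eqP ->.
have dcE : down_closure [fset u]%fset =i fpowerset u.
  move=> v; rewrite fpowersetE; apply/mem_down_closure/idP => [[w]|vu].
    by rewrite inE => /eqP ->.
  by exists u => //; rewrite inE.
apply: (space_norm_ge Us) => //.
  have a0 : (0 <= (gamma u)^-1%:E * L_norm D psi p (@test_family u))%E.
    by rewrite mule_ge0 ?L_norm_ge0// lee_fin invr_ge0 ltW.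
  by rewrite lq_norm_fsetr big_seq_fset1 invr1 (poweRe1 a0) (poweRe1 a0) term_le1.
move=> V' h' V'g HV'.
rewrite /components_norm lq_norm_fsetr invr1 poweRe1; last first.
  by apply: sume_ge0 => v _; exact: poweR_ge0.
pose F v := ((gamma v)^-1%:E * L_norm D psi p (h' v))%E.
have F0 v : v \in V' -> (0 <= F v)%E.
  by move=> vV; rewrite mule_ge0 ?L_norm_ge0// lee_fin invr_ge0 ltW// V'g.
rewrite (_ : (\sum_(i <- V') _ = \sum_(v <- V') F v)%E); last first.
  by rewrite big_seq [RHS]big_seq; apply: eq_bigr => v vV; rewrite poweRe1// F0.
apply: (@le_trans _ _ (\sum_(v <- fpowerset u) if v \in V' then F v else 0)%E).
  rewrite -sumEFin big_seq [leRHS]big_seq; apply: lee_sum => v.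
  by rewrite -dcE => /HV'; rewrite big_seq_fset1.
rewrite -big_mkcond big_fset_condE [leRHS](big_fsetID _ (fun v => v \in fpowerset u))/=.
rewrite -[leLHS]adde0; apply: leeD; last first.
  by rewrite big_seq; apply: sume_ge0 => v; rewrite !inE => /andP[/F0].
rewrite le_eqVlt; apply/orP; left; apply/eqP; apply: eq_fbigl => v.
by rewrite !inE andbC.
Qed.

End lower_bounds.

Section limits.
Context {R : realType}.

(** The test functions only come within eps of M. The finite sums to be bounded are polynomials in
    c, so continuity gives the bound at M itself; when c exceeds M, monotonicity is enough. *)
Lemma horner_le_limit (P : {poly R}) (M : R) (E : \bar R) :
  (forall x y, 0 <= x -> x <= y -> P.[x] <= P.[y]) -> 0 <= M ->
  (forall eps, 0 < eps -> exists c, [/\ 0 <= c, M - eps <= c & (P.[c]%:E <= E)%E]) ->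
  (P.[M]%:E <= E)%E.
Proof.
move=> Pmono M0 HE; case: E HE => [E HE| |HE]; last 2 first.
- by rewrite leey.
- by have [c [_ _]] := HE 1 ltr01; rewrite leNgt ltNyr.
rewrite lee_fin leNgt; apply/negP => EP.
have : nbhs M [set t | E < P.[t]] by exact: (cvgr_gt _ (@continuous_horner R P M) E EP).
rewrite -nbhs_ballE => -[d /= d0 Pd].
have [c [c0 Mc]] := HE (d / 2) (divr_gt0 d0 (ltr0Sn _ _)).
rewrite lee_fin leNgt => /negP; apply.
have [cM|Mc'] := ltP c M; last by apply: lt_le_trans EP _; exact: Pmono.
apply: Pd; rewrite /ball/= ger0_norm ?subr_ge0 ?ltW//.
rewrite ltrBlDr -ltrBlDl; apply: lt_le_trans Mc.
by rewrite ltrD2l ltrN2 ltr_pdivrMr// ltr_pMr// ltr1n.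
Qed.

Lemma measure_gt0_bigcup d (T : measurableType d) (mu : {measure set T -> \bar R})
    (F : nat -> set T) : (forall n, measurable (F n)) ->
  (0 < mu (\bigcup_n F n))%E -> exists n, (0 < mu (F n))%E.
Proof.
move=> mF; apply: contraPP => /forallNP F0; apply/negP; rewrite -leNgt.
have [N [mN N0 FN]] : mu.-negligible (\bigcup_n F n).
  apply: negligible_bigcup => n; exists (F n); split => //.
  by apply/eqP; rewrite eq_le measure_ge0 andbT leNgt; exact/negP/F0.
rewrite -N0; apply: le_measure => //; rewrite inE//; exact: bigcup_measurable.
Qed.

End limits.

(** * Test functions for p = 1 and p = +oo *)

Section test_functions.
Context {R : realType}.
Variables (D : interval R) (psi omega : R -> R) (kappa : R -> R -> R).
Hypothesis psi_meas : measurable_fun [set` D] psi.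
Hypothesis psi_ge0 : forall t, t \in D -> 0 <= psi t.
Hypothesis psi_gt0 : {ae lebesgue_measure, forall t, t \in D -> 0 < psi t}.
Hypothesis kappa_meas : measurable_fun ([set` D] `*` [set` D])
  (fun z : R * R => kappa z.1 z.2).
Hypothesis omega_meas : measurable_fun [set` D] omega.
Hypothesis omega_ge0 : forall t, t \in D -> 0 <= omega t.
Hypothesis omega_int : (\int[lebesgue_measure]_(t in [set` D]) (omega t)%:E = 1)%E.
Hypothesis kappa_bar_fin : forall q : \bar R, (1 <= q)%E ->
  (kappa_bar_norm D psi omega kappa q < +oo)%E.
Local Notation T := (measurableTypeR R).
Local Notation mu := (@lebesgue_measure R).
Local Notation mun n := (@lebesgue_tuple R n).
Local Notation mean := (kernel_mean D omega kappa \_ [set` D]).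
Local Notation psiD := (psi \_ [set` D]).
Local Notation M := (mean_sup D psi omega kappa).
Local Notation B := (mean_int D omega kappa).

Let mmean : measurable_fun setT mean.
Proof. exact: measurable_kernel_meanT. Qed.

Let mpsi : measurable_fun setT psiD.
Proof. exact: measurable_patch. Qed.

(** A null set cannot carry the density omega. Consequently no cube D^n is null, and functions of
    modulus 1 have norm 1 in the spaces with p = +oo. *)
Lemma domain_gt0 : (0 < mu [set` D])%E.
Proof.
rewrite lt0e measure_ge0 andbT; apply/eqP => D0.
have mo : measurable_fun [set` D] (EFin \o omega) by exact/measurable_EFinP.
by move: omega_int; rewrite (@null_set_integral _ _ _ mu _ _ (measurable_itv D) mo D0) => /eqP; rewrite eq_sym onee_eq0.
Qed.

(** The value at the zeros of the mean is 1 instead of 0, so that the modulus is 1 everywhere. *)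
Definition mean_sign (t : R) : R := 1 - 2 * \1_(mean @^-1` `]-oo, 0[) t.

Lemma measurable_mean_sign : measurable_fun setT mean_sign.
Proof.
apply: measurable_funB => //; apply: measurable_funM => //.
apply: measurable_indic; rewrite -[X in measurable X]setTI.
by apply: mmean => //; exact: measurable_itv.
Qed.

Lemma norm_mean_sign t : `|mean_sign t| = 1.
Proof.
rewrite /mean_sign indicE; case: (_ \in _); last by rewrite mulr0 subr0 normr1.
by rewrite mulr1 (_ : 1 - 2 = -1 :> R) ?normrN1//; lra.
Qed.

Lemma mean_signM t : mean_sign t * mean t = `|mean t|.
Proof.
rewrite /mean_sign indicE.
case: (boolP (t \in mean @^-1` `]-oo, 0[)) => [|/negP]; rewrite inE /= in_itv/=.
  by move=> m0; rewrite ltr0_norm// mulr1 (_ : 1 - 2 = -1 :> R) ?mulN1r//; lra.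
by move=> /negP; rewrite -leNgt => m0; rewrite mulr0 subr0 mul1r ger0_norm.
Qed.

Lemma L_norm1_tensor (e : R -> R) n : measurable_fun [set` D] e ->
  (\int[mu]_t (`|(e \_ [set` D]) t| * psiD t)%:E = 1)%E ->
  L_norm D psi 1 (@tensor _ e n) = 1%E.
Proof.
move=> me e1; rewrite L_normE Lnorm1.
transitivity (\int[mun n]_t (\prod_(i < n) (`|(e \_ [set` D]) (tnth t i)| *
    psiD (tnth t i)))%:E)%E.
  apply: eq_integral => t _.
  rewrite expoE invr1 powRr1; last by apply: prodr_ge0 => i _; exact: patch_psi_ge0.
  rewrite abse_EFin normrM big_split/= normr_prod; congr (_ * _)%:E; last first.
    by apply: eq_bigr => i _; rewrite ger0_norm// patch_psi_ge0.
  by rewrite -normr_prod (prod_patchE _ (fun=> e)).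
rewrite (@ge0_integral_prod _ _ (fun _ t => `|(e \_ [set` D]) t| * psiD t)).
- by rewrite e1 big1.
- move=> _; apply: measurable_funM => //.
  by apply: measurableT_comp => //; exact: measurable_patch.
- by move=> _ t; rewrite mulr_ge0// patch_psi_ge0.
Qed.

Lemma cube_gt0 n : (0 < mun n (@cube R D n))%E.
Proof.
have := @integral_cube_prod R D n (fun=> cst 1) (fun=> measurable_cst _) (fun _ _ => ler01).
under eq_integral do rewrite big1//.
rewrite integral_cst ?mul1e; last exact: measurable_cube.
move=> ->; elim/big_ind : _ => //; first by move=> x y; exact: mule_gt0.
by move=> i _; rewrite (eq_integral (cst 1%E))// integral_cst// mul1e; exact: domain_gt0.
Qed.

Lemma L_normy_tensor (e : R -> R) n : (forall t, `|e t| = 1) ->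
  L_norm D psi +oo (@tensor _ e n) = 1%E.
Proof.
move=> e1; rewrite L_normE; set F := (fun t => _).
have FE t : `|F t|%E = (\1_(@cube R D n) t)%:E.
  rewrite /F expoy powRr0 mulr1 abse_EFin patchE indicE; case: ifP => _.
    by rewrite /tensor normr_prod big1.
  by rewrite normr0.
apply/eqP; rewrite eq_le; apply/andP; split.
  apply: Lnormy_le => //; apply: aeW => t; rewrite FE lee_fin indicE.
  by case: (_ \in _).
rewrite leNgt; apply/negP => F1.
have [N [mN N0 FN]] := ae_le_Lnormy (mun n) F.
have := cube_gt0 n; rewrite ltNge => /negP; apply.
rewrite -N0; apply: le_measure; rewrite ?inE//; first exact: measurable_cube.
by move=> t tD; apply: FN => Ft; have := le_lt_trans Ft F1; rewrite FE indicE mem_set// ltxx.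
Qed.

Lemma test_function_y :
  [/\ measurable_fun [set` D] mean_sign,
    (forall t, 0 <= (mean_sign \_ [set` D]) t * mean t),
    (\int[mu]_t ((mean_sign \_ [set` D]) t * mean t)%:E = B%:E)%E &
    forall n, L_norm D psi +oo (@tensor _ mean_sign n) = 1%E].
Proof.
have E t : (mean_sign \_ [set` D]) t * mean t = `|mean t|.
  rewrite -mean_signM !patchE; case: ifP => //; by rewrite !mulr0.
split.
- by apply: measurable_funTS; exact: measurable_mean_sign.
- by move=> t; rewrite E.
- under eq_integral do rewrite E.
  by rewrite (mean_intE psi_meas kappa_meas omega_meas omega_ge0 (kappa_bar_fin (leey _))).
- by move=> n; apply: L_normy_tensor; exact: norm_mean_sign.
Qed.

(** The set where |m|/psi exceeds M - eps, with the denominator cleared; the condition on psi,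
    extended by 0, also confines it to D. *)
Definition near_sup eps : set T :=
  [set t | 0 < psiD t /\ (M - eps) * psiD t < `|mean t|].

Lemma measurable_near_sup eps : measurable (near_sup eps).
Proof.
set S := near_sup eps.
rewrite (_ : S = (psiD @^-1` `]0, +oo[) `&`
    ((fun t => `|mean t| - (M - eps) * psiD t) @^-1` `]0, +oo[)).
  apply: measurableI.
    by rewrite -[X in measurable X]setTI; apply: mpsi => //; exact: measurable_itv.
  rewrite -[X in measurable X]setTI.
  have mF : measurable_fun setT (fun t => `|mean t| - (M - eps) * psiD t).
    apply: measurable_funB; first exact: measurableT_comp.
    exact: measurable_funM.
  by apply: mF => //; exact: measurable_itv.
by apply/seteqP; split => t /=; rewrite !in_itv/= !andbT subr_gt0.
Qed.

Lemma near_sup_gt0 eps : 0 < eps -> (0 < mu (near_sup eps))%E.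
Proof.
move=> eps0; set S := near_sup eps.
rewrite lt0e measure_ge0 andbT; apply/eqP => S0.
have mS : measurable S by exact: measurable_near_sup.
have aeS : {ae mu, forall t, ~ S t}.
  by exists S; split => // t /=; apply: contrapT.
have aeM : {ae mu, forall t, t \in D -> 0 < psi t /\ `|mean t| <= (M - eps) * psi t}.
  apply: (@filterS2 _ _ (ae_filter_ringOfSetsType mu) _ _ _ _ psi_gt0 aeS) => t psit St tD.
  split; first exact: psit.
  have pE : psiD t = psi t by rewrite patchE mem_set.
  by rewrite leNgt; apply/negP => h; apply: St; rewrite /S /near_sup /= pE; split => //; exact: psit.
(* If the set were null, M - eps would be an essential bound of |m|/psi. A negative bound is
   possible only if D is null; a nonnegative one contradicts the definition of M. *)
have [Me|Me] := ltP (M - eps) 0.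
  have aeD : {ae mu, forall t, ~ t \in D}.
    apply: (@filterS _ _ (ae_filter_ringOfSetsType mu) _ _ _ aeM) => t h tD; have [pt] := h tD.
    by rewrite leNgt => /negP; apply; rewrite (lt_le_trans _ (normr_ge0 _))// nmulr_rlt0.
  have [N [mN N0 DN]] := aeD.
  have := domain_gt0; rewrite ltNge => /negP; apply.
  rewrite -[leRHS]N0; apply: le_measure; rewrite ?inE//.
  by move=> t tD; apply: DN => /= h; apply: h.
suff : (M%:E <= (M - eps)%:E)%E by rewrite lee_fin leNgt ltrBlDr ltrDl eps0.
rewrite {1}(mean_supE psi_meas psi_ge0 kappa_meas omega_meas omega_ge0 (kappa_bar_fin (lexx _))).
apply: Lnormy_le; first by rewrite lee_fin.
apply: (@filterS _ _ (ae_filter_ringOfSetsType mu) _ _ _ aeM) => t h; rewrite patchE; case: ifPn; last by rewrite abse0 lee_fin.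
rewrite inE => tD; have [pt] := h tD; rewrite patchE mem_set// => mt.
by rewrite abse_EFin lee_fin normrM normfV (gtr0_norm pt) ler_pdivrMr.
Qed.

(* The sign of the mean on a small piece of near_sup eps, normalised in
   L_{1,psi}. *)
Lemma test_function_1 (eps : R) : 0 < eps -> exists (e : R -> R) (c : R),
  [/\ measurable_fun [set` D] e,
    (forall t, 0 <= (e \_ [set` D]) t * mean t),
    (\int[mu]_t ((e \_ [set` D]) t * mean t)%:E = c%:E)%E,
    (forall n, L_norm D psi 1 (@tensor _ e n) = 1%E) & M - eps <= c].
Proof.
move=> eps0; have mS := measurable_near_sup eps.
(* Bounding both t and psi makes the integral of psi over the piece finite, hence available for
   normalisation. The pieces exhaust [near_sup eps], so one of them has positive measure. *)
pose Sn (n : nat) : set T :=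
  near_sup eps `&` (`[- n%:R, n%:R] `&` (psiD @^-1` `]-oo, n%:R])).
have mSn n : measurable (Sn n).
  apply: measurableI => //; apply: measurableI; first exact: measurable_itv.
  by rewrite -[X in measurable X]setTI; apply: mpsi => //; exact: measurable_itv.
have mSn1 n : measurable_fun setT (\1_(Sn n) : T -> R).
  by apply: measurable_indic; apply: mSn.
have [n Sn0] : exists n, (0 < mu (Sn n))%E.
  apply: measure_gt0_bigcup => //; apply: lt_le_trans (near_sup_gt0 eps0) _.
  apply: le_measure; rewrite ?inE//; first exact: bigcup_measurable.
  move=> t St; pose m := maxn (Num.truncn `|t|).+1 (Num.truncn (psiD t)).+1.
  have tm : `|t| <= m%:R.
    by rewrite ltW// (lt_le_trans (truncnS_gt _))// ler_nat leq_maxl.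
  have pm : psiD t <= m%:R.
    by rewrite ltW// (lt_le_trans (truncnS_gt _))// ler_nat leq_maxr.
  by exists m => //; split => //; split => /=; rewrite in_itv/= -?ler_norml.
have mI1 : measurable_fun setT (fun t => \1_(Sn n) t * psiD t).
  by apply: measurable_funM => //; exact: mSn1.
have I0 t : 0 <= \1_(Sn n) t * psiD t by rewrite mulr_ge0// patch_psi_ge0.
have Ify : (\int[mu]_t (\1_(Sn n) t * psiD t)%:E < +oo)%E.
  apply: (@le_lt_trans _ _ (\int[mu]_t (n%:R%:E * (\1_(`[- n%:R, n%:R]%classic : set R) t)%:E))%E).
    apply: ge0_le_integral; first exact: measurableT.
    - by move=> t _; rewrite lee_fin.
    - exact/measurable_EFinP.
    - by apply: measurable_funeM; apply/measurable_EFinP; exact: measurable_indic.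
    move=> t _; rewrite -EFinM lee_fin !indicE; case: (boolP (t \in Sn n)) => [|_].
      rewrite inE => -[_ [tn /=]]; rewrite in_itv/= => pn.
      by rewrite mem_set// mul1r mulr1.
    by rewrite mul0r mulr_ge0.
  rewrite ge0_integralZl//; last exact/measurable_EFinP.
  have itvy : (lebesgue_measure ([set` `[- n%:R, n%:R]%R] : set R) < +oo)%E.
    by rewrite lebesgue_measure_itv/=; case: ifP => _; rewrite ?ltry.
  by rewrite integral_indic// setIT; apply: lte_mul_pinfty.
set I := fine (\int[mu]_t (\1_(Sn n) t * psiD t)%:E)%E.
have IE : (\int[mu]_t (\1_(Sn n) t * psiD t)%:E = I%:E)%E.
  by rewrite fineK// ge0_fin_numE// integral_ge0// => t _; rewrite lee_fin.
have Ip : 0 < I.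
  rewrite lt_def fine_ge0 ?andbT; last by apply: integral_ge0 => t _; rewrite lee_fin.
  apply/eqP => I_0; move: IE; rewrite I_0 => IE.
  have IE' : (\int[mu]_t `|(\1_(Sn n) t * psiD t)%:E| = 0)%E.
    by under eq_integral do rewrite gee0_abs ?lee_fin//.
  have mI2 : measurable_fun setT (EFin \o (fun t => \1_(Sn n) t * psiD t)).
    exact/measurable_EFinP.
  have [N [mN N0 SN]] := (ae_eq_integral_abs mu measurableT mI2).1 IE'.
  move: Sn0; rewrite ltNge => /negP; apply; rewrite -[leRHS]N0.
  apply: le_measure; rewrite ?inE// => t St; apply: SN => /= /(_ Logic.I) [].
  rewrite indicE mem_set// mul1r => p0.
  by case: St => -[]; rewrite p0 ltxx.
pose e t := mean_sign t * \1_(Sn n) t / I.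
have SnD t : t \in Sn n -> t \in D.
  rewrite inE => -[[+ _] _]; rewrite patchE; case: ifPn; last by rewrite ltxx.
  by rewrite inE.
have eE : e \_ [set` D] = e.
  apply/funext => t; rewrite patchE; case: ifPn => // /negP tD.
  rewrite /e indicE; case: (boolP (t \in Sn n)) => [/SnD h|]; last by rewrite mulr0 mul0r.
  by exfalso; apply: tD; rewrite inE.
have meT : measurable_fun setT e.
  apply: measurable_funM => //; apply: measurable_funM; first exact: measurable_mean_sign.
  exact: mSn1.
have emE t : (e \_ [set` D]) t * mean t = \1_(Sn n) t * `|mean t| / I.
  by rewrite eE /e -mean_signM; ring.
have em0 t : 0 <= \1_(Sn n) t * `|mean t| / I by rewrite divr_ge0 ?mulr_ge0// ltW.
have mem : measurable_fun setT (fun t => \1_(Sn n) t * `|mean t| / I).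
  apply: measurable_funM => //; apply: measurable_funM; first exact: mSn1.
  exact: measurableT_comp.
have emy : (\int[mu]_t (\1_(Sn n) t * `|mean t| / I)%:E < +oo)%E.
  apply: (@le_lt_trans _ _ (\int[mu]_t (I^-1 * `|mean t|)%:E)%E).
    apply: ge0_le_integral; first exact: measurableT.
    - by move=> t _; rewrite lee_fin.
    - exact/measurable_EFinP.
    - by apply/measurable_EFinP; apply: measurable_funM => //; exact: measurableT_comp.
    move=> t _; rewrite lee_fin mulrC ler_wpM2l ?invr_ge0 ?(ltW Ip)// indicE.
    by case: (_ \in _); rewrite ?mul1r// mul0r.
  rewrite ge0_integralMl ?invr_ge0 ?(ltW Ip)//; last exact: measurableT_comp.
  rewrite -(mean_intE psi_meas kappa_meas omega_meas omega_ge0 (kappa_bar_fin (leey _))).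
  by rewrite -EFinM ltry.
exists e, (fine (\int[mu]_t (\1_(Sn n) t * `|mean t| / I)%:E)%E).
have cE : (fine (\int[mu]_t (\1_(Sn n) t * `|mean t| / I)%:E))%:E =
    (\int[mu]_t (\1_(Sn n) t * `|mean t| / I)%:E)%E.
  by rewrite fineK// ge0_fin_numE// integral_ge0// => t _; rewrite lee_fin.
split.
- exact: measurable_funTS.
- by move=> t; rewrite emE.
- by under eq_integral do rewrite emE; rewrite cE.
- move=> k; apply: L_norm1_tensor; first exact: measurable_funTS.
  rewrite (_ : (fun t => _) = (fun t => (I^-1 * (\1_(Sn n) t * psiD t))%:E)); last first.
    apply/funext => t; rewrite eE /e !normrM norm_mean_sign mul1r normfV (gtr0_norm Ip).
    by rewrite ger0_norm//; congr EFin; ring.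
  by rewrite ge0_integralMl ?invr_ge0 ?(ltW Ip)// IE -EFinM mulVf// gt_eqF.
have [Me|Me] := leP (M - eps) 0.
  by apply: le_trans Me _; rewrite fine_ge0// integral_ge0// => t _; rewrite lee_fin.
rewrite -lee_fin cE.
have -> : ((M - eps)%:E = \int[mu]_t (((M - eps) / I) * (\1_(Sn n) t * psiD t))%:E)%E.
  rewrite ge0_integralMl ?divr_ge0 ?(ltW Ip) ?(ltW Me)// IE -EFinM.
  by rewrite divfK// gt_eqF.
apply: ge0_le_integral; first exact: measurableT.
- by move=> t _; rewrite lee_fin mulr_ge0// divr_ge0 ?(ltW Ip) ?(ltW Me).
- by apply/measurable_EFinP; exact: measurable_funM.
- exact/measurable_EFinP.
move=> t _; rewrite lee_fin mulrAC ler_wpM2r ?invr_ge0 ?(ltW Ip)// indicE.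
case: (boolP (t \in Sn n)) => [|_]; last by rewrite !mul0r mulr0.
by rewrite inE => -[[_ h] _]; rewrite !mul1r ltW.
Qed.

End test_functions.

(** * Interpolation *)

Section interpolation.
Context {R : realType}.

(** The case x = 0 is included: for nonnegative exponents with sum 0, both are 0, and all three
    powers equal 1. *)
Lemma powR_addn (x r t : R) : 0 <= r -> 0 <= t -> x `^ (r + t) = x `^ r * x `^ t.
Proof.
move=> r0 t0; have [rt|rt] := eqVneq (r + t) 0.
  move: rt => /eqP; rewrite paddr_eq0// => /andP[/eqP -> /eqP ->].
  by rewrite addr0 powRr0 mulr1.
by rewrite powRD// (negPf rt).
Qed.

Variables (I : choiceType) (U V : {fset I}) (q : \bar R) (P Q : I -> I -> R).
Variables (theta A1 A2 A3 : R) (n : I -> R).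
Hypothesis q1 : (1 <= q)%E.
Hypothesis P0 : forall v u, 0 <= P v u.
Hypothesis Q0 : forall v u, 0 <= Q v u.
Hypotheses (theta0 : 0 <= theta) (theta1 : theta <= 1).
Hypotheses (A1_ge0 : 0 <= A1) (A2_ge0 : 0 <= A2) (A3_ge0 : 0 <= A3).
Hypothesis n0 : forall u, 0 <= n u.
Let e := expo q.
Let K v u := P v u `^ theta * Q v u `^ (1 - theta).
Let e0 : 0 <= e. Proof. exact: expo_ge0. Qed.
Let e1 : e <= 1. Proof. exact: expo_le1. Qed.
Let K0 v u : 0 <= K v u. Proof. by rewrite mulr_ge0// powR_ge0. Qed.

Let frac (a b : R) : 0 <= a -> a <= b -> 0 < b -> 0 <= a / b <= 1.
Proof. by move=> a0 ab b0; rewrite divr_ge0 ?(ltW b0)//= ler_pdivrMr// mul1r. Qed.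

(** Schur's test with Z = P and S = P^al Q^(1-al), where al = (theta - e)/(1 - e) is the solution of
    S^(1-e) P^e = P^theta Q^(1-theta). Hoelder's inequality bounds the rows of S by those of P and
    Q, which brings in A1 and A3; the columns of P bring in A2. *)
Lemma interpolate_le : e <= theta ->
  (forall v, v \in V -> \sum_(u <- U) P v u <= A1) ->
  (forall u, u \in U -> \sum_(v <- V) P v u <= A2) ->
  (forall v, v \in V -> \sum_(u <- U) Q v u <= A3) ->
  (lq_norm q [set` V] (fun v => (\sum_(u <- U) K v u * n u)%:E) <=
   (A1 `^ (theta - e) * A2 `^ e * A3 `^ (1 - theta))%:E * lq_norm q [set` U] (EFin \o n))%E.
Proof.
move=> et PA1 PA2 QA3; have [e_1|e_1] := eqVneq e 1.
  (* At e = 1 the exponent al is undefined, but theta = 1 and K = P. The matrix S has exponent 0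
     there, so any choice works; its entries are taken to be 1, with row sums the size of U. *)
  have th1 : theta = 1 by apply/eqP; rewrite eq_le theta1 -e_1 et.
  have := @schur_test _ _ U V q K (fun _ _ => 1) P (size U)%:R A2 n q1 K0 (fun _ _ => ler01) P0.
  rewrite -/e e_1 th1 subrr !powRr0 !mul1r !mulr1; apply => //.
  - by move=> v u _ _; rewrite /K th1 subrr powRr0 mulr1 mul1r.
  - by move=> v _; rewrite big_const_seq count_predT iter_addr addr0.
have e_lt1 : 0 < 1 - e by rewrite subr_gt0 lt_neqAle e_1.
pose al := (theta - e) / (1 - e).
have al01 : 0 <= al <= 1 by apply: frac; rewrite ?subr_ge0// lerD2r.
have al0 : 0 <= 1 - al by rewrite subr_ge0; case/andP: al01.
have alE : al * (1 - e) = theta - e by rewrite divfK// gt_eqF.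
have alE' : (1 - al) * (1 - e) = 1 - theta by rewrite mulrBl alE; ring.
pose S v u := P v u `^ al * Q v u `^ (1 - al).
have S0 v u : 0 <= S v u by rewrite mulr_ge0// powR_ge0.
have := @schur_test _ _ U V q K S P (A1 `^ al * A3 `^ (1 - al)) A2 n q1 K0 S0 P0.
rewrite -/e powRM ?powR_ge0// -!powRrM alE alE' => /(_ _ _ A2_ge0 _ PA2 n0).
rewrite mulrAC; apply.
- move=> v u _ _; rewrite /S powRM ?powR_ge0// -!powRrM alE alE' mulrAC -powR_addn ?subr_ge0//.
  by rewrite subrK.
- by rewrite mulr_ge0// powR_ge0.
- move=> v vV; apply: le_trans (hoelder_sum U al01 (P0 v) (Q0 v)) _.
  apply: ler_pM; rewrite ?powR_ge0//; apply: ge0_ler_powR; rewrite ?nnegrE ?sumr_ge0//.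
  + by case/andP: al01.
  + exact: PA1.
  + exact: QA3.
Qed.

(** The mixing moves to the columns: S = Q and Z = P^al Q^(1-al) with al = theta/e, so that Q^(1-e)
    Z^e = P^theta Q^(1-theta). The columns of Z are bounded through those of P and Q. *)
Lemma interpolate_gt : theta < e ->
  (forall u, u \in U -> \sum_(v <- V) Q v u <= A1) ->
  (forall u, u \in U -> \sum_(v <- V) P v u <= A2) ->
  (forall v, v \in V -> \sum_(u <- U) Q v u <= A3) ->
  (lq_norm q [set` V] (fun v => (\sum_(u <- U) K v u * n u)%:E) <=
   (A1 `^ (e - theta) * A2 `^ theta * A3 `^ (1 - e))%:E * lq_norm q [set` U] (EFin \o n))%E.
Proof.
move=> te QA1 PA2 QA3; have e_gt0 : 0 < e by rewrite (le_lt_trans theta0).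
pose al := theta / e.
have al01 : 0 <= al <= 1 by apply: frac => //; exact: ltW.
have al0 : 0 <= 1 - al by rewrite subr_ge0; case/andP: al01.
have alE : al * e = theta by rewrite divfK// gt_eqF.
have alE' : (1 - al) * e = e - theta by rewrite mulrBl alE mul1r.
pose Z v u := P v u `^ al * Q v u `^ (1 - al).
have Z0 v u : 0 <= Z v u by rewrite mulr_ge0// powR_ge0.
rewrite (_ : A1 `^ (e - theta) * A2 `^ theta * A3 `^ (1 - e) =
  A3 `^ (1 - e) * (A2 `^ theta * A1 `^ (e - theta))); last by ring.
have := @schur_test _ _ U V q K Q Z A3 (A2 `^ al * A1 `^ (1 - al)) n q1 K0 Q0 Z0.
rewrite -/e powRM ?powR_ge0// -!powRrM alE alE' => /(_ _ A3_ge0 _ QA3 _ n0).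
apply.
- move=> v u _ _; rewrite /Z powRM ?powR_ge0// -!powRrM alE alE' mulrCA.
  rewrite -powR_addn ?subr_ge0 ?(ltW te)//.
  by rewrite (_ : 1 - e + (e - theta) = 1 - theta)//; ring.
- by rewrite mulr_ge0// powR_ge0.
- move=> u uU; apply: le_trans (hoelder_sum V al01 (P0^~ u) (Q0^~ u)) _.
  apply: ler_pM; rewrite ?powR_ge0//; apply: ge0_ler_powR; rewrite ?nnegrE ?sumr_ge0//.
  + by case/andP: al01.
  + exact: PA2.
  + exact: QA1.
Qed.

End interpolation.

(** * Sums of products over subsets *)

Section product_weights.
Context {R : realType}.
Implicit Types (u v w : {fset nat}) (x : nat -> R).

Lemma prod_fset_if u v (x : nat -> R) : fsubset v u ->
  \prod_(j <- u) (if j \in v then x j else 1) = \prod_(j <- v) x j.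
Proof.
move=> vu; rewrite -big_mkcond/= big_fset_condE; apply: eq_fbigl => j.
by rewrite !inE/= andb_idl//; exact: (fsubsetP vu).
Qed.

Lemma prod_fsetD u v (x : nat -> R) : fsubset v u ->
  \prod_(j <- u) x j = \prod_(j <- v) x j * \prod_(j <- (u `\` v)%fset) x j.
Proof. by move=> vu; rewrite (perm_big _ (perm_fsetD vu)) big_cat. Qed.

Lemma sum_prod_col u x :
  \sum_(v <- fpowerset u) \prod_(j <- (u `\` v)%fset) x j = \prod_(j <- u) (1 + x j).
Proof.
rewrite (prod_fpowerset _ (fun=> 1)); apply: eq_big_seq => v; rewrite fpowersetE => vu.
rewrite -(prod_fset_if x (fsubsetDl u v)).
by apply: eq_big_seq => j ju; rewrite in_fsetD ju andbT; case: (j \in v).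
Qed.

(** On the sets containing v, the map from u to u \ v is injective with values in the subsets of w.
    The sum is therefore part of the expansion of the product over w, whose other terms are
    nonnegative. *)
Lemma sum_prod_row (U : {fset {fset nat}}) v w x : (forall j, 0 <= x j) ->
  (forall u, u \in U -> fsubset u w) ->
  \sum_(u <- U | fsubset v u) \prod_(j <- (u `\` v)%fset) x j <= \prod_(j <- w) (1 + x j).
Proof.
move=> x0 Uw; rewrite big_fset_condE; set U' := [fset u in U | _]%fset.
have inj : {in U' &, injective (fun u => u `\` v)%fset}.
  move=> u1 u2; rewrite !inE/= => /andP[_ v1] /andP[_ v2] e12.
  apply/fsetP => j; have /fsetP/(_ j) := e12; rewrite !in_fsetD.
  by case: (boolP (j \in v)) => //= jv _; rewrite (fsubsetP v1 _ jv) (fsubsetP v2 _ jv).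
have /= <- := big_imfset (GRing.add : Monoid.com_law 0) imfset_key
  (fun u : {fset nat} => \prod_(j <- u) x j : R) inj.
under [leRHS]eq_bigr do rewrite addrC.
rewrite (prod_fpowerset _ x (fun=> 1)).
set S := [fset _ | _ in _]%fset.
have Sw : fsubset S (fpowerset w).
  apply/fsubsetP => _ /imfsetP[u /= + ->]; rewrite !inE/= fpowersetE => /andP[uU _].
  exact: fsubset_trans (fsubsetDl _ _) (Uw u uU).
rewrite [leRHS](big_fsetID _ (mem S))/=.
rewrite (_ : \sum_(u <- S) _ = \sum_(i <- [fset x in fpowerset w | mem S x]%fset)
    \prod_(j <- w) (if j \in i then x j else 1)).
  by rewrite lerDl sumr_ge0// => i _; apply: prodr_ge0 => j _; case: ifP.
apply: eq_fbig => u.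
  by rewrite !inE/= andb_idl//; exact: (fsubsetP Sw).
by move=> uS; rewrite prod_fset_if// -fpowersetE; exact: (fsubsetP Sw).
Qed.

Lemma ler_prod_subset (w : {fset nat}) (l : seq nat) x : uniq l -> {subset w <= l} ->
  (forall j, j \in l -> 1 <= x j) -> \prod_(j <- w) x j <= \prod_(j <- l) x j.
Proof.
move=> ul wl x1; rewrite [leRHS](bigID (mem w))/=.
rewrite (_ : \prod_(i <- l | i \in w) x i = \prod_(j <- w) x j); last first.
  rewrite -big_filter; apply: perm_big; apply: uniq_perm.
  - exact: filter_uniq.
  - exact: fset_uniq.
  by move=> j; rewrite mem_filter andb_idr//; exact: wl.
rewrite ler_peMr//.
  by rewrite big_seq; apply: prodr_ge0 => j jw; rewrite (le_trans ler01)// x1// wl.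
rewrite big_seq_cond; elim/big_ind: _ => // [a b a1 b1|j /andP[jl _]]; last exact: x1.
by rewrite -[leLHS]mulr1; apply: ler_pM.
Qed.

End product_weights.

(** * Row and column sums bounded by the endpoint norms *)

Section endpoint_bounds.
Context {R : realType}.
Variables (s : option nat) (D : interval R) (psi omega : R -> R) (kappa : R -> R -> R).
Variable gamma : {fset nat} -> R.
Hypothesis D0 : 0 \in D.
Hypothesis psi_meas : measurable_fun [set` D] psi.
Hypothesis psi_ge0 : forall t, t \in D -> 0 <= psi t.
Hypothesis psi_gt0 : {ae lebesgue_measure, forall t, t \in D -> 0 < psi t}.
Hypothesis kappa_meas : measurable_fun ([set` D] `*` [set` D])
  (fun z : R * R => kappa z.1 z.2).
Hypothesis omega_meas : measurable_fun [set` D] omega.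
Hypothesis omega_ge0 : forall t, t \in D -> 0 <= omega t.
Hypothesis omega_int : (\int[lebesgue_measure]_(t in [set` D]) (omega t)%:E = 1)%E.
Hypothesis kappa0 : forall t, t \in D -> kappa 0 t = 0.
Hypothesis gamma_weights : downward_closed_weights s gamma.
Hypothesis kappa_bar_fin : forall q : \bar R, (1 <= q)%E ->
  (kappa_bar_norm D psi omega kappa q < +oo)%E.
Local Notation M := (mean_sup D psi omega kappa).
Local Notation B := (mean_int D omega kappa).
Local Notation emb := (embedding_norm s D psi omega kappa gamma).
Implicit Types (u v w : {fset nat}) (U V : {fset {fset nat}}).

Lemma weight_ratio_ge0 (c : R) v u : 0 <= c -> 0 < gamma v -> 0 < gamma u ->
  0 <= weight_ratio gamma c v u.
Proof.
move=> c0 gv gu; rewrite /weight_ratio; case: ifP => // _.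
by rewrite mulr_ge0 ?exprn_ge0// divr_ge0 ?ltW.
Qed.

Lemma weight_ratio_homo (x y : R) v u : 0 < gamma v -> 0 < gamma u ->
  0 <= x -> x <= y -> weight_ratio gamma x v u <= weight_ratio gamma y v u.
Proof.
move=> gv gu x0 xy; rewrite /weight_ratio; case: ifP => // _.
apply: ler_wpM2l; first by rewrite divr_ge0 ?ltW.
by apply: lerXn2r => //; rewrite nnegrE (le_trans x0).
Qed.

(** The entry as a polynomial in c, which is the form needed for the limit of c towards M. *)
Let weight_poly v u : {poly R} :=
  (if fsubset v u then gamma u / gamma v else 0) *: 'X^#|` (u `\` v)%fset|.

Let weight_polyE v u c : (weight_poly v u).[c] = weight_ratio gamma c v u.
Proof.
by rewrite /weight_poly /weight_ratio hornerZ hornerXn; case: ifP => //; rewrite mul0r.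
Qed.

Section summable_endpoint.
Hypothesis khat1 : forall x, x \in D -> (kappa_hat D psi kappa 1 x < +oo)%E.
Hypothesis inj1 : injective_K s D psi kappa 1.

Lemma embedding_norm_row1 U v : active s gamma U -> v \in down_closure U ->
  ((\sum_(u <- U) weight_ratio gamma M v u)%:E <= emb 1 +oo)%E.
Proof.
move=> Us vU; have [_ gv] := active_down_closure gamma_weights Us vU.
have PE c : (\sum_(u <- U) weight_poly v u).[c] = \sum_(u <- U) weight_ratio gamma c v u.
  by rewrite horner_sum; apply: eq_bigr => u _.
rewrite -PE; apply: horner_le_limit; last 2 first.
- exact: mean_sup_ge0.
- move=> eps eps0.
  have [e [c [me em0 emc ne Mc]]] := test_function_1 psi_meas psi_ge0 psi_gt0 kappa_meas
    omega_meas omega_ge0 omega_int kappa_bar_fin eps0.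
  exists c; split => //; first exact: tensor_int_ge0 em0 emc.
  by rewrite PE; apply: (embedding_norm_row _ _ _ _ _ _ _ _ _ _ _ _ _ me).
- move=> x y x0 xy; rewrite !PE big_seq [leRHS]big_seq; apply: ler_sum => u /Us[_ gu].
  exact: weight_ratio_homo.
Qed.

Lemma embedding_norm_col1 u : [set` u] `<=` coords s -> 0 < gamma u ->
  ((\sum_(v <- fpowerset u) weight_ratio gamma M v u)%:E <= emb 1 1)%E.
Proof.
move=> us gu.
have PE c : (\sum_(v <- fpowerset u) weight_poly v u).[c] =
    \sum_(v <- fpowerset u) weight_ratio gamma c v u.
  by rewrite horner_sum; apply: eq_bigr => v _.
rewrite -PE; apply: horner_le_limit; last 2 first.
- exact: mean_sup_ge0.
- move=> eps eps0.
  have [e [c [me em0 emc ne Mc]]] := test_function_1 psi_meas psi_ge0 psi_gt0 kappa_meas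
    omega_meas omega_ge0 omega_int kappa_bar_fin eps0.
  exists c; split => //; first exact: tensor_int_ge0 em0 emc.
  by rewrite PE; apply: (embedding_norm_col _ _ _ _ _ _ _ _ _ _ _ _ _ me).
- move=> x y x0 xy; rewrite !PE big_seq [leRHS]big_seq; apply: ler_sum => v.
  rewrite fpowersetE => vu; apply: weight_ratio_homo => //.
  exact: gamma_weights.2 us vu gu.
Qed.

End summable_endpoint.

Section bounded_endpoint.
Hypothesis khaty : forall x, x \in D -> (kappa_hat D psi kappa +oo x < +oo)%E.
Hypothesis injy : injective_K s D psi kappa +oo.

Lemma embedding_norm_rowy U v : active s gamma U -> v \in down_closure U ->
  ((\sum_(u <- U) weight_ratio gamma B v u)%:E <= emb +oo +oo)%E.
Proof.
have [me em0 emc ne] := test_function_y psi_meas kappa_meas omega_meas omega_ge0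
  omega_int kappa_bar_fin.
by apply: (embedding_norm_row _ _ _ _ _ _ _ _ _ _ _ _ _ me) => //; exact: leey.
Qed.

Lemma embedding_norm_coly u : [set` u] `<=` coords s -> 0 < gamma u ->
  ((\sum_(v <- fpowerset u) weight_ratio gamma B v u)%:E <= emb +oo 1)%E.
Proof.
have [me em0 emc ne] := test_function_y psi_meas kappa_meas omega_meas omega_ge0
  omega_int kappa_bar_fin.
by apply: (embedding_norm_col _ _ _ _ _ _ _ _ _ _ _ _ _ me) => //; exact: leey.
Qed.

End bounded_endpoint.

End endpoint_bounds.

Section weight_interpolation.
Context {R : realType}.
Variables (s : option nat) (gamma : {fset nat} -> R).
Hypothesis gamma_weights : downward_closed_weights s gamma.
Variables (q : \bar R) (M B theta A1 A2 A3 : R).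
Variables (U : {fset {fset nat}}) (n : {fset nat} -> R).
Hypothesis q1 : (1 <= q)%E.
Hypotheses (M0 : 0 <= M) (B0 : 0 <= B).
Hypotheses (theta0 : 0 <= theta) (theta1 : theta <= 1).
Hypotheses (A1_ge0 : 0 <= A1) (A2_ge0 : 0 <= A2) (A3_ge0 : 0 <= A3).
Hypothesis Us : active s gamma U.
Hypothesis n0 : forall u, 0 <= n u.
Local Notation V := (down_closure U).
Local Notation c := (M `^ theta * B `^ (1 - theta)).

Lemma weight_ratio_powR v u : 0 < gamma v -> 0 < gamma u ->
  weight_ratio gamma c v u =
  weight_ratio gamma M v u `^ theta * weight_ratio gamma B v u `^ (1 - theta).
Proof.
move=> gv gu; have th1 : theta + (1 - theta) = 1 by ring.
have th'0 : 0 <= 1 - theta by rewrite subr_ge0.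
rewrite /weight_ratio; case: ifP => _; last first.
  (* Off the support of the matrix, 0^theta and 0^(1-theta) are multiplied as one power of exponent
     1; so the value is 0 even if theta is 0 or 1, where one factor is 0^0 = 1. *)
  by rewrite -powR_addn// th1 powRr1.
have r0 : 0 <= gamma u / gamma v by rewrite divr_ge0 ?ltW.
move: (gamma u / gamma v) r0 => r r0.
rewrite !powRM ?exprn_ge0// mulrACA -powR_addn// th1 powRr1// exprMn.
by rewrite !powR_exprn.
Qed.

(** The interpolation asks for matrices that are nonnegative at all indices, whereas gamma is only
    controlled at active ones. Absolute values provide this and change nothing on U and its
    closure. *)
Let absE x v u : 0 <= x -> v \in V -> u \in U ->
  `|weight_ratio gamma x v u| = weight_ratio gamma x v u.
Proof.
move=> x0 /(active_down_closure gamma_weights Us)[_ gv] /Us[_ gu].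
by rewrite ger0_norm// weight_ratio_ge0.
Qed.

Let rowE x v : 0 <= x -> v \in V ->
  \sum_(u <- U) `|weight_ratio gamma x v u| = \sum_(u <- U) weight_ratio gamma x v u.
Proof. by move=> x0 vV; apply: eq_big_seq => u; exact: absE. Qed.

Let colE x u : 0 <= x -> u \in U ->
  \sum_(v <- V) `|weight_ratio gamma x v u| = \sum_(v <- fpowerset u) weight_ratio gamma x v u.
Proof.
move=> x0 uU; rewrite (big_fset_incl _ (_ : fsubset (fpowerset u) V))//.
- by apply: eq_big_seq => v vV; exact: absE.
- by apply/fsubsetP => v; rewrite fpowersetE => vu; apply/mem_down_closure; exists u.
- by move=> v _; rewrite fpowersetE /weight_ratio => /negPf ->.
Qed.

Let KE : (lq_norm q [set` V] (fun v => (\sum_(u <- U) weight_ratio gamma c v u * n u)%:E) <=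
  lq_norm q [set` V] (fun v => (\sum_(u <- U) (`|weight_ratio gamma M v u| `^ theta *
    `|weight_ratio gamma B v u| `^ (1 - theta)) * n u)%:E))%E.
Proof.
have E v : v \in V -> \sum_(u <- U) weight_ratio gamma c v u * n u =
    \sum_(u <- U) (`|weight_ratio gamma M v u| `^ theta *
    `|weight_ratio gamma B v u| `^ (1 - theta)) * n u.
  move=> vV; apply: eq_big_seq => u uU; rewrite !absE// weight_ratio_powR//.
    by case: (active_down_closure gamma_weights Us vV).
  by case: (Us uU).
apply: le_lq_norm => // v vV; rewrite lee_fin E//.
by apply: sumr_ge0 => u _; rewrite !mulr_ge0 ?powR_ge0.
Qed.

Lemma lq_norm_weight_le : expo q <= theta ->
  (forall v, v \in V -> \sum_(u <- U) weight_ratio gamma M v u <= A1) ->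
  (forall u, u \in U -> \sum_(v <- fpowerset u) weight_ratio gamma M v u <= A2) ->
  (forall v, v \in V -> \sum_(u <- U) weight_ratio gamma B v u <= A3) ->
  (lq_norm q [set` V] (fun v => (\sum_(u <- U) weight_ratio gamma c v u * n u)%:E) <=
   (A1 `^ (theta - expo q) * A2 `^ expo q * A3 `^ (1 - theta))%:E *
   lq_norm q [set` U] (EFin \o n))%E.
Proof.
move=> et rM cM rB; apply: le_trans KE _; apply: interpolate_le => //.
- by move=> v vV; rewrite rowE// rM.
- by move=> u uU; rewrite colE// cM.
- by move=> v vV; rewrite rowE// rB.
Qed.

Lemma lq_norm_weight_gt : theta < expo q ->
  (forall u, u \in U -> \sum_(v <- fpowerset u) weight_ratio gamma B v u <= A1) ->
  (forall u, u \in U -> \sum_(v <- fpowerset u) weight_ratio gamma M v u <= A2) ->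
  (forall v, v \in V -> \sum_(u <- U) weight_ratio gamma B v u <= A3) ->
  (lq_norm q [set` V] (fun v => (\sum_(u <- U) weight_ratio gamma c v u * n u)%:E) <=
   (A1 `^ (expo q - theta) * A2 `^ theta * A3 `^ (1 - expo q))%:E *
   lq_norm q [set` U] (EFin \o n))%E.
Proof.
move=> et cB cM rB; apply: le_trans KE _; apply: interpolate_gt => //.
- by move=> u uU; rewrite colE// cB.
- by move=> u uU; rewrite colE// cM.
- by move=> v vV; rewrite rowE// rB.
Qed.

End weight_interpolation.

(** * Infinite endpoint norms *)

Section extended_constants.
Context {R : realType}.
Local Open Scope ereal_scope.

(** A finite power of E forces E to be finite unless the exponent is 0. In that case the power is 1
    for every base, and any real bound of the finitely many values of f can replace E. *)
Lemma real_bound_poweR (I : choiceType) (V : {fset I}) (f : I -> R) (E : \bar R) (x : R) :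
  1 <= E -> E `^ x < +oo -> (forall v, v \in V -> (f v)%:E <= E) ->
  exists A : R, [/\ (0 <= A)%R, (forall v, v \in V -> f v <= A)%R & E `^ x = (A `^ x)%:E].
Proof.
move=> E1 Ex fE; have [Ey|Ey] := eqVneq E +oo; last first.
  have Efin : E \is a fin_num by rewrite ge0_fin_numE ?ltey// (le_trans _ E1).
  exists (fine E); split.
  - by rewrite fine_ge0// (le_trans _ E1).
  - by move=> v /fE; rewrite -lee_fin fineK.
  - by rewrite -{1}(fineK Efin).
have x0 : x = 0%R.
  by apply/eqP; apply: contraTT Ex => x0; rewrite Ey poweRyr// ltxx.
exists (\sum_(v <- V) `|f v|)%R; rewrite x0 poweRe0 powRr0; split => //.
  exact: sumr_ge0.
move=> v vV; rewrite (big_fsetD1 v)//= (le_trans (ler_norm _))// lerDl.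
exact: sumr_ge0.
Qed.

(** Factors at least 1 exclude the product of 0 and +oo, so an infinite factor would make the whole
    product infinite. *)
Lemma mule3_lty (a b d : \bar R) : 1 <= a -> 1 <= b -> 1 <= d ->
  a * b * d < +oo -> [/\ a < +oo, b < +oo & d < +oo].
Proof.
move=> a1 b1 d1; have gt0 (z : \bar R) : 1 <= z -> 0 < z by exact: lt_le_trans.
have lt2 (y z : \bar R) : 1 <= y -> 1 <= z -> y * z < +oo -> y < +oo /\ z < +oo.
  move=> y1 z1 yz; split; rewrite ltey; apply/eqP => e; move: yz; rewrite e.
    by rewrite gt0_mulye ?ltxx// gt0.
  by rewrite gt0_muley ?ltxx// gt0.
move=> /lt2[||/lt2[] // aoo boo doo] //.
by rewrite -[leLHS]mule1; apply: lee_pmul.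
Qed.

Lemma poweR_ge1 (E : \bar R) (x : R) : 1 <= E -> (0 <= x)%R -> 1 <= E `^ x.
Proof. by move=> E1 x0; rewrite -(poweR1r x); apply: ler_poweR. Qed.

End extended_constants.

Section exponent_order.
Context {R : realType}.

Lemma le_expo (p q : \bar R) : (1 <= p)%E -> (1 <= q)%E -> (p <= q)%E -> expo q <= expo p.
Proof.
move=> p1 /ge1_cases[->|[r r1 ->]]; first by rewrite expoy expo_ge0.
case: (ge1_cases p1) => [->|[t t1 ->]]; first by rewrite leNgt ltry.
rewrite lee_fin !expoE => tr; rewrite lef_pV2// posrE.
  exact: lt_le_trans r1.
exact: lt_le_trans t1.
Qed.

Lemma lt_expo (p q : \bar R) : (1 <= p)%E -> (1 <= q)%E -> (q < p)%E -> expo p < expo q.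
Proof.
move=> /ge1_cases[->|[t t1 ->]] /ge1_cases[->|[r r1 ->]] qp.
- by rewrite ltxx in qp.
- by rewrite expoy expoE invr_gt0 (lt_le_trans _ r1).
- by move: qp; rewrite ltNge leey.
move: qp; rewrite lte_fin !expoE => qp; rewrite ltf_pV2// posrE.
  exact: lt_le_trans t1.
exact: lt_le_trans r1.
Qed.

(** The empty family is settled separately: lower bounds by 1 for the endpoint norms need an active
    set u. *)
Lemma lq_norm_down_closure0 (q : \bar R) (a : {fset nat} -> \bar R) : (1 <= q)%E ->
  lq_norm q [set` down_closure fset0] a = 0%E.
Proof.
have -> : down_closure fset0 = fset0.
  apply/fsetP => v; rewrite in_fset0; apply/negbTE/negP => /mem_down_closure[u].
  by rewrite in_fset0.
move=> /ge1_cases[->|[r r1 ->]].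
  by apply/eqP; rewrite eq_le lq_norm_ge0 lq_norm_fsety_le.
by rewrite lq_norm_fsetr big_seq_fset0 poweR0r// invr_neq0// gt_eqF// (lt_le_trans _ r1).
Qed.

Variables (s : option nat) (gamma : {fset nat} -> R).
Hypothesis gamma_weights : downward_closed_weights s gamma.

Lemma weight_ratio_diag (c : R) u : 0 < gamma u -> weight_ratio gamma c u u = 1.
Proof.
move=> gu; rewrite /weight_ratio fsubset_refl fsetDv cardfs0 expr0 mulr1 divff//.
by rewrite gt_eqF.
Qed.

(** The diagonal entry is 1 and the others are nonnegative. With the analogue for columns, this
    makes every endpoint norm at least 1. *)
Lemma row_ge1 (c : R) U (u : {fset nat}) : active s gamma U -> u \in U -> 0 <= c ->
  1 <= \sum_(w <- U) weight_ratio gamma c u w.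
Proof.
move=> Us uU c0; have [_ gu] := Us u uU.
rewrite (big_fsetD1 u)//= weight_ratio_diag// lerDl big_seq; apply: sumr_ge0 => w.
by rewrite in_fsetD1 => /andP[_ /Us[_ gw]]; exact: weight_ratio_ge0.
Qed.

Lemma col_ge1 (c : R) (u : {fset nat}) : [set` u] `<=` coords s -> 0 < gamma u -> 0 <= c ->
  1 <= \sum_(v <- fpowerset u) weight_ratio gamma c v u.
Proof.
move=> us gu c0; rewrite (big_fsetD1 u)/= ?fpowersetE// weight_ratio_diag// lerDl big_seq.
apply: sumr_ge0 => v; rewrite in_fsetD1 fpowersetE => /andP[_ vu].
by apply: weight_ratio_ge0 => //; exact: gamma_weights.2 us vu gu.
Qed.

End exponent_order.

Section coordinate_products.
Context {R : realType}.

(** A finite set of coordinates lies in an initial segment, and factors at least 1 can only enlarge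
    the product. For infinite s they also make the partial products nondecreasing, so the limit is
    their supremum. *)
Lemma ge_coords_prod (s : option nat) (a : nat -> R) (w : {fset nat}) :
  (forall j, (0 < j)%N -> 1 <= a j) -> [set` w] `<=` coords s ->
  ((\prod_(j <- w) a j)%:E <= coords_prod s (EFin \o a))%E.
Proof.
move=> a1 ws.
have prodE m : (\prod_(1 <= j < m.+1) (EFin \o a) j = (\prod_(1 <= j < m.+1) a j)%:E)%E.
  by rewrite prodEFin.
have le_prod m : (forall j, j \in w -> (j <= m)%N) ->
    \prod_(j <- w) a j <= \prod_(1 <= j < m.+1) a j.
  move=> wm; apply: ler_prod_subset; first exact: iota_uniq.
    move=> j jw; rewrite mem_index_iota ltnS wm// andbT.
    by have := ws j jw; rewrite /coords/= => /andP[].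
  by move=> j; rewrite mem_index_iota => /andP[j0 _]; exact: a1.
case: s ws => [m|] ws.
  rewrite /coords_prod prodE lee_fin; apply: le_prod => j jw.
  by have := ws j jw; rewrite /coords/= => /andP[].
pose m := (\max_(j <- w) j)%N.
have wm j : j \in w -> (j <= m)%N by move=> jw; exact: leq_bigmax_seq.
apply: (@le_trans _ _ (\prod_(1 <= j < m.+1) a j)%:E); first by rewrite lee_fin le_prod.
have nd : nondecreasing_seq (fun k => (\prod_(1 <= j < k.+1) (EFin \o a) j)%E).
  apply/nondecreasing_seqP => k; rewrite !prodE lee_fin [leRHS]big_nat_recr//=.
  rewrite ler_peMr ?a1//; rewrite big_seq; apply: prodr_ge0 => j.
  by rewrite mem_index_iota => /andP[j0 _]; rewrite (le_trans ler01)// a1.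
rewrite /coords_prod -prodE (cvg_lim _ (ereal_nondecreasing_cvgn nd))//.
by apply: ereal_sup_ubound; exists m.
Qed.

End coordinate_products.

Section product_weight_bounds.
Context {R : realType}.
Variables (s : option nat) (gamma : {fset nat} -> R) (gam : nat -> R).
Hypothesis gam0 : forall j, (0 < j)%N -> 0 < gam j.
Hypothesis gamE : forall u : {fset nat}, [set` u] `<=` coords s ->
  gamma u = \prod_(j <- u) gam j.
Variable U : {fset {fset nat}}.
Hypothesis Us : active s gamma U.
Variable z : R.
Hypothesis z0 : 0 <= z.

Let W : {fset nat} := (\bigcup_(u <- U) u)%fset.
(* The absolute value only matters at the junk index 0. *)
Let x (j : nat) := `|gam j| * z.
Let x0 j : 0 <= x j. Proof. by rewrite mulr_ge0. Qed.

Let subW u : u \in U -> fsubset u W.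
Proof.
by move=> uU; apply/fsubsetP => j ju; apply/bigfcupP; exists u; rewrite ?uU.
Qed.

Let ratioE v u : u \in U -> fsubset v u ->
  weight_ratio gamma z v u = \prod_(j <- (u `\` v)%fset) x j.
Proof.
move=> uU vu; have [us gu] := Us uU.
have vs : [set` v] `<=` coords s by move=> j /= jv; apply: us; exact: (fsubsetP vu).
have jpos j : j \in u -> (0 < j)%N by move=> /us; rewrite /coords/= => /andP[].
have gv : 0 < \prod_(j <- v) gam j.
  rewrite big_seq; apply: prodr_gt0 => j jv; apply/gam0/jpos; exact: (fsubsetP vu).
rewrite /weight_ratio vu !gamE// (prod_fsetD gam vu) [X in X / _]mulrC mulfK ?gt_eqF//.
have -> : z ^+ #|` (u `\` v)%fset| = \prod_(j <- (u `\` v)%fset) z.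
  by rewrite big_const_seq count_predT; elim: #|` _| => [|k IH] /=; rewrite ?expr0// exprS IH.
rewrite -big_split/=; apply: eq_big_seq => j; rewrite in_fsetD => /andP[_ ju].
by rewrite /x gtr0_norm// gam0// jpos.
Qed.

Lemma product_weight_row v :
  \sum_(u <- U) weight_ratio gamma z v u <= \prod_(j <- W) (1 + `|gam j| * z).
Proof.
apply: le_trans (sum_prod_row v x0 subW).
rewrite [leLHS](bigID (fsubset v))/= [X in _ + X]big1 ?addr0; last first.
  by move=> u /negPf vu; rewrite /weight_ratio vu.
rewrite big_seq_cond [leRHS]big_seq_cond; apply: ler_sum => u /andP[uU vu].
by rewrite ratioE.
Qed.

Lemma product_weight_col u : u \in U ->
  \sum_(v <- fpowerset u) weight_ratio gamma z v u <= \prod_(j <- W) (1 + `|gam j| * z).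
Proof.
move=> uU; rewrite (eq_big_seq (fun v => \prod_(j <- (u `\` v)%fset) x j)); last first.
  by move=> v; rewrite fpowersetE; exact: ratioE.
rewrite sum_prod_col; apply: ler_prod_subset; first exact: fset_uniq.
  by move=> j; apply/fsubsetP/subW.
by move=> j _; rewrite lerDl x0.
Qed.

End product_weight_bounds.

Theorem corollary9 (R : realType) (s : option nat) (D : interval R)
    (psi omega : R -> R) (kappa : R -> R -> R) (gamma : {fset nat} -> R)
    (p1 p2 : \bar R)
    (s_neq0 : s <> Some 0%N)
    (D0 : 0 \in D)
    (psi_meas : measurable_fun [set` D] psi)
    (psi_ge0 : forall t, t \in D -> 0 <= psi t)
    (psi_gt0 : {ae lebesgue_measure, forall t, t \in D -> 0 < psi t})
    (kappa_meas : measurable_fun ([set` D] `*` [set` D])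
      (fun z : R * R => kappa z.1 z.2))
    (omega_meas : measurable_fun [set` D] omega)
    (omega_ge0 : forall t, t \in D -> 0 <= omega t)
    (omega_int : (\int[lebesgue_measure]_(t in [set` D]) (omega t)%:E = 1)%E)
    (kappa0 : forall t, t \in D -> kappa 0 t = 0)
    (gamma_weights : downward_closed_weights s gamma)
    (p1_ge1 : (1 <= p1)%E) (p2_ge1 : (1 <= p2)%E)
    (H_p1p2 : standing_assumptions s D psi kappa gamma p1 p2)
    (H_11 : standing_assumptions s D psi kappa gamma 1%E 1%E)
    (H_oooo : standing_assumptions s D psi kappa gamma +oo%E +oo%E)
    (H_1oo : (p1 <= p2)%E -> standing_assumptions s D psi kappa gamma 1%E +oo%E)
    (H_oo1 : (p2 < p1)%E -> standing_assumptions s D psi kappa gamma +oo%E 1%E)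
    (kappa_bar_fin : forall q : \bar R, (1 <= q)%E ->
      (kappa_bar_norm D psi omega kappa q < +oo)%E) :
  let emb q1 q2 := embedding_norm s D psi omega kappa gamma q1 q2 in
  [/\ (p1 <= p2)%E ->
        (emb p1 p2 <= emb 1 +oo `^ (expo p1 - expo p2)%R *
                       emb 1 1 `^ expo p2 *
                       emb +oo +oo `^ (1 - expo p1)%R)%E,
      (p2 < p1)%E ->
        (emb p1 p2 <= emb +oo 1 `^ (expo p2 - expo p1)%R *
                       emb 1 1 `^ expo p1 *
                       emb +oo +oo `^ (1 - expo p2)%R)%E &
      forall gam : nat -> R,
        (forall j, (0 < j)%N -> 0 < gam j) ->
        (forall i j, (0 < i <= j)%N -> gam j <= gam i) ->
        (forall u : {fset nat}, [set` u] `<=` coords s ->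
          gamma u = \prod_(j <- u) gam j) ->
        (emb p1 p2 <= coords_prod s (fun j =>
           (1 + (gam j)%:E * kappa_bar_norm D psi omega kappa 1) `^ expo p1 *
           (1 + (gam j)%:E * kappa_bar_norm D psi omega kappa +oo)
             `^ (1 - expo p1)%R))%E].
Proof.
move=> emb; have [kh inj _] := H_p1p2; have [kh1 inj1 _] := H_11.
have [khy injy _] := H_oooo.
set M := mean_sup D psi omega kappa; set B := mean_int D omega kappa.
have M0 : 0 <= M := mean_sup_ge0 D psi omega kappa.
have B0 : 0 <= B := mean_int_ge0 D omega kappa.
have th0 := expo_ge0 p1_ge1; have th1 := expo_le1 p1_ge1.
have e0 := expo_ge0 p2_ge1; have e1 := expo_le1 p2_ge1.
have row1 (U : {fset {fset nat}}) (v : {fset nat}) : active s gamma U -> v \in down_closure U ->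
    ((\sum_(u <- U) weight_ratio gamma M v u)%:E <= emb 1 +oo)%E.
  exact: (embedding_norm_row1 D0 psi_meas psi_ge0 psi_gt0 kappa_meas omega_meas
    omega_ge0 omega_int kappa0 gamma_weights kappa_bar_fin kh1 inj1).
have col1 (u : {fset nat}) : [set` u] `<=` coords s -> 0 < gamma u ->
    ((\sum_(v <- fpowerset u) weight_ratio gamma M v u)%:E <= emb 1 1)%E.
  exact: (embedding_norm_col1 D0 psi_meas psi_ge0 psi_gt0 kappa_meas omega_meas
    omega_ge0 omega_int kappa0 gamma_weights kappa_bar_fin kh1 inj1).
have rowy (U : {fset {fset nat}}) (v : {fset nat}) : active s gamma U -> v \in down_closure U ->
    ((\sum_(u <- U) weight_ratio gamma B v u)%:E <= emb +oo +oo)%E.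
  exact: (embedding_norm_rowy D0 psi_meas psi_ge0 psi_gt0 kappa_meas omega_meas
    omega_ge0 omega_int kappa0 gamma_weights kappa_bar_fin khy injy).
have coly (u : {fset nat}) : [set` u] `<=` coords s -> 0 < gamma u ->
    ((\sum_(v <- fpowerset u) weight_ratio gamma B v u)%:E <= emb +oo 1)%E.
  exact: (embedding_norm_coly D0 psi_meas psi_ge0 psi_gt0 kappa_meas omega_meas
    omega_ge0 omega_int kappa0 gamma_weights kappa_bar_fin khy injy).
(* It remains to treat real constants C and nonempty families: C = +oo is trivial, and the empty
   family has norm 0. *)
have upper (C : \bar R) : (0 <= C)%E ->
    (forall (U : {fset {fset nat}}) (n : {fset nat} -> R), C \is a fin_num ->
      active s gamma U -> (exists u, u \in U) -> (forall u, 0 <= n u) ->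
      (lq_norm p2 [set` down_closure U] (fun v => (\sum_(u <- U)
         weight_ratio gamma (M `^ expo p1 * B `^ (1 - expo p1)) v u * n u)%:E) <=
       C * lq_norm p2 [set` U] (EFin \o n))%E) ->
    (emb p1 p2 <= C)%E.
  move=> C0 HC; have [->|Cfin] := eqVneq C +oo%E; first exact: leey.
  have CE : C \is a fin_num by rewrite ge0_fin_numE// ltey.
  rewrite -(fineK CE); apply: embedding_norm_le => //; first by rewrite fine_ge0.
  move=> U n Us n0; rewrite fineK//; have [U0|[u uU]] := fset_0Vmem U.
    by rewrite U0 lq_norm_down_closure0// mule_ge0 ?lq_norm_ge0.
  by apply: HC => //; exists u.
have dcU (U : {fset {fset nat}}) u : u \in U -> u \in down_closure U.
  by move=> uU; apply/mem_down_closure; exists u.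
have kb1 := kappa_bar_fin 1%E (lexx _); have kby := kappa_bar_fin +oo%E (leey _).
have Mk1 := mean_sup_le psi_meas psi_ge0 kappa_meas omega_meas omega_ge0 kb1.
have Bky := mean_int_le psi_meas kappa_meas omega_meas omega_ge0 kby.
have fin_real (z : \bar R) : (0 <= z)%E -> (z < +oo)%E -> exists k, z = k%:E.
  by move=> z0 zy; exists (fine z); rewrite fineK// ge0_fin_numE.
have [k1 k1E] : exists k, kappa_bar_norm D psi omega kappa 1 = k%:E :=
  fin_real _ (Lnorm_ge0 _ _ _) kb1.
have [ky kyE] : exists k, kappa_bar_norm D psi omega kappa +oo = k%:E :=
  fin_real _ (Lnorm_ge0 _ _ _) kby.
move: Mk1 Bky; rewrite k1E kyE !lee_fin -/M -/B => Mk1 Bky.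
clearbody emb M B; split.
- move=> p12; have et := le_expo p1_ge1 p2_ge1 p12.
  apply: upper => [|U n Cfin Us [u uU] n0]; first by rewrite !mule_ge0 ?poweR_ge0.
  have [us gu] := Us u uU.
  have E1 : (1 <= emb 1 +oo)%E.
    by apply: le_trans (row1 _ _ Us (dcU _ _ uU)); rewrite lee_fin; exact: (row_ge1 Us).
  have E2 : (1 <= emb 1 1)%E.
    by apply: le_trans (col1 _ us gu); rewrite lee_fin; exact: (col_ge1 gamma_weights).
  have E3 : (1 <= emb +oo +oo)%E.
    by apply: le_trans (rowy _ _ Us (dcU _ _ uU)); rewrite lee_fin; exact: (row_ge1 Us).
  have RHSy : (emb 1 +oo `^ (expo p1 - expo p2) * emb 1 1 `^ expo p2 *
      emb +oo +oo `^ (1 - expo p1) < +oo)%E.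
    by rewrite -ge0_fin_numE// !mule_ge0 ?poweR_ge0.
  have te0 : 0 <= expo p1 - expo p2 by rewrite subr_ge0.
  have t10 : 0 <= 1 - expo p1 by rewrite subr_ge0.
  (* The right-hand side is finite and its three factors are at least 1, so each is finite. This
     allows every endpoint norm to be replaced by a real constant with the same power. *)
  have [b1 b2 b3] := mule3_lty (poweR_ge1 E1 te0) (poweR_ge1 E2 e0) (poweR_ge1 E3 t10) RHSy.
  have [A1 [A1_0 A1b ->]] := real_bound_poweR E1 b1 (fun v vV => row1 U v Us vV).
  have [A2 [A2_0 A2b ->]] := real_bound_poweR E2 b2
    (fun u (uU : u \in U) => col1 u (Us u uU).1 (Us u uU).2).
  have [A3 [A3_0 A3b ->]] := real_bound_poweR E3 b3 (fun v vV => rowy U v Us vV).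
  by rewrite -!EFinM; exact: (lq_norm_weight_le gamma_weights).
- move=> p21; have te := lt_expo p1_ge1 p2_ge1 p21.
  apply: upper => [|U n Cfin Us [u uU] n0]; first by rewrite !mule_ge0 ?poweR_ge0.
  have [us gu] := Us u uU.
  have E1 : (1 <= emb +oo 1)%E.
    by apply: le_trans (coly _ us gu); rewrite lee_fin; exact: (col_ge1 gamma_weights).
  have E2 : (1 <= emb 1 1)%E.
    by apply: le_trans (col1 _ us gu); rewrite lee_fin; exact: (col_ge1 gamma_weights).
  have E3 : (1 <= emb +oo +oo)%E.
    by apply: le_trans (rowy _ _ Us (dcU _ _ uU)); rewrite lee_fin; exact: (row_ge1 Us).
  have RHSy : (emb +oo 1 `^ (expo p2 - expo p1) * emb 1 1 `^ expo p1 *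
      emb +oo +oo `^ (1 - expo p2) < +oo)%E.
    by rewrite -ge0_fin_numE// !mule_ge0 ?poweR_ge0.
  have te0 : 0 <= expo p2 - expo p1 by rewrite subr_ge0 ltW.
  have e10 : 0 <= 1 - expo p2 by rewrite subr_ge0.
  have [b1 b2 b3] := mule3_lty (poweR_ge1 E1 te0) (poweR_ge1 E2 th0) (poweR_ge1 E3 e10) RHSy.
  have [A1 [A1_0 A1b ->]] := real_bound_poweR E1 b1
    (fun u (uU : u \in U) => coly u (Us u uU).1 (Us u uU).2).
  have [A2 [A2_0 A2b ->]] := real_bound_poweR E2 b2
    (fun u (uU : u \in U) => col1 u (Us u uU).1 (Us u uU).2).
  have [A3 [A3_0 A3b ->]] := real_bound_poweR E3 b3 (fun v vV => rowy U v Us vV).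
  by rewrite -!EFinM; exact: (lq_norm_weight_gt gamma_weights).
- move=> gam gam0 _ gamE.
  pose a j := (1 + gam j * k1) `^ expo p1 * (1 + gam j * ky) `^ (1 - expo p1).
  rewrite (_ : (fun j => _) = EFin \o a); last by apply/funext => j; rewrite /= /a EFinM.
  have th'0 : 0 <= 1 - expo p1 by rewrite subr_ge0.
  have base1 (y z : R) : 0 <= y -> 0 <= z -> 1 <= 1 + y * z.
    by move=> y0 z0; rewrite lerDl mulr_ge0.
  have k10 : 0 <= k1 := le_trans M0 Mk1.
  have ky0 : 0 <= ky := le_trans B0 Bky.
  have pow1 (y r : R) : 1 <= y -> 0 <= r -> 1 <= y `^ r.
    by move=> y1 r0; rewrite -lee_fin -poweR_EFin poweR_ge1// lee_fin.
  have a1 j : (0 < j)%N -> 1 <= a j.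
    move=> /gam0/ltW gj; rewrite -[leLHS]mulr1.
    by apply: ler_pM => //; apply: pow1 => //; exact: base1.
  have prod_ge0 : (0 <= coords_prod s (EFin \o a))%E.
    apply: le_trans (@ge_coords_prod _ _ _ fset0 a1 _); last by move=> j /=; rewrite in_fset0.
    by rewrite lee_fin prodr_ge0// => j _; rewrite mulr_ge0// powR_ge0.
  apply: upper => // U n Cfin Us [u uU] n0.
  (* A finite family involves only the finitely many coordinates in W, so the bounds PM and PB are
     finite products even if s is infinite. *)
  pose W : {fset nat} := (\bigcup_(u <- U) u)%fset.
  have Ws : [set` W] `<=` coords s.
    by move=> j /= /bigfcupP[v /andP[vU _] jv]; have [vs _] := Us v vU; exact: vs.
  pose PM := \prod_(j <- W) (1 + `|gam j| * M).
  pose PB := \prod_(j <- W) (1 + `|gam j| * B).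
  have PM0 : 0 <= PM by apply: prodr_ge0 => j _; rewrite addr_ge0// mulr_ge0.
  have PB0 : 0 <= PB by apply: prodr_ge0 => j _; rewrite addr_ge0// mulr_ge0.
  apply: (@le_trans _ _ ((PM `^ expo p1 * PB `^ (1 - expo p1))%:E *
      lq_norm p2 [set` U] (EFin \o n))%E); last first.
    apply: lee_wpmul2r; first exact: lq_norm_ge0.
    apply: le_trans (ge_coords_prod a1 Ws); rewrite lee_fin !powR_prod; last 2 first.
    - by move=> j; rewrite addr_ge0// mulr_ge0.
    - by move=> j; rewrite addr_ge0// mulr_ge0.
    rewrite -big_split/= big_seq [leRHS]big_seq; apply: ler_prod => j jW.
    have gj : 0 < gam j by apply: gam0; have := Ws j jW; rewrite /coords/= => /andP[].
    rewrite (gtr0_norm gj) mulr_ge0 ?powR_ge0//=.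
    have mono (y y' r : R) : 0 <= y -> y <= y' -> 0 <= r ->
        (1 + gam j * y) `^ r <= (1 + gam j * y') `^ r.
      move=> y0 yy r0; have gj0 := ltW gj; apply: ge0_ler_powR => //.
      + by rewrite nnegrE addr_ge0// mulr_ge0.
      + by rewrite nnegrE addr_ge0// mulr_ge0// (le_trans y0).
      by rewrite lerD2l ler_wpM2l.
    by apply: ler_pM; rewrite ?powR_ge0//; exact: mono.
  have rowM := product_weight_row gam0 gamE Us M0.
  have rowB := product_weight_row gam0 gamE Us B0.
  have colM := product_weight_col gam0 gamE Us M0.
  have colB := product_weight_col gam0 gamE Us B0.
  (* Rows and columns obey the same bound, PM for M and PB for B. In both cases the three powers of
     the interpolation therefore recombine into PM^(1/p1) PB^(1-1/p1), in which p2 no longer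
     appears. *)
  have [et|te] := leP (expo p2) (expo p1).
    have -> : PM `^ expo p1 * PB `^ (1 - expo p1) =
        PM `^ (expo p1 - expo p2) * PM `^ expo p2 * PB `^ (1 - expo p1).
      by rewrite -powR_addn ?subr_ge0// subrK.
    exact: (lq_norm_weight_le gamma_weights).
  have -> : PM `^ expo p1 * PB `^ (1 - expo p1) =
      PB `^ (expo p2 - expo p1) * PM `^ expo p1 * PB `^ (1 - expo p2).
    rewrite mulrAC -powR_addn ?subr_ge0 ?(ltW te)// mulrC; congr (_ `^ _ * _); ring.
  exact: (lq_norm_weight_gt gamma_weights).
Qed.
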